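(* For $\lambda\in\mathbb Z_+^n$ we have $$\mathrm{ch}\,L^0(\Lambda(\lambda))=\det\left(\mathrm{ch}\,L^0(\Lambda(\lambda_i-i+j))\right)_{1\le i,j\le n},$$ where $L^0(\Lambda(\lambda))$ is the irreducible highest weight $\widehat{\mathfrak{gl}}_\infty$-module associated with $\lambda$, and in the determinant each integer $\lambda_i-i+j$ is regarded as an element of $\mathbb Z_+^1=\mathbb Z$ (generalized partition of level $1$).
   Context: $\mathfrak{gl}_\infty$ is the Lie algebra of complex matrices $(a_{ij})_{i,j\in\mathbb Z}$ with $a_{ij}=0$ for $|i-j|\gg0$; $e_{ij}$ are elementary matrices. $\widehat{\mathfrak{gl}}_\infty=\mathfrak{gl}_\infty\oplus\mathbb CK$ is the central extension by the two-cocycle $\alpha(A,B)=\mathrm{tr}([J,A]B)$, $J=\sum_{r\le0}e_{rr}$. It has a triangular decomposition $\mathfrak n^0_+\oplus\mathfrak h^0\oplus\mathfrak n^0_-$, with $\mathfrak h^0$ spanned by diagonal matrices and $K$, and $\mathfrak n^0_+$ (resp. $\mathfrak n^0_-$) the strictly upper (resp. lower) triangular matrices. $L^0(\Lambda)$ is the irreducible highest weight module with highest weight $\Lambda\in(\mathfrak h^0)^*$. $\mathbb Z_+^n=\{\lambda\in\mathbb Z^n:\lambda_1\ge\dots\ge\lambda_n\}$. For $\lambda\in\mathbb Z_+^n$, $\Lambda(\lambda)\in(\mathfrak h^0)^*$ is determined by $\Lambda(\lambda)(K)=-n$ and $\Lambda(\lambda)(e_{kk})=\lambda_k$ if $1\le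 k\le n$ and $\lambda_k>0$; $=\lambda_{n+k}$ if $-n<k\le0$ and $\lambda_{n+k}<0$; $=0$ otherwise (its value on a diagonal matrix is the corresponding finite sum). The character $\mathrm{ch}$ is taken with respect to the action of $\bigoplus_{k\in\mathbb Z}\mathbb Ce_{kk}$ (so the eigenvalue of $K$ is not recorded), as a formal series in $x_k=e^{\omega_k}$ ($k>0$) and $x_k^{-1}$ ($k\le0$), where $\omega_k(e_{ll})=\delta_{kl}$, $\omega_k(K)=0$. *)

(* Defs.v *)
From HB Require Import structures.
From mathcomp Require Import all_boot all_order all_algebra finmap.
From mathcomp Require Import boolp classical_sets functions cardinality fsbigop.
From mathcomp Require Import reals complex.
From mathcomp Require Import monalg.

Set Implicit Arguments.
Unset Strict Implicit.
Unset Printing Implicit Defensive.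

Import Order.TTheory GRing.Theory Num.Theory.

Local Open Scope classical_set_scope.
Local Open Scope ring_scope.

(* Formal power series over K in the (possibly infinitely many) commuting
   variables indexed by I, given by their coefficients. The product is the
   convolution; it is well defined as a monomial has finitely many divisors. *)
Definition fps (I : choiceType) (K : comNzRingType) : Type := {cmonom I} -> K.

Section FormalPowerSeries.
Variables (I : choiceType) (K : comNzRingType).
Implicit Types (f g h : fps I K) (m : {cmonom I}).

HB.instance Definition _ := GRing.Zmodule.copy (fps I K) ({cmonom I} -> K).

Definition fps_one : fps I K := fun m => (m == mone)%:R.

Definition fps_mul f g : fps I K := fun m =>
  \sum_(p \in [set p : {cmonom I} * {cmonom I} | mmul p.1 p.2 = m])
    f p.1 * g p.2.

Lemma finite_divisors m : finite_set [set a : {cmonom I} | exists b, mmul a b = m].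
Proof.
pose N := (\max_(i : finsupp m) m (val i))%N.
pose G (F : {ffun finsupp m -> 'I_N.+1}) : {cmonom I} :=
  mkcmonom [fsfun i : finsupp m => nat_of_ord (F i) | 0%N].
apply: (@sub_finite_set _ _ (G @` setT)); last first.
  by apply: finite_image; exact: finite_finset.
move=> a /= [b ab].
have le_am i : (a i <= m i)%N by rewrite -ab cmM leq_addr.
exists [ffun i : finsupp m => inord (a (val i))] => //.
apply/eqP/cmP => i; rewrite cmE fsfun_ffun.
case: insubP => [u iu ui /=|im]; last first.
  apply/esym/eqP; rewrite -leqn0 (leq_trans (le_am i))// leqn0.
  by rewrite cmE_eq0.
rewrite ffunE inordK ?ui// ltnS -ui (leq_trans (le_am _))//.
exact: (@leq_bigmax _ (fun i : finsupp m => m (val i))).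
Qed.

Lemma fps_mulE (S : {fset {cmonom I}}) f g m :
  (forall a b, mmul a b = m -> a \in S) ->
  fps_mul f g m =
    \sum_(a <- S) \sum_(b <- S) (if mmul a b == m then f a * g b else 0).
Proof.
move=> SP.
have SP2 a b : mmul a b = m -> b \in S by rewrite mulmC => /SP.
rewrite pair_big_dep_cond /=.
set T := [fset _ | _ in _, _ in _]%fset.
have TE a b : ((a, b) \in T) = (a \in S) && (b \in S).
  apply/imfset2P/andP => /= [[x xS [y yS [-> ->]]]|[aS bS]].
    by move: xS yS; rewrite !inE !andbT.
  by exists a; rewrite ?inE ?aS//; exists b; rewrite ?inE ?bS.
rewrite /fps_mul fsbig_mkcond (fsbigTE T) => [|[a b]]; last first.
  rewrite TE negb_and /patch; case: ifPn => //; rewrite inE /= => abm.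
  by rewrite (SP _ _ abm) (SP2 _ _ abm).
apply: eq_bigr => p _; rewrite /patch.
by congr (if _ then _ else _); apply/idP/eqP; rewrite inE.
Qed.

Let divisors m : {fset {cmonom I}} :=
  fset_set [set a : {cmonom I} | exists b, mmul a b = m].

Let divisorsP m a b : mmul a b = m -> a \in divisors m.
Proof.
by move=> abm; rewrite in_fset_set ?inE/=; [exists b|exact: finite_divisors].
Qed.

Let divisors_trans m a b c : mmul (mmul a b) c = m ->
  [/\ a \in divisors m, b \in divisors m & c \in divisors m].
Proof.
move=> <-; split.
- by apply: (@divisorsP _ _ (mmul b c)); rewrite mulmA.
- by apply: (@divisorsP _ _ (mmul a c)); rewrite mulmA (mulmC b).
- by apply: (@divisorsP _ _ (mmul a b)); rewrite mulmC.
Qed.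

Fact fps_mulC : commutative fps_mul.
Proof.
move=> f g; apply/funext => m; have D := @divisorsP m.
rewrite !(fps_mulE _ _ D) exchange_big/=.
by apply: eq_bigr => a _; apply: eq_bigr => b _; rewrite mulmC mulrC.
Qed.

Fact fps_mulDl : left_distributive fps_mul +%R.
Proof.
move=> f g h; apply/funext => m; have D := @divisorsP m.
rewrite [RHS]/GRing.add /= !(fps_mulE _ _ D) -big_split/=.
apply: eq_bigr => a _; rewrite -big_split/=; apply: eq_bigr => b _.
by case: ifP => _; rewrite ?addr0// -mulrDl.
Qed.

Fact fps_mul1 : left_id fps_one fps_mul.
Proof.
move=> f; apply/funext => m.
have D1 : mone \in divisors m by apply: (@divisorsP _ _ m); rewrite mul1m.
have Dm : m \in divisors m by apply: (@divisorsP _ _ mone); rewrite mulm1.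
rewrite (fps_mulE _ _ (@divisorsP m)); move: (divisors m) D1 Dm => D D1 Dm.
rewrite (big_fsetD1 _ D1) (big_fsetD1 _ Dm) /=.
rewrite mul1m (eqxx m) {1}/fps_one (eqxx mone) mul1r.
rewrite [X in _ + X + _]big1_fset => [|b]; last first.
  by rewrite in_fsetD1 => /andP[/negPf bm _] _; rewrite mul1m bm.
rewrite addr0 [X in _ + X]big1_fset ?addr0// => a.
rewrite in_fsetD1 => /andP[/negPf a1 _] _; apply: big1_fset => b _ _.
by rewrite {1}/fps_one a1 mul0r if_same.
Qed.

Let triple m f g h : fps_mul (fps_mul f g) h m =
  \sum_(a <- divisors m) \sum_(b <- divisors m) \sum_(c <- divisors m)
    (if mmul (mmul a b) c == m then f a * g b * h c else 0).
Proof.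
set D := divisors m; rewrite (fps_mulE _ _ (@divisorsP m)) -/D.
transitivity (\sum_(p <- D) \sum_(c <- D) \sum_(a <- D) \sum_(b <- D)
   (if (mmul a b == p) && (mmul p c == m) then f a * g b * h c else 0)).
  apply: eq_big_seq => p _; apply: eq_big_seq => c _.
  case: eqP => [pcm|_]; last first.
    by rewrite big1_fset// => a _ _; rewrite big1_fset// => b _ _; rewrite andbF.
  rewrite (@fps_mulE D) => [|a b abp]; last first.
    by have [|] := @divisors_trans m a b c; rewrite ?abp.
  rewrite mulr_suml; apply: eq_bigr => a _; rewrite mulr_suml.
  by apply: eq_bigr => b _; rewrite andbT; case: eqP; rewrite ?mul0r.
under eq_bigr do rewrite exchange_big/=.
rewrite exchange_big/=; apply: eq_bigr => a _.
under eq_bigr do rewrite exchange_big/=.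
rewrite exchange_big/=; apply: eq_bigr => b _.
rewrite exchange_big/=; apply: eq_bigr => c _.
case: ifPn => [/eqP abcm|nabcm].
  rewrite (big_fsetD1 (mmul a b))/=; last exact: divisorsP abcm.
  rewrite eqxx abcm eqxx big1_fset ?addr0// => p.
  by rewrite in_fsetD1 => /andP[pab _] _; rewrite eq_sym (negPf pab).
by rewrite big1_fset// => p _ _; case: eqP => // <-; rewrite (negPf nabcm).
Qed.

Fact fps_mulA : associative fps_mul.
Proof.
move=> f g h; apply/funext => m; rewrite fps_mulC !triple.
rewrite [RHS]exchange_big/=; apply: eq_bigr => b _.
rewrite [RHS]exchange_big/=; apply: eq_bigr => c _; apply: eq_bigr => a _.
by rewrite (mulmC (mmul b c)) mulmA mulrC mulrA.
Qed.

Fact fps_one_neq0 : fps_one != 0.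
Proof.
apply/eqP => /(congr1 (fun f : fps I K => f mone)).
by rewrite /fps_one eqxx; apply/eqP; exact: oner_neq0.
Qed.

HB.instance Definition _ := GRing.Zmodule_isComNzRing.Build (fps I K)
  fps_mulA fps_mulC fps_mul1 fps_mulDl fps_one_neq0.

End FormalPowerSeries.

Section BandMatrices.
Variable R : realType.
Local Notation C := R[i].

Definition banded : {pred int -> int -> C^o} := fun A =>
  `[< exists N : nat, forall i j : int, (N < absz (i - j))%N -> A i j = 0 >].

Fact banded_submod_closed : submod_closed banded.
Proof.
split=> [|c A B /asboolP[N AN] /asboolP[M BM]]; apply/asboolP; first by exists 0%N.
exists (maxn N M) => i j; rewrite gtn_max => /andP[/AN Aij /BM Bij].
by rewrite -[LHS]/(c *: A i j + B i j) Aij Bij scaler0 addr0.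
Qed.

HB.instance Definition _ :=
  GRing.isSubmodClosed.Build C (int -> int -> C^o) banded banded_submod_closed.

Record gl_infty := GlInfty {
  gl_val : int -> int -> C^o;
  gl_val_banded : gl_val \in banded
}.

Definition entry (A : gl_infty) : int -> int -> C := gl_val A.
Coercion entry : gl_infty >-> Funclass.

HB.instance Definition _ := [isSub for gl_val].
HB.instance Definition _ := [Choice of gl_infty by <:].
HB.instance Definition _ := [SubChoice_isSubLmodule of gl_infty by <:].

Fact mul_subproof (A B : gl_infty) :
  (fun i j => \sum_(k \in [set: int]) A i k * B k j) \in banded.
Proof.
have [/asboolP[N AN] /asboolP[M BM]] := (gl_val_banded A, gl_val_banded B).
apply/asboolP; rewrite /entry.
exists (N + M)%N => i j ij; apply: fsbig1 => k _.
have [/AN ->|ik] := ltnP N (absz (i - k)); first by rewrite mul0r.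
rewrite BM ?mulr0// -(ltn_add2l N) (leq_trans ij)//.
rewrite (leq_trans (leqD_dist i k j))// leq_add2r.
exact: ik.
Qed.

Definition gl_mul (A B : gl_infty) : gl_infty := GlInfty (mul_subproof A B).

Definition gl_bracket (A B : gl_infty) : gl_infty := gl_mul A B - gl_mul B A.

Definition gl_trace (A : gl_infty) : C := \sum_(i \in [set: int]) A i i.

Fact diag_subproof (d : int -> C^o) :
  (fun i j : int => if i == j then d i else 0) \in banded.
Proof.
by apply/asboolP; exists 0%N => i j; case: eqP => // ->; rewrite subrr.
Qed.

Definition gl_diag (d : int -> C^o) : gl_infty := GlInfty (diag_subproof d).

Definition gl_J : gl_infty := gl_diag (fun r => if r <= 0 then 1 else 0).

(* The trace is a finite sum: [J, A] has finitely many nonzero entries. *)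
Definition cocycle (A B : gl_infty) : C :=
  gl_trace (gl_mul (gl_bracket gl_J A) B).

(* (A, c) stands for A + c K *)
Definition ghat : Type := (gl_infty * C^o)%type.
HB.instance Definition _ := GRing.Lmodule.on ghat.

Definition bracket (x y : ghat) : ghat :=
  (gl_bracket x.1 y.1, cocycle x.1 y.1).

Record ghat_module := GhatModule {
  carrier :> lmodType C;
  act : ghat -> carrier -> carrier;
  act_linear_l : forall v, linear (act^~ v);
  act_linear_r : forall x, linear (act x);
  act_bracket : forall x y v,
    act (bracket x y) v = act x (act y v) - act y (act x v)
}.

(* The Cartan subalgebra h^0: (d, c) stands for sum_k d_k e_kk + c K. *)
Definition h0 : Type := ((int -> C^o) * C^o)%type.
HB.instance Definition _ := GRing.Lmodule.on h0.

Definition h0_inj (h : h0) : ghat := (gl_diag h.1, h.2).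

Definition strictly_upper (A : gl_infty) : Prop :=
  forall i j : int, j <= i -> A i j = 0.

Definition submodule (V : ghat_module) (U : set V) : Prop :=
  [/\ U 0, forall (a : C) (u w : V), U u -> U w -> U (a *: u + w)
     & forall (x : ghat) (u : V), U u -> U (act x u)].

Definition irreducible (V : ghat_module) : Prop :=
  (exists v : V, v <> 0) /\
  forall U : set V, submodule U -> U = [set 0] \/ U = [set: V].

Definition highest_weight_vector (V : ghat_module) (L : {scalar h0}) (v : V) :=
  [/\ v <> 0, forall A, strictly_upper A -> act (A, 0) v = 0
     & forall h : h0, act (h0_inj h) v = L h *: v].

Definition highest_weight_module (V : ghat_module) (L : {scalar h0}) : Prop :=
  exists2 v : V, highest_weight_vector L v
    & forall U : set V, submodule U -> U v -> U = [set: V].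

(* L^0(L) is only defined up to isomorphism: V is one of its models. *)
Definition is_L0 (L : {scalar h0}) (V : ghat_module) : Prop :=
  irreducible V /\ highest_weight_module V L.

(* lam : 'I_n -> int is indexed from 0: lam i is the entry of index i + 1, which
   is the value on e_kk for k = i + 1 if positive, for k = i + 1 - n if
   negative. *)
Section HighestWeight.
Variables (n : nat) (lam : 'I_n -> int).

Definition Lambda_fun (h : h0) : C :=
  - n%:R * (h.2 : C)
  + \sum_(i < n | 0 < lam i) (lam i)%:~R * (h.1 (i.+1)%:Z : C)
  + \sum_(i < n | lam i < 0) (lam i)%:~R * (h.1 ((i.+1)%:Z - n%:Z) : C).

Fact Lambda_linear : scalar Lambda_fun.
Proof.
move=> a g h; set u := a *: g + h.
have E1 k : u.1 k = a * (g.1 k : C) + (h.1 k : C) :> C by [].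
have E2 : u.2 = a * (g.2 : C) + (h.2 : C) :> C by [].
move: u E1 E2 => u E1 E2.
have S (P : pred 'I_n) (e : 'I_n -> int) :
    \sum_(i < n | P i) (lam i)%:~R * (u.1 (e i) : C) =
    a * (\sum_(i < n | P i) (lam i)%:~R * (g.1 (e i) : C))
    + \sum_(i < n | P i) (lam i)%:~R * (h.1 (e i) : C).
  rewrite mulr_sumr -big_split/=; apply: eq_bigr => i _.
  by rewrite E1 mulrDr mulrCA.
rewrite /Lambda_fun !S E2 !mulrDr (mulrCA _ a g.2).
by rewrite (addrACA (a * _)) (addrACA (a * _ + _)).
Qed.

HB.instance Definition _ :=
  GRing.isLinear.Build C h0 C *%R Lambda_fun Lambda_linear.

Definition Lambda : {scalar h0} := Lambda_fun.

End HighestWeight.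

Definition finite_basis (V : lmodType C) (U : set V) (d : nat) : Prop :=
  exists b : 'I_d -> V,
    [/\ forall i, U (b i),
        forall c : 'I_d -> C, \sum_i c i *: b i = 0 -> forall i, c i = 0
      & forall v, U v -> exists c : 'I_d -> C, v = \sum_i c i *: b i].

(* The dimension of the subspace U, or 0 if it is infinite. *)
Definition dimension (V : lmodType C) (U : set V) : nat :=
  xget 0%N (finite_basis U).

Fact elem_subproof (k l : int) :
  (fun i j : int => if (i == k) && (j == l) then 1 else 0) \in banded.
Proof.
apply/asboolP; exists (absz (k - l)) => i j.
by case: eqP => // ->; case: eqP => // ->; rewrite ltnn.
Qed.

Definition gl_elem (k l : int) : gl_infty := GlInfty (elem_subproof k l).

Definition weight_space (V : ghat_module) (mu : int -> C) : set V :=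
  [set v | forall k, act (gl_elem k k, 0) v = mu k *: v].

(* A monomial m has the variable of index k to the power m k. That variable is
   x_k for k > 0 and x_k^-1 for k <= 0, where x_k = e^{omega_k}; this gives the
   weight of m on e_kk. *)
Definition monomial_weight (m : {cmonom int}) (k : int) : int :=
  if 0 < k then (m k)%:Z else - (m k)%:Z.

Definition ch (V : ghat_module) : fps int int := fun m =>
  (dimension (@weight_space V (fun k => (monomial_weight m k)%:~R)))%:Z.

End BandMatrices.

Definition generalized_partition (n : nat) (lam : 'I_n -> int) : Prop :=
  forall i j : 'I_n, (i <= j)%N -> lam j <= lam i.

(* Main.v *)
(* Polynomials in variables indexed by Z x {1, .., n} form a Fock space with
   commuting actions of gl_n and of ghat at level -n. Its gl_n-singular vectors
   of weight lam contain, up to a scalar, only one vector that is moreover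
   singular for ghat: it is determined by its coefficient at one monomial.
   Hence the submodule generated in V x Fock by the two highest weight vectors
   is the graph of an isomorphism of V onto a space of gl_n-singular vectors,
   and orthogonality for the Fischer form shows that every gl_n-singular vector
   of weight lam is reached. In the finite-dimensional space of vectors of a
   given ghat-weight, Freudenthal's argument with the Casimir operator counts
   the gl_n-singular vectors as the sum over w of sgn(w) times the number of
   monomials of gl_n-weight lam - id + w. The case n = 1 identifies these
   numbers of monomials with coefficients of the products of the ch (W i (w i)),
   so that the sum is the Leibniz expansion of the determinant. *)

From HB Require Import structures.
From mathcomp Require Import all_boot all_order all_fingroup all_algebra finmap.
From mathcomp Require Import boolp classical_sets functions cardinality fsbigop.
From mathcomp Require Import reals complex.
From mathcomp Require Import monalg.
From mathcomp Require Import zify ring lra.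
Require Import Defs.

Set Implicit Arguments.
Unset Strict Implicit.
Unset Printing Implicit Defensive.

Import Order.TTheory GRing.Theory Num.Theory.

Local Open Scope ring_scope.

(** * Alternating sums over the symmetric group *)

(** Of V nothing is known but irreducibility and a highest weight vector: no weight decomposition,
    no finite dimensions. Both are read off the Fock space, where a ghat-weight fixes the sum of the
    exponents in each row and so leaves finitely many monomials. A submodule of the product replaces
    a map out of V, which is not presented by generators and relations; that it avoids (0, w)
    follows from the eigenvalues of the diagonal matrix with entries i, a grading element inside
    gl_infty. The count avoids complete reducibility and Weyl's formula. Freudenthal's relation
    holds for traces of any operator commuting with gl_n. In the alternating sum its off-diagonal
    terms disappear at once, because that sum is a product of one difference operator for each
    positive root. The delicate point is the uniqueness of joint highest weight vectors. Extremal
    exponents clear most variables, but in the columns with lam p > 0 they do not reach the rows k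
    <= 0; there the positivity of the Fischer form decides. *)

Section DifferenceOperators.
Variables (F : comNzRingType) (n : nat).
Local Notation wt := ('I_n -> int).
Implicit Types (g h : wt -> F) (mu : wt) (p q : 'I_n) (x y : 'I_n * 'I_n).

Definition shift p mu : wt := fun q => mu q + (q == p)%:Z.

Lemma shiftC p q mu : shift p (shift q mu) = shift q (shift p mu).
Proof. by apply/funext => r; rewrite /shift addrAC. Qed.

(** This is the operator z_q - z_p, where z_p is the shift in direction p and x = (p, q). All these
    operators commute. *)
Definition diff x g : wt -> F := fun mu => g (shift x.2 mu) - g (shift x.1 mu).

Definition diffs (s : seq ('I_n * 'I_n)) g := foldr diff g s.

Lemma diffC x y g : diff x (diff y g) = diff y (diff x g).
Proof.
apply/funext => mu; rewrite /diff (shiftC y.2 x.2) (shiftC y.1 x.2).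
by rewrite (shiftC y.2 x.1) (shiftC y.1 x.1) !opprB !addrA; ring.
Qed.

Lemma diffs_diff s x g : diffs s (diff x g) = diff x (diffs s g).
Proof. by elim: s => //= y s ->; rewrite diffC. Qed.

Lemma diffs_rem s x g : x \in s -> diffs s g = diff x (diffs (rem x s) g).
Proof.
elim: s => //= y s IHs; rewrite inE; case: (eqVneq x y) => [->//|yx] /=.
by move=> /IHs ->; rewrite diffC.
Qed.

Lemma diffs_shift s p g mu :
  diffs s (fun nu => g (shift p nu)) mu = diffs s g (shift p mu).
Proof.
by elim: s mu => //= x s IHs mu; rewrite /diff !IHs (shiftC p x.2) (shiftC p x.1).
Qed.

Lemma diffsD s g h mu :
  diffs s (fun nu => g nu + h nu) mu = diffs s g mu + diffs s h mu.
Proof. by elim: s mu => //= x s IHs mu; rewrite /diff !IHs; ring. Qed.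

Lemma diffsZ s c g mu :
  diffs s (fun nu => c * g nu) mu = c * diffs s g mu.
Proof. by elim: s mu => //= x s IHs mu; rewrite /diff !IHs; ring. Qed.

Lemma diffsN s g mu : diffs s (fun nu => - g nu) mu = - diffs s g mu.
Proof. by elim: s mu => //= x s IHs mu; rewrite /diff !IHs; ring. Qed.

Lemma diffs_sum s (T : Type) (r : seq T) (P : pred T) (G : T -> wt -> F) mu :
  diffs s (fun nu => \sum_(i <- r | P i) G i nu) mu =
  \sum_(i <- r | P i) diffs s (G i) mu.
Proof.
elim: r => [|i r IHr].
  have -> : (fun nu : wt => \sum_(i <- [::] | P i) G i nu) = fun nu => 0 * 0.
    by apply/funext => nu; rewrite big_nil mulr0.
  by rewrite diffsZ mul0r big_nil.
have -> : (fun nu => \sum_(j <- i :: r | P j) G j nu) =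
    (fun nu => (P i)%:R * G i nu + \sum_(j <- r | P j) G j nu).
  by apply/funext => nu; rewrite big_cons; case: (P i); rewrite ?mul1r ?mul0r ?add0r.
by rewrite diffsD diffsZ IHr big_cons; case: (P i); rewrite ?mul1r ?mul0r ?add0r.
Qed.

Definition pairs : seq ('I_n * 'I_n) :=
  [seq x : 'I_n * 'I_n <- enum {: 'I_n * 'I_n} | (x.1 < x.2)%N].

Lemma iter_shift p k mu q : iter k (shift p) mu q = mu q + (k * (q == p))%:Z.
Proof.
by elim: k => [|k IHk]; rewrite ?addr0 //= /shift IHk mulSn PoszD; ring.
Qed.

(** The differences compose to the action of the product of the z_q - z_p over p < q, a Vandermonde
    determinant; in its Leibniz expansion every monomial acts as a shift by a permutation. *)
Lemma diffs_pairs_act (K : comNzRingType) (z : 'I_n -> K)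
    (act : K -> (wt -> F) -> wt -> F) :
    (forall P Q g mu, act (P + Q) g mu = act P g mu + act Q g mu) ->
    (forall P g mu, act (- P) g mu = - act P g mu) ->
    (forall g mu, act 1 g mu = g mu) ->
    (forall p Q g mu, act (z p * Q) g mu = act Q g (shift p mu)) ->
  forall g mu, diffs pairs g mu =
  \sum_(w : 'S_n) (-1) ^+ w * g (fun p => mu p + (w p)%:Z).
Proof.
move=> actD actN act1 actz g mu.
have act0 h nu : act 0 h nu = 0 by rewrite -(subrr (0 : K)) actD actN subrr.
have diffsE s nu : diffs s g nu = act (\prod_(x <- s) (z x.2 - z x.1)) g nu.
  elim: s nu => [|x s IHs] nu /=; first by rewrite big_nil act1.
  by rewrite /diff !IHs big_cons mulrBl actD actN !actz.
rewrite diffsE.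
have -> : \prod_(x <- pairs) (z x.2 - z x.1) =
    \det (Vandermonde n (\row_p z p)).
  rewrite det_Vandermonde pair_big_dep /= big_filter big_enum_cond /=.
  by apply: eq_bigr => x _; rewrite !mxE.
rewrite -det_tr /determinant (big_morph (fun P => act P g mu)
  (fun P Q => actD P Q g mu) (act0 g mu)).
apply: eq_bigr => w _; under eq_bigr do rewrite !mxE.
have -> : act ((-1) ^+ w * \prod_i z i ^+ w i) g mu =
    (-1) ^+ w * act (\prod_i z i ^+ w i) g mu.
  by case: (odd_perm w); rewrite ?expr0 ?expr1 ?mul1r // !mulN1r actN.
congr (_ * _).
have actzX p k Q nu : act (z p ^+ k * Q) g nu = act Q g (iter k (shift p) nu).
  elim: k nu => [|k IHk] nu; first by rewrite expr0 mul1r.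
  by rewrite exprS -mulrA actz IHk iterSr.
have actp s nu : act (\prod_(i <- s) z i ^+ w i) g nu =
    g (fun p => nu p + (\sum_(i <- s) w i * (p == i))%N%:Z).
  elim: s nu => [|i s IHs] nu.
    by rewrite big_nil act1; congr g; apply/funext => p; rewrite big_nil addr0.
  rewrite big_cons actzX IHs; congr g; apply/funext => p.
  by rewrite iter_shift big_cons PoszD addrA.
rewrite actp; congr g; apply/funext => p; congr (_ + _%:Z).
rewrite (bigD1 p) //= eqxx muln1 big1 ?addn0 // => q qp.
by rewrite eq_sym (negPf qp) muln0.
Qed.

(* Vandermonde's identity in the commutative ring generated by the shifts. *)
Lemma diffs_pairs g mu :
  diffs pairs g mu =
  \sum_(w : 'S_n) (-1) ^+ w * g (fun p => mu p + (w p)%:Z).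
Proof.
(* An integer polynomial acts through its monomials, each of which shifts by its exponents. *)
pose act (P : {malg int[{cmonom 'I_n}]}) (h : wt -> F) nu : F :=
  \sum_(m <- msupp P) (P@_m)%:~R * h (fun p => nu p + (m p)%:Z).
have actE (D : {fset {cmonom 'I_n}}) P h nu : (msupp P `<=` D)%fset ->
    act P h nu = \sum_(m <- D) (P@_m)%:~R * h (fun p => nu p + (m p)%:Z).
  move=> PD; rewrite /act; apply: big_fset_incl => // m _ /mcoeff_outdom ->.
  by rewrite mul0r.
have actD P Q h nu : act (P + Q) h nu = act P h nu + act Q h nu.
  rewrite !(@actE (msupp P `|` msupp Q)%fset) ?fsubsetUl ?fsubsetUr //.
    by rewrite -big_split /=; apply: eq_bigr => m _; rewrite mcoeffD intrD mulrDl.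
  exact: msuppD_le.
have actN P h nu : act (- P) h nu = - act P h nu.
  rewrite /act msuppN -sumrN; apply: eq_bigr => m _.
  by rewrite mcoeffN intrN mulNr.
have act0 h nu : act 0 h nu = 0 by rewrite /act msupp0 big_nil.
have actU c m h nu : act << c *g m >> h nu = c%:~R * h (fun p => nu p + (m p)%:Z).
  by rewrite (actE [fset m]%fset) ?msuppU_le// big_seq_fset1 mcoeffUU.
have actz p Q h nu : act (<< ucm p >> * Q) h nu = act Q h (shift p nu).
  rewrite [Q in LHS]monalgE [Q in RHS]monalgE mulr_sumr.
  rewrite !(big_morph (fun P => act P h _) (fun P Q => actD P Q h _) (act0 h _)).
  apply: eq_bigr => k _; rewrite malgM_def fgmulUU mul1r [LHS]actU [RHS]actU.
  congr (_ * h _); apply/funext => q.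
  by rewrite cmM PoszD addrA cmU eq_sym.
clearbody act.
apply: (@diffs_pairs_act _ (fun p => << ucm p >>) act) => //.
move=> h nu; have -> : 1 = << mone >> :> {malg int[{cmonom 'I_n}]} by [].
by rewrite actU mul1r; congr h; apply/funext => p; rewrite cm1 addr0.
Qed.

End DifferenceOperators.

(** * Freudenthal's relation for alternating sums *)

Section Freudenthal.
Variables (F : comNzRingType) (n : nat).
Local Notation wt := ('I_n -> int).
Local Notation P := (pairs n).
Implicit Types (g h : wt -> F) (mu : wt) (p q : 'I_n) (x y : 'I_n * 'I_n).

Definition coordmul p g : wt -> F := fun mu => (mu p)%:~R * g mu.

(** A coordinate does not commute with shifts: its commutator with the factor z_q - z_p is a single
    shift when p or q is that coordinate, and 0 otherwise. The derivation rule removes one factor at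
    a time. *)
Lemma diffs_coordmul s p g mu :
  diffs s (coordmul p g) mu = (mu p)%:~R * diffs s g mu +
  \sum_(x <- s) ((p == x.2)%:R - (p == x.1)%:R) *
     diffs (rem x s) g (shift p mu).
Proof.
elim: s mu => [|y s IHs] mu; first by rewrite big_nil addr0.
have E nu : \sum_(x <- y :: s) ((p == x.2)%:R - (p == x.1)%:R) *
     diffs (rem x (y :: s)) g nu =
   ((p == y.2)%:R - (p == y.1)%:R) * diffs s g nu +
   \sum_(x <- s) ((p == x.2)%:R - (p == x.1)%:R) *
     diff y (diffs (rem x s) g) nu.
  rewrite big_cons /= eqxx; congr (_ + _); apply: eq_big_seq => x xs.
  by case: (eqVneq y x) => [-> | //]; rewrite -diffs_rem.
rewrite E /= /diff !IHs.
under [in RHS]eq_bigr do rewrite mulrBr (shiftC _ p) (shiftC _ p).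
rewrite sumrB /shift !intrD.
have -> (q : 'I_n) : (p == q)%:Z%:~R = (p == q)%:R :> F by case: eqP.
case: (eqVneq p y.2) => [<-|_]; case: (eqVneq p y.1) => [<-|_];
  rewrite /= -?/(shift _ _); ring.
Qed.

Lemma sum_pairs_antisym (G : 'I_n -> 'I_n * 'I_n -> F) :
  \sum_(x <- P) (G x.1 x - G x.2 x) =
  \sum_p \sum_(x <- P) ((p == x.1)%:R - (p == x.2)%:R) * G p x.
Proof.
rewrite exchange_big /=; apply: eq_bigr => x _.
under eq_bigr do rewrite mulrBl.
rewrite sumrB (bigD1 x.1) //= eqxx mul1r big1 ?addr0; last first.
  by move=> i /negPf ->; rewrite mul0r.
rewrite [in X in _ = _ - X](bigD1 x.2) //= eqxx mul1r big1 ?addr0 // => i /negPf ->.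
by rewrite mul0r.
Qed.

Lemma mem_pairs x : (x \in P) = (x.1 < x.2)%N.
Proof. by rewrite mem_filter mem_enum andbT. Qed.

Lemma sum_pairs (G : 'I_n -> 'I_n -> F) :
  \sum_(x <- P) G x.1 x.2 = \sum_(p < n) \sum_(q < n | (p < q)%N) G p q.
Proof. by rewrite pair_big_dep /= big_filter big_enum_cond. Qed.

Lemma sum_pairs_incident p :
  \sum_(x <- P) ((p == x.1)%:R + (p == x.2)%:R) = n%:R - 1 :> F.
Proof.
rewrite (sum_pairs (fun a b => (p == a)%:R + (p == b)%:R)).
transitivity (\sum_(a < n) ((a < p)%N%:R + (p == a)%:R * \sum_(b < n) (p < b)%N%:R) : F).
  apply: eq_bigr => a _; rewrite big_mkcond /=.
  rewrite mulr_sumr (bigD1 p) //= eqxx.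
  rewrite [in RHS](bigD1 p) //= ltnn mulr0 add0r; congr (_ + _).
    by case: (eqVneq p a) => [<-|_]; rewrite ?ltnn //; case: ifP => //; rewrite add0r.
  apply: eq_bigr => b bp; rewrite [p == b]eq_sym (negPf bp) addr0.
  by case: (eqVneq p a) => [<-|_]; case: ifP => // _; rewrite ?mul1r ?mul0r.
rewrite big_split /= -mulr_suml.
have -> : \sum_(a < n) (p == a)%:R = 1 :> F.
  by rewrite (bigD1 p) //= eqxx big1 ?addr0 // => i /negPf; rewrite eq_sym => ->.
rewrite mul1r -big_split /=.
have -> : n%:R = \sum_(a < n) 1 :> F by rewrite sumr_const card_ord.
rewrite [in RHS](bigD1 p) //= [in LHS](bigD1 p) //= ltnn addr0 add0r.
rewrite [1 + _]addrC addrK; apply: eq_bigr => a ap.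
have : (a != p :> nat) by [].
by rewrite neq_ltn; case: ltngtP => // _ _; rewrite ?addr0 ?add0r.
Qed.

(** This is (lam, lam + 2 rho) with indices from 0, the eigenvalue of the Casimir operator on
    singular vectors of weight lam. *)
Definition casimir_value (lam : wt) : int :=
  \sum_(p < n) lam p * (lam p + n%:Z - 1 - (2 * p)%:Z).

(** With rho_p = - p up to a constant, these weights are lam + rho - w rho: if [g] counts weights,
    this is the coefficient at lam + rho of the character times the Weyl denominator. *)
Definition altsum g (lam : wt) : F :=
  \sum_(w : 'S_n) (-1) ^+ w * g (fun p => lam p - p%:Z + (w p)%:Z).

(** Here [d], [d'] and [t x] stand for the traces on weight spaces of G, of G times the Casimir
    operator, and of G E_pq E_qp for x = (p, q). The second hypothesis only gives the difference of
    [t x] along [x]; usually it is summed along root strings. *)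
Lemma altsum_casimir (d d' : wt -> F) (t : 'I_n * 'I_n -> wt -> F) lam :
  (forall mu, d' mu =
     (\sum_p mu p ^+ 2 + \sum_(x <- P) (mu x.1 - mu x.2))%:~R * d mu +
     2 * \sum_(x <- P) t x mu) ->
  (forall x mu, x \in P -> t x (shift x.2 mu) =
     t x (shift x.1 mu) + (mu x.1 - mu x.2 + 1)%:~R * d (shift x.1 mu)) ->
  altsum d' lam = (casimir_value lam)%:~R * altsum d lam.
Proof.
move=> d'E tE; pose kap : wt := fun p => lam p - p%:Z.
have altE g : altsum g lam = diffs P g kap by rewrite diffs_pairs.
pose dd p : wt -> F := coordmul p d.
pose Rx x g nu : F := diffs (rem x P) g nu.
have PR x g : x \in P -> diffs P g kap = Rx x g (shift x.2 kap) - Rx x g (shift x.1 kap).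
  by move=> xP; rewrite (diffs_rem _ xP).
pose Qx x g : F := Rx x g (shift x.2 kap) + Rx x g (shift x.1 kap).
(* The difference along [x] is a factor of the whole product, so it can be applied to [t x] first,
   which eliminates [t x] in favour of [d]. *)
have Pt x : x \in P -> diffs P (t x) kap =
    Rx x (dd x.1) (shift x.1 kap) - Rx x (dd x.2) (shift x.1 kap).
  move=> xP; rewrite (diffs_rem _ xP) -diffs_diff.
  have -> : diff x (t x) = fun mu => dd x.1 (shift x.1 mu) + - dd x.2 (shift x.1 mu).
    apply/funext => mu; rewrite /diff tE // addrAC subrr add0r /dd /coordmul.
    rewrite /shift eqxx; have -> : (x.2 == x.1) = false.
      by apply/eqP => E; move: xP; rewrite mem_pairs E ltnn.
    by rewrite -mulrBl -intrB; congr (_%:~R * _); rewrite /=; ring.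
  rewrite (diffsD _ (fun mu => dd x.1 (shift x.1 mu))
     (fun mu => - dd x.2 (shift x.1 mu))) diffsN.
  by rewrite !(diffs_shift (rem x P)).
have step1 x : x \in P ->
    diffs P (fun mu => dd x.1 mu + - dd x.2 mu) kap + 2 * diffs P (t x) kap =
    Qx x (dd x.1) - Qx x (dd x.2).
  by move=> xP; rewrite Pt // diffsD diffsN !(PR x) // /Qx; ring.
have sumQ p g : \sum_(x <- P) ((p == x.1)%:R - (p == x.2)%:R) * Qx x g =
    (n%:R - 1) * diffs P g kap +
    2 * ((kap p)%:~R * diffs P g kap - diffs P (coordmul p g) kap).
  rewrite diffs_coordmul opprD addrA subrr add0r mulrN mulr_sumr -sumrN.
  rewrite -(sum_pairs_incident p) mulr_suml -big_split /=.
  apply: eq_big_seq => x xP; rewrite (PR x) // /Qx -/(Rx x g _).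
  have : x.1 != x.2 by apply/eqP => E; move: xP; rewrite mem_pairs E ltnn.
  case: (eqVneq p x.1) => [<-|_]; case: (eqVneq p x.2) => [<-|_]; rewrite ?eqxx // => _;
  by rewrite /=; ring.
have total : diffs P d' kap = \sum_p
   (diffs P (coordmul p (dd p)) kap + ((n%:R - 1) * diffs P (dd p) kap +
    2 * ((kap p)%:~R * diffs P (dd p) kap - diffs P (coordmul p (dd p)) kap))).
  have -> : d' = fun mu => (\sum_p coordmul p (dd p) mu +
     \sum_(x <- P) (dd x.1 mu + - dd x.2 mu)) + 2 * \sum_(x <- P) t x mu.
    apply/funext => mu; rewrite d'E; congr (_ + _).
    rewrite intrD mulrDl !rmorph_sum !mulr_suml; congr (_ + _).
      by apply: eq_bigr => p _; rewrite /coordmul /dd /coordmul rmorphXn expr2 mulrA.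
    by apply: eq_bigr => x _; rewrite /dd /coordmul rmorphB mulrBl.
  rewrite !diffsD diffsZ !diffs_sum -addrA mulr_sumr -big_split /=.
  rewrite (eq_big_seq _ step1) (sum_pairs_antisym (fun p x => Qx x (dd p))).
  by rewrite -big_split /=; apply: eq_bigr => p _; rewrite sumQ.
rewrite altE total.
rewrite /altsum mulr_sumr; under eq_bigr do rewrite !diffs_pairs.
under eq_bigr do rewrite mulrBr !mulr_sumr -sumrB -!big_split /=.
rewrite exchange_big /=; apply: eq_bigr => w _.
pose D : F := d (fun p => kap p + (w p)%:Z).
(* Only the values of [d] at [kap + w] remain, with coefficients polynomial in [kap] and [w]. *)
transitivity ((-1) ^+ w * D * (\sum_p (kap p ^+ 2 - (w p)%:Z ^+ 2 +
   (n%:Z - 1) * (kap p + (w p)%:Z)))%:~R).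
  rewrite rmorph_sum mulr_sumr; apply: eq_bigr => p _.
  rewrite /dd /coordmul -/D; move: (kap p) ((w p)%:Z) => k j.
  rewrite /= -[n%:R]/(n%:Z%:~R) !(intrD, intrM, intrN, rmorphXn) /=.
  move: D (k%:~R : F) (j%:~R : F) (n%:Z%:~R : F) ((-1) ^+ w : F) => D' k' j' n' e.
  ring.
rewrite [RHS]mulrC; congr (_ * _%:~R).
rewrite !big_split /= sumrN -mulr_sumr big_split /=.
(* Symmetric sums over the values of [w] are those of the identity, so the coefficient is the same
   for all [w]. *)
have S (G : int -> int) : \sum_p G (w p)%:Z = \sum_(p < n) G p%:Z.
  by rewrite [RHS](reindex_perm w).
rewrite (S (fun i => i ^+ 2)) (S id).
rewrite -sumrN -!big_split /= mulr_sumr -!big_split /=.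
apply: eq_bigr => p _; rewrite /kap PoszM; ring.
Qed.

End Freudenthal.

(** * Counting gl_n-singular vectors *)

Section Dominance.
Variable n : nat.
Implicit Types (mu nu lam : 'I_n -> int) (k : nat).

Definition psum mu k : int := \sum_(p < n | (p < k)%N) mu p.

Definition dominates mu lam :=
  psum mu n = psum lam n /\ forall k, psum lam k <= psum mu k.

Definition dominant lam := forall p q : 'I_n, (p < q)%N -> lam q <= lam p.

Lemma dominates_trans mu nu lam :
  dominates mu nu -> dominates nu lam -> dominates mu lam.
Proof.
move=> [e1 l1] [e2 l2]; split; first by rewrite e1.
by move=> k; apply: le_trans (l1 k).
Qed.

Lemma psumS mu (p : 'I_n) : psum mu p.+1 = psum mu p + mu p.
Proof.
rewrite /psum (bigD1 p) //= addrC; congr (_ + _); apply: eq_bigl => q.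
by rewrite ltnS ltn_neqAle andbC.
Qed.

Lemma psum_inj mu lam : (forall k, psum mu k = psum lam k) -> mu =1 lam.
Proof. by move=> E p; apply: (addrI (psum mu p)); rewrite -psumS !E psumS. Qed.

Lemma dominates_antisym mu lam : dominates mu lam -> dominates lam mu -> mu =1 lam.
Proof.
move=> [_ l1] [_ l2]; apply: psum_inj => k; apply/eqP.
by rewrite eq_le l1 l2.
Qed.

Lemma dominates_raise mu (p q : 'I_n) : (p < q)%N ->
  dominates (fun r => mu r + (r == p)%:Z - (r == q)%:Z) mu.
Proof.
move=> pq; have E k : psum (fun r => mu r + (r == p)%:Z - (r == q)%:Z) k =
    psum mu k + (p < k)%N%:Z - (q < k)%N%:Z.
  have S (s : 'I_n) : \sum_(r < n | (r < k)%N) (r == s)%:Z = (s < k)%N%:Z.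
    rewrite big_mkcond (bigD1 s) //= eqxx big1 ?addr0; first by case: ifP.
    by move=> i /negPf ->; case: ifP.
  by rewrite /psum sumrB big_split /= !S.
by split=> [|k]; rewrite E ?ltn_ord; lia.
Qed.

(** Any k distinct indices have at least the sum of the k smallest ones. *)
Lemma dominates_perm lam (w : 'S_n) :
  dominates (fun p => lam p - p%:Z + (w p)%:Z) lam.
Proof.
have E k : psum (fun p => lam p - p%:Z + (w p)%:Z) k - psum lam k =
    \sum_(p < n) (((w^-1)%g p < k)%N%:Z - (p < k)%N%:Z) * (p%:Z - k%:Z).
  rewrite /psum -sumrB [LHS]big_mkcond /=.
  transitivity (\sum_(p < n) (p < k)%N%:Z * ((w p)%:Z - k%:Z)
      - \sum_(p < n) (p < k)%N%:Z * (p%:Z - k%:Z)).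
    by rewrite -sumrB; apply: eq_bigr => p _; case: ifP => _ /=; ring.
  under [RHS]eq_bigr do rewrite mulrBl.
  rewrite sumrB; congr (_ - _); rewrite [RHS](reindex_perm w) /=.
  by apply: eq_bigr => p _; rewrite permK.
split=> [|k].
  apply/eqP; rewrite -subr_eq0 E big1 // => p _.
  by rewrite !ltn_ord subrr mul0r.
rewrite -subr_ge0 E; apply: sumr_ge0 => p _.
by case: ltnP; case: ltnP => /=; lia.
Qed.

Lemma abel_sum (D g : nat -> int) m :
  \sum_(k < m) (D k.+1 - D k) * g k =
  D m * g m - D 0%N * g 0%N + \sum_(k < m) D k.+1 * (g k - g k.+1).
Proof.
elim: m => [|m IHm]; first by rewrite !big_ord0; ring.
by rewrite !big_ord_recr /= IHm; ring.
Qed.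

(** The difference of the two values is (mu - lam, mu + lam + 2 rho). Summation by parts turns it
    into a sum of the nonnegative [D k] with coefficients at least 2, so all [D k] vanish. *)
Lemma casimir_value_inj mu lam : dominant mu -> dominant lam ->
  dominates mu lam -> casimir_value mu = casimir_value lam -> mu =1 lam.
Proof.
move=> dmu dlam [en le] cE.
pose D k := psum mu k - psum lam k.
pose ext (f : 'I_n -> int) k := if insub k is Some p then f p else 0.
have extE f (p : 'I_n) : ext f p = f p by rewrite /ext valK.
pose g k : int := ext mu k + ext lam k + n%:Z - 1 - (2 * k)%:Z.
have D0 k : 0 <= D k by rewrite subr_ge0.
have Dn : D n = 0 by rewrite /D en subrr.
have D00 : D 0%N = 0 by rewrite /D /psum !big_pred0.
have : casimir_value mu - casimir_value lam = \sum_(k < n) (D k.+1 - D k) * g k.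
  rewrite /casimir_value -sumrB; apply: eq_bigr => p _.
  by rewrite /D !psumS /g !extE; ring.
rewrite cE subrr abel_sum Dn D00 !mul0r subr0 add0r => /esym S0.
(* The 2 is the contribution of 2 rho; dominance of both weights makes the rest nonnegative. At the
   last index [D n = 0]. *)
have step (k : 'I_n) : 0 <= D k.+1 * (g k - g k.+1) - 2 * D k.+1.
  have [kn|] := ltnP k.+1 n; last first.
    move=> nk; have -> : k.+1 = n by have := ltn_ord k; lia.
    by rewrite Dn mul0r mulr0 subr0.
  rewrite mulrC -mulrBl mulr_ge0 // /g extE -[k.+1]/(val (Ordinal kn)) !extE /=.
  have := dmu k (Ordinal kn) (ltnSn _); have := dlam k (Ordinal kn) (ltnSn _).
  by lia.
have Dk k : (k < n)%N -> D k.+1 = 0.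
  move=> kn; pose p := Ordinal kn; apply/eqP; rewrite eq_le D0 andbT.
  have : \sum_(k < n) (D k.+1 * (g k - g k.+1) - 2 * D k.+1) >= 0 by apply: sumr_ge0.
  rewrite sumrB S0 sub0r (bigD1 p) //= -[k.+1]/((p : nat).+1).
  have : 0 <= \sum_(i < n | i != p) 2 * D i.+1.
    by apply: sumr_ge0 => i _; rewrite mulr_ge0.
  by move: (\sum_(i < n | i != p) _) (D _) => s d s0 sd; lia.
apply: psum_inj => k; apply/eqP; rewrite -subr_eq0 -/(D k); apply/eqP.
elim: k => // k IHk; have [|nk] := ltnP k n; first exact: Dk.
rewrite -[RHS]IHk /D; congr (_ - _); apply: eq_bigl => p; have := ltn_ord p; lia.
Qed.

End Dominance.

(** In a rank factorization S = C B both factors can be cancelled, so S S = c S gives B C = c, and S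
    has the trace of B C. *)
Lemma mxtrace_quasi_idempotent (F : fieldType) N (S : 'M[F]_N) (c : F) :
  S *m S = c *: S -> \tr S = c * (\rank S)%:R.
Proof.
move=> SS; rewrite -{1}(mulmx_base S) mxtrace_mulC.
suff -> : row_base S *m col_base S = c%:M by rewrite mxtrace_scalar mulr_natr.
have fr := row_base_free S; have fc := col_base_full S.
apply: (row_full_inj fc); apply: (row_free_inj fr).
have E : col_base S *m row_base S = S := mulmx_base S.
rewrite mulmxA E -[LHS]mulmxA E SS mul_mx_scalar -scalemxAl E.
by [].
Qed.

(** * Weight traces and the Casimir operator of a gl_n-action by matrices *)

Section WeightCount.
Variables (F : numFieldType) (n N : nat).
Variables (rho : 'I_n -> 'I_n -> 'M[F]_N) (wt : 'I_N -> 'I_n -> int).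
Local Notation weight := ('I_n -> int).

Hypothesis rho_diag : forall p i j, rho p p i j = (wt i p)%:~R *+ (i == j).
(* Matrices act on row vectors from the right, which reverses products. *)
Hypothesis rho_comm : forall p q r s,
  rho r s *m rho p q - rho p q *m rho r s =
  (q == r)%:R *: rho p s - (p == s)%:R *: rho r q.

Definition has_weight (mu : weight) (u : 'rV[F]_N) :=
  forall p, u *m rho p p = (mu p)%:~R *: u.

Definition gl_singular (mu : weight) (u : 'rV[F]_N) :=
  (forall p q : 'I_n, (p < q)%N -> u *m rho p q = 0) /\ has_weight mu u.

Let central G := forall p q, G *m rho p q = rho p q *m G.

Let shifts (A : 'M[F]_N) (p q : 'I_n) := forall i j, A i j != 0 ->
  forall r, wt j r = wt i r + (r == p)%:Z - (r == q)%:Z.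

Let mulmx_diag m (A : 'M_(m, N)) p i j : (A *m rho p p) i j = A i j * (wt j p)%:~R.
Proof.
rewrite mxE (bigD1 j) //= rho_diag eqxx mulr1n big1 ?addr0 // => k /negPf kj.
by rewrite rho_diag kj mulr0.
Qed.

Let diag_mulmx m (A : 'M_(N, m)) p i j : (rho p p *m A) i j = (wt i p)%:~R * A i j.
Proof.
rewrite mxE (bigD1 i) //= rho_diag eqxx mulr1n big1 ?addr0 // => k /negPf ki.
by rewrite rho_diag eq_sym ki mul0r.
Qed.

Lemma rho_shifts p q : shifts (rho p q) p q.
Proof.
move=> i j Aij r; have := rho_comm r r p q.
have -> : (r == p)%:R *: rho r q - (r == q)%:R *: rho p r =
    ((r == p)%:Z - (r == q)%:Z)%:~R *: rho p q.
  rewrite rmorphB scalerBl /= -!pmulrn; congr (_ - _).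
    by case: eqP => [->|]; rewrite ?scale0r.
  by case: eqP => [->|]; rewrite ?scale0r.
move/(congr1 (fun M : 'M_N => M i j)).
rewrite [LHS]mxE [X in _ + X = _]mxE mulmx_diag diag_mulmx [RHS]mxE.
rewrite mulrC -mulrBl => /(mulIf Aij); rewrite -rmorphB => /intr_inj /= E.
by rewrite -addrA -E addrC subrK.
Qed.

Lemma central_shifts G : central G -> forall i j, G i j != 0 -> wt j =1 wt i.
Proof.
move=> cG i j Gij p; have := cG p p.
move/(congr1 (fun M : 'M_N => M i j)); rewrite mulmx_diag diag_mulmx.
by rewrite mulrC => /(mulIf Gij) /intr_inj.
Qed.

Definition wtrace (A : 'M[F]_N) (mu : weight) : F :=
  \sum_(i | [forall p, wt i p == mu p]) A i i.

Let wtraceD A B mu : wtrace (A + B) mu = wtrace A mu + wtrace B mu.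
Proof. by rewrite -big_split; apply: eq_bigr => i _; rewrite mxE. Qed.

Let wtraceZ c A mu : wtrace (c *: A) mu = c * wtrace A mu.
Proof. by rewrite mulr_sumr; apply: eq_bigr => i _; rewrite mxE. Qed.

Let wtraceN A mu : wtrace (- A) mu = - wtrace A mu.
Proof. by rewrite -scaleN1r wtraceZ mulN1r. Qed.

Let wtrace_sum (I : Type) (r : seq I) (P : pred I) (A : I -> 'M[F]_N) mu :
  wtrace (\sum_(k <- r | P k) A k) mu = \sum_(k <- r | P k) wtrace (A k) mu.
Proof. by rewrite exchange_big; apply: eq_bigr => i _; rewrite summxE. Qed.

Let wtrace_diag A p mu : wtrace (A *m rho p p) mu = (mu p)%:~R * wtrace A mu.
Proof.
rewrite mulr_sumr; apply: eq_bigr => i /forallP/(_ p)/eqP <-.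
by rewrite mulmx_diag mulrC.
Qed.

(** Moving a raising operator around a trace changes the weight at which the trace is taken. *)
Let wtrace_cyc (A B : 'M[F]_N) (mu nu : weight) :
  (forall i j, A i j != 0 -> wt i =1 mu <-> wt j =1 nu) ->
  wtrace (A *m B) mu = wtrace (B *m A) nu.
Proof.
move=> AP; rewrite /wtrace.
under eq_bigr do rewrite mxE; under [RHS]eq_bigr do rewrite mxE.
rewrite [LHS]big_mkcond [RHS]big_mkcond /=.
transitivity (\sum_i \sum_j if [forall p, wt i p == mu p] then A i j * B j i else 0).
  by apply: eq_bigr => i _; case: ifP => // _; rewrite big1.
rewrite exchange_big /=; apply: eq_bigr => j _.
case: ifP => jn; last first.
  rewrite big1 // => i _; case: ifP => // im.
  have [->|/AP AE] := eqVneq (A i j) 0; first by rewrite mul0r.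
  have/AE E : wt i =1 mu by move=> q; exact/eqP/(forallP im).
  by case/negP: (negbT jn); apply/forallP => p; rewrite E.
apply: eq_bigr => i _; rewrite [in RHS]mulrC; case: ifP => // im.
have [->|/AP AE] := eqVneq (A i j) 0; first by rewrite mul0r.
have/AE E : wt j =1 nu by move=> q; exact/eqP/(forallP jn).
by case/negP: (negbT im); apply/forallP => p; rewrite E.
Qed.

Definition casimir : 'M[F]_N := \sum_p \sum_q rho p q *m rho q p.

(** By the derivation rule the commutator is a combination of four sums of products, which cancel in
    pairs. *)
Lemma casimir_central : central casimir.
Proof.
move=> r s; apply/eqP; rewrite -subr_eq0 /casimir; apply/eqP.
rewrite mulmx_suml mulmx_sumr -sumrB.
have C (A B D : 'M[F]_N) : A *m B *m D - D *m (A *m B) =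
    A *m (B *m D - D *m B) + (A *m D - D *m A) *m B.
  by rewrite mulmxBr mulmxBl !mulmxA addrA subrK.
transitivity (\sum_p \sum_q
   (((s == q)%:R *: (rho p q *m rho r p) - (r == p)%:R *: (rho p q *m rho q s))
  + ((s == p)%:R *: (rho r q *m rho q p) - (r == q)%:R *: (rho p s *m rho q p)))).
  apply: eq_bigr => p _; rewrite mulmx_suml mulmx_sumr -sumrB.
  apply: eq_bigr => q _; rewrite C !rho_comm mulmxBr mulmxBl -!scalemxAr -!scalemxAl.
  by [].
have pick (G : 'I_n -> 'M[F]_N) q : \sum_p (q == p)%:R *: G p = G q.
  rewrite (bigD1 q) //= eqxx scale1r big1 ?addr0 // => p; rewrite eq_sym.
  by move=> /negPf ->; rewrite scale0r.
have pick2 (G : 'I_n -> 'I_n -> 'M[F]_N) q :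
   \sum_p \sum_k (q == p)%:R *: G p k = \sum_k G q k.
  by under eq_bigr do rewrite -scaler_sumr; rewrite pick.
under eq_bigr do rewrite big_split /= !sumrB.
rewrite big_split /= !sumrB.
rewrite (pick2 (fun p q => rho p q *m rho q s)).
rewrite (pick2 (fun p q => rho r q *m rho q p)).
under eq_bigr do rewrite (pick (fun q => rho _ q *m rho r _)).
under [X in _ + (_ - X)]eq_bigr do rewrite (pick (fun q => rho _ s *m rho q _)).
rewrite addrC addrA subrK subrr.
by [].
Qed.

(** An arbitrary central [G] allows iteration, hence passage to all polynomials in the Casimir
    operator. *)
Lemma altsum_wtrace_casimir G lam : central G ->
  altsum (wtrace (G *m casimir)) lam =
  (casimir_value lam)%:~R * altsum (wtrace G) lam.
Proof.
move=> cG.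
pose t (x : 'I_n * 'I_n) := wtrace (G *m (rho x.1 x.2 *m rho x.2 x.1)).
have swap p q : p != q -> wtrace (G *m (rho q p *m rho p q)) =1
    fun mu => wtrace (G *m (rho p q *m rho q p)) mu
              + ((mu p)%:~R - (mu q)%:~R) * wtrace G mu.
  move=> pq mu; have := rho_comm p q q p; rewrite !eqxx !scale1r => /eqP.
  rewrite subr_eq => /eqP ->; rewrite addrC !mulmxDr mulmxN !wtraceD wtraceN.
  by rewrite !wtrace_diag; ring.
apply: (altsum_casimir (t := t)).
  move=> mu; rewrite /casimir mulmx_sumr wtrace_sum.
  under eq_bigr do rewrite mulmx_sumr wtrace_sum.
  pose T p q := wtrace (G *m (rho p q *m rho q p)) mu.
  transitivity (\sum_p T p p + \sum_(x <- pairs n) (T x.1 x.2 + T x.2 x.1)).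
    rewrite big_split /= (sum_pairs T) (sum_pairs (fun p q => T q p)).
    rewrite [X in _ + (_ + X)](exchange_big_dep xpredT) //= -!big_split /=.
    apply: eq_bigr => p _; rewrite (bigD1 p) //=; congr (_ + _).
    rewrite (bigID (fun q : 'I_n => (p < q)%N)) /=; congr (_ + _).
      by apply: eq_bigl => q; rewrite neq_ltn; case: ltngtP.
    by apply: eq_bigl => q; rewrite -leqNgt [RHS]ltn_neqAle.
  rewrite !rmorphD /= mulrDl -!addrA; congr (_ + _).
    rewrite rmorph_sum mulr_suml; apply: eq_bigr => p _.
    by rewrite /T mulmxA !wtrace_diag mulrA rmorphXn expr2.
  rewrite rmorph_sum mulr_suml mulr_sumr -big_split /=.
  apply: eq_big_seq => x; rewrite mem_pairs => x12.
  rewrite /T (swap x.1 x.2) ?neq_ltn ?x12 // /t rmorphB /=; ring.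
move=> x mu; rewrite mem_pairs => x12.
have x1x2 : x.1 != x.2 by rewrite neq_ltn x12.
(* [G *m rho x.1 x.2] takes the weight [shift x.2 mu] exactly to [shift x.1 mu]. *)
rewrite /t mulmxA (@wtrace_cyc _ _ _ (shift x.1 mu)).
  rewrite mulmxA -(cG x.2 x.1) -mulmxA swap //; congr (_ + _ * _); first by rewrite mulmxA.
  by rewrite -rmorphB /shift eqxx eq_sym (negPf x1x2) /=; congr (_%:~R); ring.
move=> i j; rewrite mxE => Gij.
have [k Gik] : exists k, G i k * rho x.1 x.2 k j != 0.
  apply/existsP; apply: contraR Gij => /existsPn H; rewrite big1 // => k _.
  by apply/eqP; rewrite -[_ == _]negbK H.
have wk : wt k =1 wt i.
  by apply: (central_shifts cG); apply: contraNneq Gik => ->; rewrite mul0r.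
have wj : forall r, wt j r = wt k r + (r == x.1)%:Z - (r == x.2)%:Z.
  by apply: rho_shifts; apply: contraNneq Gik => ->; rewrite mulr0.
by rewrite /shift; split => E r; have := E r; rewrite wj wk; lia.
Qed.

(** Raising commutes with the Casimir operator and goes up in the dominance order; it stops because
    there are finitely many weights. *)
Lemma raise_to_singular (c : F) mu u : u != 0 -> has_weight mu u ->
  u *m casimir = c *: u ->
  exists nu u', [/\ u' != 0, gl_singular nu u', u' *m casimir = c *: u'
    & dominates nu mu].
Proof.
(* The coefficients decrease in [p], so raising from column [q] to [p < q] increases [h] by [q - p];
   [H] bounds [h] on all weights. *)
pose h (f : weight) : int := \sum_(p < n) (n%:Z - p%:Z) * f p.
pose H : nat := (\max_i absz (h (wt i)))%N.
have [m] : exists m, (absz (H%:Z - h mu) < m)%N by exists (absz (H%:Z - h mu)).+1.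
elim: m mu u => // m IHm mu u; rewrite ltnS => mm u0 wu cu.
have [/forallP sing|] := boolP [forall p : 'I_n, [forall q : 'I_n, (p < q)%N ==> (u *m rho p q == 0)]].
  exists mu, u; split => //; split => // p q pq.
  by have /forallP/(_ q)/implyP/(_ pq)/eqP := sing p.
rewrite negb_forall => /existsP[p]; rewrite negb_forall => /existsP[q].
rewrite negb_imply => /andP[pq u1].
have hE : h (fun r => mu r + (r == p)%:Z - (r == q)%:Z) = h mu + q%:Z - p%:Z.
  rewrite /h; have S (s : 'I_n) : \sum_(r < n) (n%:Z - r%:Z) * (r == s)%:Z = n%:Z - s%:Z.
    rewrite (bigD1 s) //= eqxx mulr1 big1 ?addr0 // => i /negPf ->.
    by rewrite mulr0.
  under eq_bigr do rewrite mulrBr mulrDr.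
  by rewrite sumrB big_split /= !S; ring.
have hle nu v : v != 0 -> has_weight nu v -> h nu <= H%:Z.
  move=> v0 wv; have [i vi] : exists i, v 0 i != 0.
    apply/existsP; apply: contraR v0 => /existsPn v0; apply/eqP/rowP => i.
    by rewrite mxE; apply/eqP; rewrite -[_ == _]negbK v0.
  have -> : h nu = h (wt i).
    apply: eq_bigr => r _; congr (_ * _); apply/esym.
    have /(congr1 (fun w : 'rV_N => w 0 i)) := wv r.
    by rewrite mulmx_diag mxE mulrC => /(mulIf vi)/intr_inj.
  apply: le_trans (lez_abs _) _; rewrite lez_nat.
  exact: (@leq_bigmax _ (fun i => absz (h (wt i))) i).
have wu1 : has_weight (fun r => mu r + (r == p)%:Z - (r == q)%:Z) (u *m rho p q).
  move=> r; apply/rowP => j; rewrite mulmx_diag [RHS]mxE mulrC.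
  rewrite [X in _ * X = _]mxE [X in _ = _ * X]mxE !mulr_sumr; apply: eq_bigr => k _.
  have [->|/rho_shifts ->] := eqVneq (rho p q k j) 0; first by rewrite !mulr0.
  have [->|uk] := eqVneq (u 0 k) 0; first by rewrite !(mul0r, mulr0).
  have /(congr1 (fun w : 'rV_N => w 0 k)) := wu r.
  by rewrite mulmx_diag mxE mulrC => /(mulIf uk)/intr_inj ->.
have := hle _ _ u1 wu1; rewrite hE => hle1.
have cu1 : u *m rho p q *m casimir = c *: (u *m rho p q).
  by rewrite -mulmxA -casimir_central mulmxA cu scalemxAl.
have [|nu [v [v0 sv cv dv]]] := IHm _ _ _ u1 wu1 cu1; first by rewrite hE; lia.
exists nu, v; split => //; apply: dominates_trans dv _.
exact: dominates_raise.
Qed.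

(** Once each product is reordered so that its raising factor acts first, only diagonal operators
    survive. *)
Lemma gl_singular_casimir mu u : gl_singular mu u ->
  u *m casimir = (casimir_value mu)%:~R *: u.
Proof.
move=> [s w].
have E p q : u *m (rho p q *m rho q p) =
  ((p == q)%:Z * mu p ^+ 2 + (q < p)%N%:Z * (mu q - mu p))%:~R *: u.
  rewrite mulmxA; have [pq|qp|/val_inj ->] := ltngtP p q.
  - by rewrite s // mul0mx -val_eqE /= ltn_eqF // mul0r mul0r scale0r.
  - have := rho_comm q p p q; rewrite !eqxx !scale1r => /eqP.
    rewrite subr_eq => /eqP E; rewrite -mulmxA E mulmxDr mulmxBr !w mulmxA (s q p) //.
    rewrite mul0mx addr0 -scalerBl -rmorphB -val_eqE /= gtn_eqF // mul0r.
    by rewrite add0r mul1r.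
  - by rewrite eqxx w -scalemxAl w scalerA -rmorphM /= mul1r mul0r addr0 expr2.
rewrite /casimir mulmx_sumr; under eq_bigr do rewrite mulmx_sumr.
under eq_bigr do under eq_bigr do rewrite E.
under eq_bigr do rewrite -scaler_suml -rmorph_sum.
rewrite -scaler_suml -rmorph_sum; congr (_%:~R *: _).
under eq_bigr do rewrite big_split /=.
rewrite big_split /=.
have -> : \sum_(p < n) \sum_(q < n) (p == q)%:Z * mu p ^+ 2 = \sum_p mu p ^+ 2.
  apply: eq_bigr => p _; rewrite (bigD1 p) //= eqxx mul1r big1 ?addr0 // => q.
  by rewrite eq_sym => /negPf ->; rewrite mul0r.
have -> : \sum_(p < n) \sum_(q < n) (q < p)%N%:Z * (mu q - mu p) =
   \sum_(p < n) (\sum_(q < n) ((p < q)%N%:Z - (q < p)%N%:Z)) * mu p.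
  under eq_bigr do (under eq_bigr do rewrite mulrBr; rewrite sumrB).
  rewrite sumrB exchange_big /= -sumrB; apply: eq_bigr => p _.
  by rewrite mulr_suml -sumrB; apply: eq_bigr => q _; ring.
rewrite /casimir_value -big_split; apply: eq_bigr => p _ /=.
have -> : \sum_(q < n) ((p < q)%N%:Z - (q < p)%N%:Z) = n%:Z - 1 - (2 * p)%:Z.
  have -> : \sum_(q < n) ((p < q)%N%:Z - (q < p)%N%:Z) =
    \sum_(q < n) (1 - (q == p)%:Z - 2 * (q < p)%N%:Z).
    apply: eq_bigr => q _; rewrite -val_eqE /=.
    by case: ltngtP.
  rewrite !sumrB -mulr_sumr sumr_const card_ord.
  have -> : \sum_(q < n) (q == p)%:Z = 1.
    by rewrite (bigD1 p) //= eqxx big1 ?addr0 // => q /negPf ->.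
  have -> : \sum_(q < n) (q < p)%N%:Z = p%:Z.
    rewrite -(big_mkord xpredT (fun q => (q < p)%N%:Z)) (big_cat_nat _ (n := p)) //=; last exact: ltnW.
    rewrite big_nat (eq_bigr (fun=> 1)); last by move=> i /andP[_ ->].
    rewrite -big_nat sumr_const_nat subn0 [X in _ + X]big_nat big1 ?addr0 -?pmulrn ?natz //.
    by move=> i /andP[pi _]; rewrite ltnNge pi.
  by rewrite !natz PoszM.
by ring.
Qed.

End WeightCount.

(* Alternating sums of traces only see the Casimir operator through its value
   at lam, so the identity may be replaced by the spectral projection of that
   value: it kills the weights strictly above lam and projects the weight space
   of lam onto the singular vectors. *)
Lemma rank_gl_singular (F : numFieldType) n N
    (rho : 'I_n -> 'I_n -> 'M[F]_N) (wt : 'I_N -> 'I_n -> int) lam :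
  (forall p i j, rho p p i j = (wt i p)%:~R *+ (i == j)) ->
  (forall p q r s, rho r s *m rho p q - rho p q *m rho r s =
     (q == r)%:R *: rho p s - (p == s)%:R *: rho r q) ->
  (forall mu u, u != 0 -> gl_singular rho mu u -> dominant mu) ->
  dominant lam ->
  exists S : 'M[F]_N, (forall u : 'rV_N, (u <= S)%MS <-> gl_singular rho lam u) /\
   (\rank S)%:Z = \sum_(w : 'S_n) (-1) ^+ w *
     #|[set i | [forall p, wt i p == lam p - p%:Z + (w p)%:Z]]|%:Z.
Proof.
(* Polynomials are evaluated in a ring of matrices, which requires a nonzero size. *)
case: N rho wt => [|N] rho wt rho_diag rho_comm sing_dom dlam.
  exists 0; split=> [u|].
    rewrite [u]thinmx0 sub0mx; split=> // _; split=> [p q _|p].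
      by apply/rowP => -[].
    by apply/rowP => -[].
  rewrite mxrank0 big1 // => w _; rewrite eq_card0 ?mulr0 //.
  by case.
pose Om := casimir rho; pose c : F := (casimir_value lam)%:~R.
have cOm := casimir_central rho_comm.
have cP (f : {poly F}) p q : horner_mx Om f *m rho p q = rho p q *m horner_mx Om f.
  elim/poly_ind: f => [|f a IHf]; first by rewrite rmorph0 mul0mx mulmx0.
  rewrite rmorphD rmorphM /= horner_mx_X horner_mx_C mulmxDl mulmxDr.
  by rewrite -[_ * Om *m _]mulmxA cOm 2!mulmxA IHf scalar_mxC.
have altP (f : {poly F}) : altsum (wtrace wt (horner_mx Om f)) lam =
    f.[c] * altsum (wtrace wt 1%:M) lam.
  have alt_ext (g h : ('I_n -> int) -> F) : g =1 h -> altsum g lam = altsum h lam.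
    by move=> gh; apply: eq_bigr => w _; rewrite gh.
  elim/poly_ind: f => [|f a IHf].
    rewrite rmorph0 horner0 mul0r /altsum big1 // => w _.
    by rewrite /wtrace big1 ?mulr0 // => i _; rewrite mxE.
  rewrite rmorphD rmorphM /= horner_mx_X horner_mx_C hornerMXaddC.
  transitivity (altsum (wtrace wt (horner_mx Om f *m Om)) lam +
      a * altsum (wtrace wt 1%:M) lam).
    rewrite /altsum [X in _ = _ + X]mulr_sumr -[RHS]big_split; apply: eq_bigr => w _ /=.
    rewrite mulrCA -mulrDr; congr (_ * _); rewrite /wtrace [X in _ = _ + X]mulr_sumr -[RHS]big_split.
    by apply: eq_bigr => i _; rewrite !mxE mulr_natr.
  rewrite (altsum_wtrace_casimir rho_diag rho_comm) //.
  by rewrite IHf mulrDl -/c mulrA [c * _]mulrC.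
(* Splitting off all factors X - c leaves [g] with [g.[c]] nonzero. Then [g] of the Casimir operator
   kills the other generalized eigenspaces and is [g.[c]] on eigenvectors for [c]: up to this scalar
   it serves as the projection. If [c] is no eigenvalue, [k = 0] and [G = 0]. *)
have [k [g /implyP gc chiE]] := multiplicity_XsubC (char_poly Om) c.
have {}gc : g.[c] != 0.
  by apply: gc; rewrite monic_neq0 // char_poly_monic.
pose G := horner_mx Om g.
have GK : G *m (Om - c%:M) ^+ k = 0.
  have := Cayley_Hamilton Om; rewrite chiE rmorphM rmorphXn rmorphB /=.
  by rewrite horner_mx_X horner_mx_C.
have OmC (u : 'rV_N.+1) : u *m G *m Om = u *m Om *m G.
  rewrite -!mulmxA; congr (_ *m _); rewrite /G.
  by have := comm_horner_mx2 Om g 'X; rewrite horner_mx_X.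
have wG mu u : has_weight rho mu u -> has_weight rho mu (u *m G).
  by move=> wu p; rewrite -mulmxA cP mulmxA wu scalemxAl.
(* the part of generalized Casimir eigenvalue c vanishes above lam *)
have killed mu u : has_weight rho mu u -> dominates mu lam ->
    u *m G != 0 -> mu =1 lam.
  move=> wu dmu uG0.
  pose v j := u *m G *m (Om - c%:M) ^+ j.
  have vk : v k = 0 by rewrite /v -mulmxA GK mulmx0.
  have wv j : has_weight rho mu (v j).
    move=> p; rewrite /v; elim: j => [|j IHj]; first by rewrite expr0 mulmx1 (wG _ _ wu).
    have cD : (Om - c%:M) *m rho p p = rho p p *m (Om - c%:M).
      by rewrite mulmxBl mulmxBr cOm scalar_mxC.
    by rewrite exprSr -mulmxE !mulmxA -mulmxA cD mulmxA IHj -scalemxAl.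
  (* The last nonzero [v j] is a genuine eigenvector for [c], to which raising applies. *)
  have [j [vj0 vj1]] : exists j, v j != 0 /\ v j.+1 = 0.
    have v0 : v 0%N != 0 by rewrite /v expr0 mulmx1.
    elim: k vk {GK chiE} => [v00|k IHk vk]; first by rewrite v00 eqxx in v0.
    by have [/IHk //|vk0] := eqVneq (v k) 0; exists k.
  have cv : v j *m Om = c *: v j.
    by apply/eqP; rewrite -subr_eq0 -mul_mx_scalar -mulmxBr -vj1 /v exprSr -mulmxE !mulmxA.
  have [nu [u' [u'0 su' cu' dnu]]] :=
    raise_to_singular rho_diag rho_comm vj0 (wv j) cv.
  have nulam : nu =1 lam.
    apply: casimir_value_inj => //; first exact: sing_dom su'.
      exact: dominates_trans dmu.
    apply: (@intr_inj F); apply/eqP; rewrite -subr_eq0.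
    have /eqP := gl_singular_casimir rho_comm su'; rewrite cu' -subr_eq0 -scalerBl.
    by rewrite scaler_eq0 (negPf u'0) orbF -opprB oppr_eq0.
  apply: dominates_antisym dmu _.
  by rewrite (_ : lam = nu) //; apply/funext => p; rewrite nulam.
(* A raised vector has a weight strictly above [lam], and there [G] vanishes. *)
have singG u : has_weight rho lam u -> gl_singular rho lam (u *m G).
  move=> wu; split=> [p q pq|]; last exact: wG.
  rewrite -mulmxA cP mulmxA; apply/eqP/negPn/negP => uG0.
  have ww : has_weight rho (fun r => lam r + (r == p)%:Z - (r == q)%:Z) (u *m rho p q).
    move=> r; have := rho_comm r r p q => /eqP; rewrite subr_eq => /eqP E.
    rewrite -mulmxA E mulmxDr mulmxBr mulmxA wu -scalemxAl.
    rewrite -!scalemxAr rmorphB rmorphD /= scalerBl scalerDl [LHS]addrC -[RHS]addrA.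
    congr (_ + (_ - _)).
      by case: eqP => [->|]; rewrite ?scale0r.
    by case: eqP => [->|]; rewrite ?scale0r.
  have := killed _ _ ww (dominates_raise _ pq) uG0 p.
  rewrite eqxx -val_eqE /= ltn_eqF //=; lia.
have Gsing u : gl_singular rho lam u -> u *m G = g.[c] *: u.
  move=> /(gl_singular_casimir rho_comm) uE; rewrite /G.
  elim/poly_ind: (g) => [|f a IHf]; first by rewrite rmorph0 mulmx0 horner0 scale0r.
  rewrite rmorphD rmorphM /= horner_mx_X horner_mx_C mulmxDr mulmxA IHf.
  by rewrite -scalemxAl uE hornerMXaddC scalerDl scalerA mul_mx_scalar.
pose Pi : 'M[F]_N.+1 := diag_mx (\row_i [forall p, wt i p == lam p]%:R).
have wPi u : has_weight rho lam (u *m Pi).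
  move=> p; apply/rowP => i; rewrite mul_mx_diag !mxE (bigD1 i) //= !mxE.
  rewrite rho_diag eqxx big1 ?addr0; last first.
    by move=> j /negPf ji; rewrite rho_diag ji mulr0.
  case: forallP => [/(_ p)/eqP ->|]; last by rewrite mulr0 mul0r mulr0.
  by rewrite mulrC.
have Piw u : has_weight rho lam u -> u *m Pi = u.
  move=> wu; apply/rowP => i; rewrite mul_mx_diag !mxE.
  have [->|ui] := eqVneq (u 0 i) 0; first by rewrite mul0r.
  case: forallP => [_|[]]; first by rewrite mulr1.
  move=> p; have /(congr1 (fun w : 'rV_N.+1 => w 0 i)) := wu p.
  rewrite !mxE (bigD1 i) //= rho_diag eqxx big1 ?addr0; last first.
    by move=> j /negPf ji; rewrite rho_diag ji mulr0.
  by rewrite mulrC => /(mulIf ui)/intr_inj ->.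
(* The image of [S] is the space of singular vectors of weight [lam], on which [S] is the scalar
   [g.[c]]; so its trace is [g.[c]] times its rank. *)
pose S := Pi *m G.
have singS u : gl_singular rho lam (u *m S) by rewrite mulmxA; apply: singG.
have Ssing u : gl_singular rho lam u -> u *m S = g.[c] *: u.
  by move=> su; rewrite mulmxA Piw ?Gsing //; case: su.
have SS : S *m S = g.[c] *: S.
  by apply/row_matrixP => i; rewrite row_mul [RHS]linearZ /= rowE Ssing.
exists S; split=> [u|].
  split=> [/submxP[D ->] //|/Ssing uS].
  by rewrite -(eqmx_scale _ gc) -uS submxMl.
apply: (@intr_inj F); apply: (mulfI gc).
rewrite -[_%:~R]/((\rank S)%:R) -(mxtrace_quasi_idempotent SS).
transitivity (altsum (wtrace wt G) lam); last first.
  rewrite altP; congr (_ * _); rewrite rmorph_sum; apply: eq_bigr => w _ /=.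
  rewrite rmorphM rmorphXn rmorphN1; congr (_ * _).
  rewrite /= -pmulrn -sum1_card natr_sum /=.
  by apply: eq_big => [i|i _]; rewrite ?inE // mxE eqxx.
(* All weights [lam - id + w] dominate [lam], so the traces of [G] there vanish unless [w] is the
   identity. *)
rewrite /altsum (bigD1 1%g) //= big1 ?addr0 => [|w w1]; last first.
  rewrite [wtrace _ _ _]big1 ?mulr0 // => i /forallP wi; apply/eqP.
  apply: contraNT w1 => Gii; apply/eqP/permP => p; rewrite perm1.
  apply/val_inj/eqP; rewrite -eqz_nat; apply/eqP.
  suff /(_ p) : (fun p => lam p - p%:Z + (w p)%:Z) =1 lam by move=> /=; lia.
  apply: (killed _ (delta_mx 0 i)).
  - move=> r; rewrite -rowE; apply/rowP => j; rewrite !mxE rho_diag.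
    by rewrite (eqP (wi r)) eqxx /= eq_sym mulr_natr.
  - exact: dominates_perm.
  - apply: contraNneq Gii => /(congr1 (fun u : 'rV_N.+1 => u 0 i)).
    by rewrite -rowE !mxE => ->.
rewrite odd_perm1 mul1r.
have -> : (fun p => lam p - p%:Z + ((1%g : 'S_n) p)%:Z) = lam.
  by apply/funext => p; rewrite perm1 subrK.
rewrite /wtrace [RHS]big_mkcond; apply: eq_bigr => i _ /=.
rewrite /S mul_diag_mx !mxE.
by case: forallP => _; rewrite ?mul1r ?mul0r.
Qed.

(** * The Fock space and the dual pair (gl_n, ghat) *)

(* Locked: otherwise failed unifications compare finitely supported functions. *)
HB.lock Definition inc (I : choiceType) (a : {cmonom I}) (u : I) : {cmonom I} :=
  mmul a (ucm u).
HB.lock Definition dec (I : choiceType) (a : {cmonom I}) (u : I) : {cmonom I} :=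
  divcm a (ucm u).

Section Monomials.
Variable I : choiceType.
Implicit Types (a b : {cmonom I}) (u v w : I).

Lemma incE a u v : inc a u v = (a v + (u == v))%N.
Proof. by rewrite inc.unlock cmM cmU. Qed.

Lemma decE a u v : dec a u v = (a v - (u == v))%N.
Proof.
rewrite dec.unlock /divcm cmE fsfunE -cmE_neq0 cmU.
by case: eqP => // ->; rewrite sub0n.
Qed.

Lemma cmonom_eq a b : (forall u, a u = b u) -> a = b.
Proof. by move=> E; apply/eqP/cmP. Qed.

Lemma incC a u v : inc (inc a u) v = inc (inc a v) u.
Proof. by apply: cmonom_eq => w; rewrite !incE addnAC. Qed.

Lemma decC a u v : dec (dec a u) v = dec (dec a v) u.
Proof. by apply: cmonom_eq => w; rewrite !decE subnAC. Qed.

Lemma incK a u : dec (inc a u) u = a.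
Proof. by apply: cmonom_eq => w; rewrite decE incE addnK. Qed.

Lemma decK a u : (0 < a u)%N -> inc (dec a u) u = a.
Proof.
move=> au; apply: cmonom_eq => w; rewrite incE decE subnK //.
by case: eqP => // <-.
Qed.

Lemma inc_dec a u v : u != v -> dec (inc a u) v = inc (dec a v) u.
Proof.
move=> uv; apply: cmonom_eq => w; rewrite !(incE, decE).
case: (eqVneq u w) => [<-|_] /=; last by rewrite !addn0.
by rewrite eq_sym (negPf uv) !subn0.
Qed.

End Monomials.

(* A function on monomials stands for the formal sum of divided powers with
   these coefficients. *)
Definition fock (K : comNzRingType) (I : choiceType) : Type := {cmonom I} -> K.

(** * The Weyl algebra in the basis of divided powers *)

Section Weyl.
Variables (K : comNzRingType) (I : choiceType).
Local Notation Fock := (fock K I).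
Implicit Types (f g : Fock) (c : K) (a b : {cmonom I}) (u v w : I).

HB.instance Definition _ := gen_eqMixin Fock.
HB.instance Definition _ := gen_choiceMixin Fock.

Let add f g : Fock := fun a => f a + g a.
Let opp f : Fock := fun a => - f a.
Let zero : Fock := fun=> 0.
Let scale c f : Fock := fun a => c * f a.

Fact fock_addA : associative add.
Proof. by move=> f g h; apply/funext => a; rewrite /add addrA. Qed.
Fact fock_addC : commutative add.
Proof. by move=> f g; apply/funext => a; rewrite /add addrC. Qed.
Fact fock_add0 : left_id zero add.
Proof. by move=> f; apply/funext => a; rewrite /add add0r. Qed.
Fact fock_addN : left_inverse zero opp add.
Proof. by move=> f; apply/funext => a; rewrite /add addNr. Qed.
HB.instance Definition _ :=
  GRing.isZmodule.Build Fock fock_addA fock_addC fock_add0 fock_addN.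

Fact fock_scaleA c d f : scale c (scale d f) = scale (c * d) f.
Proof. by apply/funext => a; rewrite /scale mulrA. Qed.
Fact fock_scale1 : left_id 1 scale.
Proof. by move=> f; apply/funext => a; rewrite /scale mul1r. Qed.
Fact fock_scaleDr : right_distributive scale +%R.
Proof. by move=> c f g; apply/funext => a; exact: mulrDr. Qed.
Fact fock_scaleDl f : {morph scale^~ f : c d / c + d}.
Proof. by move=> c d; apply/funext => a; exact: mulrDl. Qed.
HB.instance Definition _ := GRing.Zmodule_isLmodule.Build K Fock
  fock_scaleA fock_scale1 fock_scaleDr fock_scaleDl.

Lemma fockD f g a : (f + g) a = f a + g a. Proof. by []. Qed.
Lemma fockN f a : (- f) a = - f a. Proof. by []. Qed.
Lemma fock0 a : (0 : Fock) a = 0. Proof. by []. Qed.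
Lemma fockZ c f a : (c *: f) a = c * f a. Proof. by []. Qed.
Lemma fockB f g a : (f - g) a = f a - g a. Proof. by []. Qed.
Lemma fock_sum (T : Type) (r : seq T) (P : pred T) (F : T -> Fock) a :
  (\sum_(i <- r | P i) F i) a = \sum_(i <- r | P i) F i a.
Proof. exact: (big_morph (fun f : Fock => f a)). Qed.
Definition fockE := (fockD, fockN, fockZ, fock0, fock_sum).

(* In the basis of divided powers, multiplication by the variable u and the
   partial derivative with respect to it. *)
Definition mulv u f : Fock := fun a => (a u)%:R * f (dec a u).
Definition derv u f : Fock := fun a => f (inc a u).

Fact mulv_linear u : linear (mulv u).
Proof.
move=> c f g; apply/funext => a; rewrite /mulv.
by rewrite !fockE; ring.
Qed.
HB.instance Definition _ u := GRing.isLinear.Build K Fock Fock *:%R (mulv u) (mulv_linear u).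

Fact derv_linear u : linear (derv u). Proof. by []. Qed.
HB.instance Definition _ u := GRing.isLinear.Build K Fock Fock *:%R (derv u) (derv_linear u).

Lemma mulvC u v f : mulv u (mulv v f) = mulv v (mulv u f).
Proof.
have [->//|uv] := eqVneq u v; apply/funext => a; rewrite /mulv decC !decE.
by rewrite (negPf uv) eq_sym (negPf uv) !subn0 mulrCA.
Qed.

Lemma dervC u v f : derv u (derv v f) = derv v (derv u f).
Proof. by apply/funext => a; rewrite /derv incC. Qed.

Lemma derv_mulv u v f : derv u (mulv v f) = mulv v (derv u f) + (u == v)%:R *: f.
Proof.
apply/funext => a; rewrite !fockE /derv /mulv incE.
have [->|uv] := eqVneq u v; last by rewrite addn0 inc_dec // mul0r addr0.
rewrite incK mul1r natrD mulrDl mul1r; congr (_ + _).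
by have [->|av] := posnP (a v); rewrite ?mul0r // decK.
Qed.

End Weyl.

(** * Normally ordered quadratic operators and the elementary matrices *)

Section FockSpace.
Variables (K : comNzRingType) (n : nat).
Local Notation I := (int * 'I_n)%type.
Local Notation Fock := (fock K I).
Implicit Types (f g : Fock) (a b : {cmonom I}) (u v w : I) (p q r s : 'I_n).

(* In the rows k <= 0 multiplication and derivation exchange their roles, with
   the sign that preserves [psis v, psi u] = delta_uv. *)
Definition psi u f : Fock := if 0 < u.1 then mulv u f else - derv u f.
Definition psis u f : Fock := if 0 < u.1 then derv u f else mulv u f.

Fact psi_linear u : linear (psi u).
Proof.
move=> c f g; rewrite /psi; case: ifP => _; first exact: linearP.
apply/funext => a; rewrite /derv.
by rewrite !fockE; ring.
Qed.
HB.instance Definition _ u := GRing.isLinear.Build K Fock Fock *:%R (psi u) (psi_linear u).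

Fact psis_linear u : linear (psis u).
Proof. by move=> c f g; rewrite /psis; case: ifP => _; exact: linearP. Qed.
HB.instance Definition _ u := GRing.isLinear.Build K Fock Fock *:%R (psis u) (psis_linear u).

Lemma psiDZ u c f g : psi u (f + c *: g) = psi u f + c *: psi u g.
Proof. by rewrite addrC psi_linear addrC. Qed.

Lemma psisDZ u c f g : psis u (f + c *: g) = psis u f + c *: psis u g.
Proof. by rewrite addrC psis_linear addrC. Qed.

Lemma mulvN u f : mulv u (- f) = - mulv u f.
Proof. by apply/funext => a; rewrite /mulv mulrN. Qed.

Lemma dervN u f : derv u (- f) = - derv u f.
Proof. by []. Qed.

Let sign_neq u v : 0 < u.1 -> v.1 <= 0 -> (u == v) = false /\ (v == u) = false.
Proof.
move=> u0 v0; rewrite [v == u]eq_sym.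
by have /negPf -> : u != v by apply: contraTneq v0 => <-; rewrite -ltNge.
Qed.

Lemma psiC u v f : psi u (psi v f) = psi v (psi u f).
Proof.
rewrite /psi; have [u0|u0] := ltP 0 u.1; have [v0|v0] := ltP 0 v.1.
- exact: mulvC.
- by rewrite mulvN derv_mulv (sign_neq u0 v0).2 scale0r addr0.
- by rewrite mulvN derv_mulv (sign_neq v0 u0).2 scale0r addr0.
- by rewrite !dervN dervC.
Qed.

Lemma psisC u v f : psis u (psis v f) = psis v (psis u f).
Proof.
rewrite /psis; have [u0|u0] := ltP 0 u.1; have [v0|v0] := ltP 0 v.1.
- exact: dervC.
- by rewrite derv_mulv (sign_neq u0 v0).1 scale0r addr0.
- by rewrite derv_mulv (sign_neq v0 u0).1 scale0r addr0.
- exact: mulvC.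
Qed.

Lemma psis_psi u v f : psis u (psi v f) = psi v (psis u f) + (u == v)%:R *: f.
Proof.
rewrite /psis /psi; have [u0|u0] := ltP 0 u.1; have [v0|v0] := ltP 0 v.1.
- exact: derv_mulv.
- by rewrite dervN dervC (sign_neq u0 v0).1 scale0r addr0.
- by rewrite mulvC (sign_neq v0 u0).2 scale0r addr0.
- by rewrite mulvN derv_mulv opprD eq_sym subrK.
Qed.

Opaque psi psis.

(* The normally ordered product of psi u and psis v. *)
Definition bil u v f : Fock := psi u (psis v f) + ((u == v) && (u.1 <= 0))%:R *: f.

Lemma bilE u v f : bil u v f = psi u (psis v f) + ((u == v) && (u.1 <= 0))%:R *: f.
Proof. by []. Qed.

Lemma bilEa u v f a :
  bil u v f a = psi u (psis v f) a + ((u == v) && (u.1 <= 0))%:R * f a.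
Proof. by []. Qed.

Fact bil_linear u v : linear (bil u v).
Proof.
move=> c f g; rewrite /bil psis_linear psi_linear !scalerDr !scalerA.
by rewrite [c * _]mulrC addrACA.
Qed.
HB.instance Definition _ u v := GRing.isLinear.Build K Fock Fock *:%R (bil u v) (bil_linear u v).

Lemma bilDZ u v c f g : bil u v (f + c *: g) = bil u v f + c *: bil u v g.
Proof. by rewrite addrC bil_linear addrC. Qed.

Lemma bil_psi u v w f : bil u v (psi w f) = psi w (bil u v f) + (v == w)%:R *: psi u f.
Proof.
by rewrite /bil psis_psi !psiDZ (psiC u w) addrAC.
Qed.

Lemma bil_psis u v w f : bil u v (psis w f) = psis w (bil u v f) - (u == w)%:R *: psis v f.
Proof.
rewrite /bil psisDZ psis_psi (psisC w v) [w == u]eq_sym.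
by rewrite addrAC addrK.
Qed.

(** The ordering constants are scalars and drop out of the commutator, so the right-hand side
    consists of unordered products. *)
Lemma bil_comm u v u' v' f : bil u v (bil u' v' f) - bil u' v' (bil u v f) =
  (v == u')%:R *: psi u (psis v' f) - (u == v')%:R *: psi u' (psis v f).
Proof.
have E g : bil u' v' g = psi u' (psis v' g) + ((u' == v') && (u'.1 <= 0))%:R *: g by [].
rewrite !E bilDZ bil_psi bil_psis -scaleNr psiDZ scaleNr opprD addrACA subrr addr0.
by rewrite addrAC [X in X - _ + _]addrC addrK addrC.
Qed.

Transparent psi psis.

Lemma bil_diag u f a :
  bil u u f a = (if 0 < u.1 then (a u)%:R else - (a u)%:R) * f a.
Proof.
rewrite /bil eqxx /= !fockE /psi /psis.
case: ltP => u0 /=.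
  rewrite mul0r addr0 /mulv /derv.
  by have [->|/decK ->] := posnP (a u); rewrite ?mul0r.
rewrite fockN /derv /mulv incE eqxx incK natrD mulrDl.
by rewrite opprD !mul1r subrK mulNr.
Qed.

Lemma bil_xx u v f a : 0 < u.1 -> 0 < v.1 -> bil u v f a = (a u)%:R * f (inc (dec a u) v).
Proof.
move=> u0 v0; rewrite /bil (leNgt u.1) u0 andbF !fockE.
by rewrite mul0r addr0 /psi /psis u0 v0.
Qed.

Lemma bil_yy u v f a : u.1 <= 0 -> v.1 <= 0 -> u != v ->
  bil u v f a = - ((a v)%:R * f (dec (inc a u) v)).
Proof.
move=> u0 v0 uv; rewrite /bil (negPf uv) !fockE mul0r addr0.
rewrite /psi /psis !ltNge u0 v0 /= fockE.
by rewrite /derv /mulv incE (negPf uv) addn0.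
Qed.

Lemma bil_xy u v f a : 0 < u.1 -> v.1 <= 0 ->
  bil u v f a = (a u)%:R * (a v)%:R * f (dec (dec a u) v).
Proof.
move=> u0 v0; have [uv _] := sign_neq u0 v0.
rewrite /bil uv !fockE mul0r addr0.
by rewrite /psi /psis u0 ltNge v0 /mulv /= decE uv subn0 mulrA.
Qed.

Lemma bil_yx u v f a : u.1 <= 0 -> 0 < v.1 ->
  bil u v f a = - f (inc (inc a u) v).
Proof.
move=> u0 v0; have [_ uv] := sign_neq v0 u0.
rewrite /bil uv !fockE mul0r addr0.
by rewrite /psi /psis v0 ltNge u0 /= fockE.
Qed.

Opaque psi psis mulv derv bil.

Definition ghop (i j : int) f : Fock := \sum_p bil (i, p) (j, p) f.

Fact ghop_linear i j : linear (ghop i j).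
Proof.
move=> c f g; rewrite /ghop scaler_sumr -big_split.
by apply: eq_bigr => p _; rewrite linearP.
Qed.
HB.instance Definition _ i j := GRing.isLinear.Build K Fock Fock *:%R (ghop i j) (ghop_linear i j).

Lemma ghopE i j f a : ghop i j f a = \sum_p bil (i, p) (j, p) f a.
Proof. by rewrite /ghop fock_sum. Qed.

(** The terms with [n%:R] come from restoring the normal order, once for each of the n columns; they
    will add up to the cocycle at level -n. *)
Lemma ghop_comm i j k l f : ghop i j (ghop k l f) - ghop k l (ghop i j f) =
  (j == k)%:R *: (ghop i l f - (n%:R * ((i == l) && (i <= 0))%:R) *: f)
  - (i == l)%:R *: (ghop k j f - (n%:R * ((k == j) && (k <= 0))%:R) *: f).
Proof.
pose G i j := \sum_p psi (i, p) (psis (j, p) f).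
have GE i' j' : ghop i' j' f - (n%:R * ((i' == j') && (i' <= 0))%:R) *: f = G i' j'.
  have -> d : (n%:R * d) *: f = \sum_(p < n) d *: f.
    by rewrite sumr_const card_ord -scaler_nat scalerA.
  rewrite /ghop -sumrB; apply: eq_bigr => p _.
  by rewrite bilE xpair_eqE eqxx andbT addrK.
rewrite !GE.
have -> : ghop i j (ghop k l f) = \sum_p \sum_q bil (i, p) (j, p) (bil (k, q) (l, q) f).
  by rewrite {1}/ghop; apply: eq_bigr => p _; rewrite linear_sum.
have -> : ghop k l (ghop i j f) = \sum_p \sum_q bil (k, q) (l, q) (bil (i, p) (j, p) f).
  by rewrite {1}/ghop exchange_big; apply: eq_bigr => p _; rewrite linear_sum.
rewrite -sumrB /G !scaler_sumr -sumrB; apply: eq_bigr => p _.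
rewrite -sumrB (bigD1 p) //= bil_comm !xpair_eqE eqxx !andbT.
rewrite big1 ?addr0 // => q qp; rewrite bil_comm !xpair_eqE [p == q]eq_sym.
by rewrite (negPf qp) !andbF !scale0r subr0.
Qed.

End FockSpace.

(** * The commuting action of gl_n, weights and energy *)

Section DualPair.
Variables (K : comNzRingType) (n : nat).
Local Notation I := (int * 'I_n)%type.
Local Notation Fock := (fock K I).
Implicit Types (f g : Fock) (a b : {cmonom I}) (u v w : I) (p q r s : 'I_n).
Implicit Types (S : {fset int}) (i j k : int).

Definition within S a := forall u, u.1 \notin S -> a u = 0%N.

Definition rows a : {fset int} := [fset u.1 | u in finsupp a]%fset.

Lemma within_rows a : within (rows a) a.
Proof.
move=> u ua; apply/eqP; rewrite cmE_eq0; apply: contra ua => ua.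
exact: in_imfset.
Qed.

Lemma within_sub S S' a : (S `<=` S')%fset -> within S a -> within S' a.
Proof.
by move=> /fsubsetP sub w u uS'; apply: w; apply: contra uS'; exact: sub.
Qed.

Lemma within_inc S a u : u.1 \in S -> within S a -> within S (inc a u).
Proof.
move=> uS w v vS; rewrite incE w // add0n.
by case: eqP => // uv; rewrite -uv uS in vS.
Qed.

Lemma within_dec S a u : within S a -> within S (dec a u).
Proof. by move=> w v vS; rewrite decE w. Qed.

Lemma psi_local S u f g a : u.1 \in S -> within S a ->
  (forall b, within S b -> f b = g b) -> psi u f a = psi u g a.
Proof.
move=> uS aS E; rewrite /psi; case: ifP => _.
  by rewrite /mulv E //; exact: within_dec.
by rewrite !fockE /derv E //; exact: within_inc.
Qed.

Lemma psis_local S u f g a : u.1 \in S -> within S a ->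
  (forall b, within S b -> f b = g b) -> psis u f a = psis u g a.
Proof.
move=> uS aS E; rewrite /psis; case: ifP => _.
  by rewrite /derv E //; exact: within_inc.
by rewrite /mulv E //; exact: within_dec.
Qed.

Lemma bil_local S u v f g a : u.1 \in S -> v.1 \in S -> within S a ->
  (forall b, within S b -> f b = g b) -> bil u v f a = bil u v g a.
Proof.
move=> uS vS aS E; rewrite !bilE !fockE E //; congr (_ + _).
by apply: (psi_local uS aS) => b bS; apply: (psis_local vS bS).
Qed.

Lemma ghop_local S i j f g a : i \in S -> j \in S -> within S a ->
  (forall b, within S b -> f b = g b) -> ghop i j f a = ghop i j g a.
Proof.
move=> iS jS aS E; rewrite !ghopE; apply: eq_bigr => p _.
exact: (bil_local _ _ aS).
Qed.

(** For [p = q] and [k <= 0] this is the effect of normal ordering. It makes sums over all rows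
    finite at each monomial. *)
Lemma bil_out S k p q f a : k \notin S -> within S a -> bil (k, p) (k, q) f a = 0.
Proof.
move=> kS aS; have [->|pq] := eqVneq p q.
  by rewrite bil_diag aS // oppr0 if_same mul0r.
have [k0|k0] := ltP 0 k; first by rewrite bil_xx // aS // mul0r.
by rewrite bil_yy ?xpair_eqE ?eqxx // aS // mul0r oppr0.
Qed.

Definition glsum S p q f : Fock := \sum_(k <- S) bil (k, p) (k, q) f.

(** This is the sum over all rows: by [bil_out], any set of rows containing those of [a] gives the
    same value at [a]. *)
Definition glop p q f : Fock := fun a => glsum (rows a) p q f a.

Lemma glopE S p q f a : within S a -> glop p q f a = glsum S p q f a.
Proof.
move=> aS; rewrite /glop /glsum !fock_sum.
pose G k := bil (k, p) (k, q) f a.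
rewrite (big_fset_incl _ (fsubsetUl (rows a) S)); last first.
  by move=> k _ ka; exact: (bil_out _ _ _ ka (@within_rows a)).
rewrite [RHS](big_fset_incl _ (fsubsetUr (rows a) S)) // => k _ ka.
exact: (bil_out _ _ _ ka aS).
Qed.

Fact glsum_linear S p q : linear (glsum S p q).
Proof.
move=> c f g; rewrite /glsum scaler_sumr -big_split.
by apply: eq_bigr => k _; rewrite bil_linear.
Qed.
HB.instance Definition _ S p q :=
  GRing.isLinear.Build K Fock Fock *:%R (glsum S p q) (glsum_linear S p q).

Fact glop_linear p q : linear (glop p q).
Proof.
by move=> c f g; apply/funext => a; rewrite /glop !fockE glsum_linear !fockE.
Qed.
HB.instance Definition _ p q :=
  GRing.isLinear.Build K Fock Fock *:%R (glop p q) (glop_linear p q).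

Lemma glop_local S p q f g a : within S a ->
  (forall b, within S b -> f b = g b) -> glop p q f a = glop p q g a.
Proof.
move=> aS E; rewrite !(glopE _ _ _ aS) /glsum !fock_sum.
by apply: eq_big_seq => k kS; exact: (bil_local _ _ aS).
Qed.

Lemma sum_pick S i (G : int -> K) : i \in S ->
  \sum_(k <- S) (k == i)%:R * G k = G i.
Proof.
move=> iS; rewrite (big_fsetD1 i iS) /= eqxx mul1r big1_fset ?addr0 // => k.
by rewrite in_fsetD1 => /andP[/negPf -> _] _; rewrite mul0r.
Qed.

Lemma glop_psi p q i r f :
  glop p q (psi (i, r) f) = psi (i, r) (glop p q f) + (q == r)%:R *: psi (i, p) f.
Proof.
apply/funext => a; pose S := (i |` rows a)%fset.
have aS : within S a by apply: within_sub (@within_rows a); exact: fsubsetUr.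
have iS : i \in S by rewrite !inE eqxx.
rewrite (glopE _ _ _ aS) !fockE.
rewrite (@psi_local S _ _ (glsum S p q f)) // => [|b bS]; last exact: glopE.
rewrite /glsum !fock_sum (linear_sum (psi (i, r))) fock_sum.
under eq_bigr do rewrite bil_psi !fockE.
rewrite big_split /=; congr (_ + _).
under eq_bigr do rewrite xpair_eqE -mulnb natrM -mulrA.
by rewrite (sum_pick (fun k => _ * psi (k, p) f a)).
Qed.

Lemma glop_psis p q i r f :
  glop p q (psis (i, r) f) = psis (i, r) (glop p q f) - (p == r)%:R *: psis (i, q) f.
Proof.
apply/funext => a; pose S := (i |` rows a)%fset.
have aS : within S a by apply: within_sub (@within_rows a); exact: fsubsetUr.
have iS : i \in S by rewrite !inE eqxx.
rewrite (glopE _ _ _ aS) !fockE.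
rewrite (@psis_local S _ _ (glsum S p q f)) // => [|b bS]; last exact: glopE.
rewrite /glsum !fock_sum (linear_sum (psis (i, r))) fock_sum.
under eq_bigr do rewrite bil_psis !fockE.
rewrite sumrB /=; congr (_ - _).
under eq_bigr do rewrite xpair_eqE -mulnb natrM -mulrA.
by rewrite (sum_pick (fun k => _ * psis (k, q) f a)).
Qed.

Lemma glop_bil p q i r j s f : glop p q (bil (i, r) (j, s) f) =
  bil (i, r) (j, s) (glop p q f) + ((q == r)%:R *: psi (i, p) (psis (j, s) f)
   - (p == s)%:R *: psi (i, r) (psis (j, q) f)).
Proof.
rewrite !bilE (linearD (glop p q)) (linearZ_LR (glop p q)) /= glop_psi glop_psis.
rewrite (linearB (psi (i, r))) (linearZ_LR (psi (i, r))) /=.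
have shuffle (V : zmodType) (x y z t : V) : x - y + z + t = x + t + (z - y).
  by rewrite [z - y]addrC !addrA [LHS]addrAC [x - y + t]addrAC.
by rewrite shuffle.
Qed.

Lemma sum_delta (V : lmodType K) (G : 'I_n -> V) q :
  \sum_p (q == p)%:R *: G p = G q.
Proof.
rewrite (bigD1 q) //= eqxx scale1r big1 ?addr0 // => p; rewrite eq_sym.
by move=> /negPf ->; rewrite scale0r.
Qed.

Lemma sum_deltaB (V : lmodType K) (G H : 'I_n -> V) p q :
  \sum_r ((q == r)%:R *: G r - (p == r)%:R *: H r) = G q - H p.
Proof. by rewrite sumrB !sum_delta. Qed.

(** Summed over the columns, both commutator terms become [psi (i, p) (psis (j, q) f)] and
    cancel. *)
Lemma glop_ghop p q i j f : glop p q (ghop i j f) = ghop i j (glop p q f).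
Proof.
rewrite /ghop (linear_sum (glop p q)) /=.
under eq_bigr do rewrite glop_bil.
rewrite big_split (sum_deltaB (fun r => psi (i, p) (psis (j, r) f))
   (fun r => psi (i, r) (psis (j, q) f))).
by rewrite subrr; exact: addr0.
Qed.

Lemma glop_comm p q r s f : glop p q (glop r s f) - glop r s (glop p q f) =
  (q == r)%:R *: glop p s f - (p == s)%:R *: glop r q f.
Proof.
apply/funext => a; pose S := rows a; have aS : within S a := @within_rows a.
rewrite !fockE (@glop_local S _ _ _ (glsum S r s f)) // => [|b bS]; last exact: glopE.
rewrite {1}/glsum (linear_sum (glop p q)) /= fock_sum.
rewrite !(glopE _ _ _ aS) /glsum !fock_sum -sumrB !mulr_sumr -sumrB.
apply: eq_bigr => k _; rewrite glop_bil !fockE addrAC subrr add0r.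
rewrite !bilEa !xpair_eqE !eqxx [r == q]eq_sym.
(* The ordering constants of both terms coincide, so that gl_n acts without a central term. *)
have shuffle (x y z : K) (b c d : bool) :
    b%:R * x - c%:R * y = b%:R * (x + (c && d)%:R * z) - c%:R * (y + (b && d)%:R * z).
  by case: b; case: c; case: d => /=; rewrite ?mul1r ?mul0r ?addr0 ?subr0 // opprD addrACA subrr addr0.
exact: shuffle.
Qed.

Definition sgcol k : int := if 0 < k then 1 else -1.

(** This is the gl_n-weight of the monomial, and [wtm] is its ghat-weight: see [glop_diag] and
    [ghop_diag]. *)
Definition charge a p : int := \sum_(k <- rows a) sgcol k * (a (k, p))%:Z.

Definition wtm a k : int := sgcol k * (\sum_p a (k, p))%:Z.

Lemma sgcol_mul k m : (sgcol k * m%:Z)%:~R = (if 0 < k then m%:R else - m%:R) :> K.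
Proof. by rewrite /sgcol; case: ifP => _; rewrite ?mul1r // mulN1r rmorphN. Qed.

Lemma glop_diag p f a : glop p p f a = (charge a p)%:~R * f a.
Proof.
rewrite (glopE _ _ _ (@within_rows a)) /glsum fock_sum rmorph_sum mulr_suml.
by apply: eq_bigr => k _ /=; rewrite bil_diag sgcol_mul.
Qed.

Lemma ghop_diag k f a : ghop k k f a = (wtm a k)%:~R * f a.
Proof.
rewrite ghopE /wtm sgcol_mul; under [LHS]eq_bigr do rewrite bil_diag.
rewrite -mulr_suml; congr (_ * _); rewrite natr_sum.
by case: ifP => k0; rewrite /= ?k0 ?sumrN.
Qed.

Definition ht k : nat := if 0 < k then absz k else (absz k).+1.

Lemma ht_pos k : 0 < k -> ht k = absz k. Proof. by rewrite /ht => ->. Qed.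

Lemma ht_npos k : k <= 0 -> ht k = (absz k).+1.
Proof. by rewrite /ht ltNge => ->. Qed.

Definition meas a : nat := (\sum_(u <- finsupp a) ht u.1 * a u)%N.

Lemma measE (S : {fset I}) a : (finsupp a `<=` S)%fset ->
  meas a = (\sum_(u <- S) ht u.1 * a u)%N.
Proof.
move=> aS; rewrite /meas (big_fset_incl _ aS) // => u _.
by rewrite -cmE_eq0 => /eqP ->; rewrite muln0.
Qed.

Lemma meas_inc a u : meas (inc a u) = (meas a + ht u.1)%N.
Proof.
pose S := (finsupp (inc a u))%fset; have uS : u \in S.
  by rewrite -cmE_neq0 incE eqxx addn1.
have aS : (finsupp a `<=` S)%fset.
  apply/fsubsetP => v; rewrite -!cmE_neq0 incE -!lt0n => v0.
  exact: leq_trans (leq_addr _ _).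
rewrite (measE (fsubset_refl S)) (measE aS) (big_fsetD1 u uS) /=.
rewrite [in RHS](big_fsetD1 u uS) /= incE eqxx mulnDr muln1 addnAC; congr (_ + _ + _)%N.
apply: eq_big_seq => v; rewrite in_fsetD1 => /andP[vu _].
by rewrite incE eq_sym (negPf vu) addn0.
Qed.

Lemma meas_dec a u : (0 < a u)%N -> (meas (dec a u) + ht u.1 = meas a)%N.
Proof. by move=> au; rewrite -meas_inc decK. Qed.

(** [meas] is an energy that the operator (i, j) changes by about [j - i]. The correction for
    [j < i] is attained when [j <= 0 < i], where two variables are removed and the heights add up to
    [i - j + 1]. *)
Lemma bil_meas i j p f a : bil (i, p) (j, p) f a != 0 -> exists b,
  f b != 0 /\ (meas a)%:Z + (j - i) - (j < i)%R%:Z <= (meas b)%:Z.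
Proof.
have [<-|ij] := eqVneq i j.
  rewrite bil_diag => F; exists a; split; last by rewrite ltxx; lia.
  by apply: contraNneq F => ->; rewrite mulr0.
have P u : (a u)%:R != 0 :> K -> (0 < a u)%N.
  by rewrite lt0n; apply: contra => /eqP ->.
have [i0|i0] := ltP 0 i; have [j0|j0] := ltP 0 j.
- rewrite bil_xx // => F; exists (inc (dec a (i, p)) (j, p)); split.
    by apply: contraNneq F => ->; rewrite mulr0.
  have /P/meas_dec : (a (i, p))%:R != 0 :> K by apply: contraNneq F => ->; rewrite mul0r.
  by rewrite meas_inc (ht_pos i0) (ht_pos j0); lia.
- rewrite bil_xy // => F; exists (dec (dec a (i, p)) (j, p)); split.
    by apply: contraNneq F => ->; rewrite mulr0.
  have /P/meas_dec : (a (i, p))%:R != 0 :> K.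
    by apply: contraNneq F => ->; rewrite mul0r mul0r.
  have /P ap : (a (j, p))%:R != 0 :> K.
    by apply: contraNneq F => ->; rewrite mulr0 mul0r.
  have := @meas_dec (dec a (i, p)) (j, p).
  rewrite decE xpair_eqE (negPf ij) /= subn0 => /(_ ap).
  by rewrite (ht_pos i0) (ht_npos j0); lia.
- rewrite bil_yx // => F; exists (inc (inc a (i, p)) (j, p)); split.
    by apply: contraNneq F => ->; rewrite oppr0.
  by rewrite !meas_inc (ht_npos i0) (ht_pos j0); lia.
- rewrite bil_yy ?xpair_eqE ?(negPf ij) // => F.
  exists (dec (inc a (i, p)) (j, p)); split.
    by apply: contraNneq F => ->; rewrite mulr0 oppr0.
  have /P ap : (a (j, p))%:R != 0 :> K.
    by apply: contraNneq F => ->; rewrite mul0r oppr0.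
  have := @meas_dec (inc a (i, p)) (j, p).
  rewrite incE meas_inc xpair_eqE (negPf ij) /= addn0 => /(_ ap).
  by rewrite (ht_npos i0) (ht_npos j0); lia.
Qed.

Definition bounded N f := forall a, (N <= meas a)%N -> f a = 0.

(** The bound drops with each raising operator; the inductions on raising terminate for this
    reason. *)
Lemma bounded_ghop_raise N i j f : i < j -> bounded N.+1 f -> bounded N (ghop i j f).
Proof.
move=> ij fN a aN; rewrite ghopE big1 // => p _; apply/eqP.
apply/negPn/negP => /bil_meas[b [/negP fb]].
by rewrite (ltNge j) (ltW ij) /= => ab; apply: fb; rewrite fN //; lia.
Qed.

Lemma ghop_meas N M i j f a : (absz (i - j) <= M)%N -> bounded N f ->
  (N + M.+1 <= meas a)%N -> ghop i j f a = 0.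
Proof.
move=> ijM fN aN; rewrite ghopE big1 // => p _; apply/eqP.
apply/negPn/negP => /bil_meas[b [/negP fb]] ab; apply: fb; rewrite fN //.
by move: ab; case: (j < i); lia.
Qed.

Definition gl_highest (lam : 'I_n -> int) f :=
  (forall p q, (p < q)%N -> glop p q f = 0) /\
  (forall p, glop p p f = (lam p)%:~R *: f).

Definition gh_weight (nu : int -> int) f := forall k, ghop k k f = (nu k)%:~R *: f.

Lemma gl_highest_linear lam c f g :
  gl_highest lam f -> gl_highest lam g -> gl_highest lam (c *: f + g).
Proof.
move=> [fs fw] [gs gw]; split=> [p q pq|p]; rewrite (glop_linear p).
  by rewrite fs // gs // scaler0 addr0.
by rewrite fw gw scalerDr !scalerA mulrC.
Qed.

Lemma gh_weight_linear nu c f g :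
  gh_weight nu f -> gh_weight nu g -> gh_weight nu (c *: f + g).
Proof.
by move=> fw gw k; rewrite (ghop_linear k k) fw gw scalerDr !scalerA mulrC.
Qed.

Lemma gl_highest_ghop lam i j f : gl_highest lam f -> gl_highest lam (ghop i j f).
Proof.
move=> [s w]; split=> [p q pq|p]; rewrite glop_ghop.
  by rewrite s // (linear0 (ghop i j)).
rewrite w.
by rewrite (linearZ_LR (ghop i j)).
Qed.

Lemma gh_weight_ghop nu i j f : gh_weight nu f ->
  gh_weight (fun k => nu k + (k == i)%:Z - (k == j)%:Z) (ghop i j f).
Proof.
move=> w k; have := ghop_comm k k i j f; rewrite w (linearZ_LR (ghop i j)) /=.
move/eqP; rewrite subr_eq => /eqP ->.
rewrite rmorphB rmorphD /= scalerBl scalerDl addrC -addrA; congr (_ + _).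
have [<-|ki] := eqVneq k i; have [<-|kj] := eqVneq k j.
- by rewrite !subrr.
- by rewrite andFb mulr0 !scale0r !subr0.
- by rewrite andFb mulr0 !scale0r !subr0.
- by rewrite !scale0r.
Qed.

End DualPair.

Section Window.
Implicit Types (i j k : int) (N M : nat).

Definition window N : {fset int} :=
  seq_fset tt [seq k%:Z - N%:Z | k : nat <- iota 0 (2 * N).+1].

Lemma mem_window N i : (i \in window N) = (absz i <= N)%N.
Proof.
rewrite seq_fsetE; apply/mapP/idP => [[k]|iN]; first by rewrite mem_iota; lia.
exists (absz (i + N%:Z)); first by rewrite mem_iota; lia.
by lia.
Qed.

Lemma window_sub N M : (N <= M)%N -> (window N `<=` window M)%fset.
Proof. by move=> NM; apply/fsubsetP => i; rewrite !mem_window; lia. Qed.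

Lemma fset_sub_window (S : {fset int}) : exists N, (S `<=` window N)%fset.
Proof.
exists (\max_(i <- S) absz i)%N; apply/fsubsetP => i iS.
by rewrite mem_window; exact: (@leq_bigmax_seq _ _ xpredT absz i iS isT).
Qed.

Lemma fsbig_window (K : zmodType) N (F : int -> K) :
  (forall i, (N < absz i)%N -> F i = 0) ->
  \sum_(i \in [set: int]) F i = \sum_(i <- window N) F i.
Proof.
move=> F0; rewrite (fsbigTE (window N)) // => i.
by rewrite mem_window -ltnNge; exact: F0.
Qed.

Lemma big_window_widen (K : zmodType) N M (F : int -> K) : (N <= M)%N ->
  (forall i, (N < absz i <= M)%N -> F i = 0) ->
  \sum_(i <- window M) F i = \sum_(i <- window N) F i.
Proof.
move=> NM F0; rewrite [RHS](big_fset_incl _ (window_sub NM)) // => i.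
by rewrite !mem_window => iM iN; apply: F0; rewrite iM andbT ltnNge.
Qed.

Lemma sum_window_delta (K : pzRingType) N (F : int -> K) i : (absz i <= N)%N ->
  \sum_(k <- window N) (k == i)%:R * F k = F i.
Proof.
rewrite -mem_window => iS; rewrite (big_fsetD1 i iS) /= eqxx mul1r big1_fset ?addr0 // => k.
by rewrite in_fsetD1 => /andP[/negPf -> _] _; rewrite mul0r.
Qed.

End Window.

(** * The action of banded matrices at level -n *)

Section BandMatrixAction.
Variables (R : realType) (n : nat).
Local Notation C := R[i].
Local Notation I := (int * 'I_n)%type.
Local Notation Fock := (fock C I).
Implicit Types (A B : gl_infty R) (x y : ghat R) (f g : Fock) (a b : {cmonom I}).
Implicit Types (i j k l : int) (N M : nat).

Definition band M A := forall i j, (M < absz (i - j))%N -> A i j = 0.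

Lemma band_exists A : exists M, band M A.
Proof. by have /asboolP[M AM] := gl_val_banded A; exists M. Qed.

Lemma band_le M M' A : (M <= M')%N -> band M A -> band M' A.
Proof. by move=> MM' AM i j ij; apply: AM; apply: leq_ltn_trans ij. Qed.

Lemma entryD A B i j : (A + B) i j = A i j + B i j. Proof. by []. Qed.
Lemma entryN A i j : (- A) i j = - A i j. Proof. by []. Qed.

Lemma gl_ext A B : (forall i j, A i j = B i j) -> A = B.
Proof. by move=> E; apply: val_inj; apply/funext => i; apply/funext => j; exact: E. Qed.

Lemma gl_mulE A B M N i j : band M A -> (absz i + M <= N)%N ->
  gl_mul A B i j = \sum_(k <- window N) A i k * B k j.
Proof.
move=> AM iN; rewrite -[LHS]/(\sum_(k \in [set: int]) A i k * B k j).
by apply: fsbig_window => k kN; rewrite AM ?mul0r //; lia.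
Qed.

Lemma band_mul A B M M' : band M A -> band M' B -> band (M + M') (gl_mul A B).
Proof.
move=> AM BM i j ij; rewrite (gl_mulE _ _ AM (leqnn _)) big1_fset // => k _ _.
have [/AM ->|ik] := ltnP M (absz (i - k)); first by rewrite mul0r.
by rewrite BM ?mulr0 //; lia.
Qed.

(** The bracket with J keeps the entries whose indices lie on different sides of the cut between 0
    and 1; bandedness confines these to a window around 0. *)
Lemma cocycleE A B M N : band M A -> (M <= N)%N ->
  cocycle A B = \sum_(i <- window N) \sum_(j <- window N)
     ((i <= 0)%R%:R - (j <= 0)%R%:R) * (A i j * B j i).
Proof.
move=> AM MN.
have JA i j : gl_bracket (gl_J R) A i j = ((i <= 0)%R%:R - (j <= 0)%R%:R) * A i j.
  have J0 : band 0 (gl_J R).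
    move=> i' j' ij; rewrite -[LHS]/(if i' == j' then _ else 0).
    by case: eqP => // ij'; move: ij; rewrite ij' subrr.
  have JE i' j' : gl_J R i' j' = (j' == i')%:R * (i' <= 0)%R%:R.
    rewrite -[LHS]/(if i' == j' then if i' <= 0 then 1 else 0 else 0) eq_sym.
    by case: eqP; case: (i' <= 0); rewrite /= ?mul1r ?mul0r.
  rewrite entryD entryN mulrBl; congr (_ - _).
    rewrite (gl_mulE _ _ J0 (leqnn _)); under eq_bigr do rewrite JE -mulrA.
    by rewrite (sum_window_delta (fun k => (i <= 0)%R%:R * A k j)) //; lia.
  rewrite (@gl_mulE _ _ M (absz i + absz j + M) _ _ AM); last by lia.
  under eq_bigr do rewrite JE mulrC -mulrA [j == _]eq_sym.
  by rewrite (sum_window_delta (fun k => (k <= 0)%R%:R * A i k)) //; lia.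
rewrite /cocycle /gl_trace.
have bJA : band M (gl_bracket (gl_J R) A).
  by move=> i j ij; rewrite JA AM ?mulr0.
have JA0 i j : (N < absz i)%N || (N < absz j)%N -> gl_bracket (gl_J R) A i j = 0.
  move=> ijN; have [/bJA //|ij] := ltnP M (absz (i - j)).
  rewrite JA; have -> : (j <= 0) = (i <= 0) by apply/idP/idP; lia.
  by rewrite subrr mul0r.
rewrite (@fsbig_window _ N) => [|i iN].
  apply: eq_big_seq => i; rewrite mem_window => iN.
  rewrite (@gl_mulE _ _ M (N + M) _ _ bJA) ?leq_add2r // (@big_window_widen _ N) //.
  - by apply: eq_bigr => j _; rewrite JA mulrA.
  - exact: leq_addr.
  - by move=> j /andP[jN _]; rewrite JA0 ?mul0r // jN orbT.
rewrite (gl_mulE _ _ bJA (leqnn _)) big1_fset // => j _ _.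
by rewrite JA0 ?mul0r // iN.
Qed.

(** The operator reads an exponent of [a] in row [i] or [j], except when [i <= 0 < j]; in that case
    both indices are at most M in absolute value. *)
Lemma ghop_far M N i j f a : within (window N) a -> (absz (i - j) <= M)%N ->
  ~~ ((absz i <= N + M)%N && (absz j <= N + M)%N) -> ghop i j f a = 0.
Proof.
move=> aN ij far; rewrite ghopE big1 // => p _.
have a0 k : (N < absz k)%N -> a (k, p) = 0%N.
  by move=> kN; apply: aN; rewrite mem_window -ltnNge.
have [i0|i0] := ltP 0 i; have [j0|j0] := ltP 0 j.
- by rewrite bil_xx // a0 ?mul0r //; lia.
- by rewrite bil_xy // a0 ?mul0r //; lia.
- by lia.
- have [ijE|ijE] := eqVneq i j.
    by rewrite ijE bil_diag a0 ?oppr0 ?if_same ?mul0r //; lia.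
  by rewrite bil_yy ?a0 ?mul0r ?oppr0 ?xpair_eqE ?eqxx ?andbT //=; lia.
Qed.

Definition ghsum N A f : Fock :=
  \sum_(i <- window N) \sum_(j <- window N) A i j *: ghop i j f.

Lemma ghsumE N A f a : ghsum N A f a =
  \sum_(i <- window N) \sum_(j <- window N) A i j * ghop i j f a.
Proof. by rewrite /ghsum fock_sum; apply: eq_bigr => i _; rewrite fock_sum. Qed.

(** The double sum is finite at each monomial by [ghop_far] and bandedness. The last term lets K act
    by -n. *)
Definition gact x f : Fock := fun a =>
  \sum_(i \in [set: int]) \sum_(j \in [set: int]) x.1 i j * ghop i j f a
  - n%:R * x.2 * f a.

Lemma gactE A (c : C) f a M N N' : band M A -> within (window N) a -> (N + M <= N')%N ->
  gact (A, c) f a = (ghsum N' A f - (n%:R * c) *: f) a.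
Proof.
move=> AM aN NN'; rewrite fockB ghsumE fockZ /gact /=; congr (_ - _).
have far i j : (N' < absz i)%N || (N' < absz j)%N -> A i j * ghop i j f a = 0.
  move=> ijN; have [/AM ->|ij] := ltnP M (absz (i - j)); first by rewrite mul0r.
  by rewrite (ghop_far _ aN ij) ?mulr0 //; lia.
rewrite (@fsbig_window _ N') => [|i iN].
  apply: eq_bigr => i _; rewrite (@fsbig_window _ N') // => j jN.
  by rewrite far // jN orbT.
by apply: fsbig1 => j _; rewrite far // iN.
Qed.

Lemma within_window_exists a : exists N, within (window N) a.
Proof.
have [N sub] := fset_sub_window (rows a).
by exists N; apply: within_sub sub (@within_rows _ a).
Qed.

Lemma within_windowW N M a : (N <= M)%N -> within (window N) a -> within (window M) a.
Proof. by move=> NM; apply: within_sub; exact: window_sub. Qed.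

Lemma gact_local A (c : C) f g a M N : band M A -> within (window N) a ->
  (forall b, within (window (N + M)) b -> f b = g b) ->
  gact (A, c) f a = gact (A, c) g a.
Proof.
move=> AM aN E; rewrite !(gactE _ _ AM aN (leqnn _)) !fockB !fockZ !ghsumE.
have aN' := within_windowW (leq_addr M N) aN.
rewrite E //; congr (_ - _).
apply: eq_big_seq => i iN; apply: eq_big_seq => j jN; congr (_ * _).
exact: (ghop_local iN jN aN').
Qed.

Lemma ghsum_linear N A : linear (ghsum N A).
Proof.
move=> c f g; rewrite /ghsum scaler_sumr -big_split /=; apply: eq_bigr => i _.
rewrite scaler_sumr -big_split /=; apply: eq_bigr => j _.
by rewrite ghop_linear scalerDr !scalerA mulrC.
Qed.

Lemma ghsumBZ N A (c : C) f g a :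
  ghsum N A (f - c *: g) a = ghsum N A f a - c * ghsum N A g a.
Proof. by rewrite addrC -scaleNr ghsum_linear fockD fockZ mulNr addrC. Qed.

Lemma gact_linear_r x : linear (gact x : Fock -> Fock).
Proof.
case: x => A d c f g; apply/funext => a.
have [M AM] := band_exists A; have [N aN] := within_window_exists a.
rewrite fockD fockZ !(gactE _ _ AM aN (leqnn _)) ghsum_linear.
rewrite !fockB !fockD !fockZ fockD fockZ.
have shuffle (t u v w z y : C) : t * u + v - z * (t * w + y) = t * (u - z * w) + (v - z * y).
  by ring.
exact: shuffle.
Qed.

Lemma gact_linear_l f : linear ((fun x => gact x f) : ghat R -> Fock).
Proof.
move=> c [A d] [B e]; apply/funext => a.
have [M1 AM] := band_exists A; have [M2 BM] := band_exists B.
have [N aN] := within_window_exists a.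
pose M := (M1 + M2)%N.
have {}AM : band M A by apply: band_le AM; exact: leq_addr.
have {}BM : band M B by apply: band_le BM; exact: leq_addl.
have ABM : band M (c *: A + B).
  by move=> i j ij; rewrite -[LHS]/(c * A i j + B i j) AM // BM // mulr0 addr0.
rewrite fockD fockZ -[c *: (A, d) + _]/(c *: A + B, c * d + e).
rewrite (gactE _ _ ABM aN (leqnn _)) (gactE _ _ AM aN (leqnn _)) (gactE _ _ BM aN (leqnn _)).
rewrite !fockB !fockZ !ghsumE.
have -> : \sum_(i <- window (N + M)) \sum_(j <- window (N + M))
      (c *: A + B) i j * ghop i j f a =
    c * (\sum_(i <- window (N + M)) \sum_(j <- window (N + M)) A i j * ghop i j f a) +
    \sum_(i <- window (N + M)) \sum_(j <- window (N + M)) B i j * ghop i j f a.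
  rewrite mulr_sumr -big_split; apply: eq_bigr => i _ /=.
  rewrite mulr_sumr -big_split; apply: eq_bigr => j _ /=.
  by rewrite -[LHS]/((c * A i j + B i j) * _) mulrDl mulrA.
have shuffle (t u v w z y x : C) :
   t * u + v - z * (t * w + y) * x = t * (u - z * w * x) + (v - z * y * x).
  by ring.
exact: shuffle.
Qed.

Lemma gact_comm A B (c d : C) f a M N N' : band M A -> band M B ->
  within (window N) a -> (N + 3 * M <= N')%N ->
  gact (A, c) (gact (B, d) f) a - gact (B, d) (gact (A, c) f) a =
  \sum_(i <- window N') \sum_(j <- window N')
  \sum_(k <- window N') \sum_(l <- window N')
   A i j * B k l * (ghop i j (ghop k l f) - ghop k l (ghop i j f)) a.
Proof.
move=> AM BM aN NN'.
have E A' B' (c' d' : C) : band M A' -> band M B' ->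
  gact (A', c') (gact (B', d') f) a = ghsum N' A' (ghsum N' B' f) a
   - n%:R * d' * ghsum N' A' f a - n%:R * c' * (ghsum N' B' f a - n%:R * d' * f a).
  move=> AM' BM'.
  rewrite (gact_local (g := ghsum N' B' f - (n%:R * d') *: f) _ AM' aN).
    rewrite (gactE _ _ AM' aN (N' := N')); last by lia.
    by rewrite fockB fockZ fockB fockZ ghsumBZ.
  by move=> b bN; rewrite (gactE _ _ BM' bN (N' := N')) //; lia.
rewrite (E _ _ _ _ AM BM) (E _ _ _ _ BM AM).
have shuffle (x1 x2 y1 y2 m z c' d' : C) :
   x1 - m * d' * y1 - m * c' * (y2 - m * d' * z) -
   (x2 - m * c' * y2 - m * d' * (y1 - m * c' * z)) = x1 - x2 by ring.
rewrite shuffle.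
have S A' B' : ghsum N' A' (ghsum N' B' f) a =
  \sum_(i <- window N') \sum_(j <- window N')
  \sum_(k <- window N') \sum_(l <- window N')
   A' i j * B' k l * ghop i j (ghop k l f) a.
  rewrite ghsumE; apply: eq_bigr => i _; apply: eq_bigr => j _.
  rewrite /ghsum (linear_sum (ghop i j)) fock_sum mulr_sumr.
  apply: eq_bigr => k _; rewrite (linear_sum (ghop i j)) fock_sum mulr_sumr.
  by apply: eq_bigr => l _; rewrite (linearZ_LR (ghop i j)) /= fockZ mulrA.
rewrite !S; rewrite [X in _ - X](_ : _ =
  \sum_(i <- window N') \sum_(j <- window N')
  \sum_(k <- window N') \sum_(l <- window N')
   A i j * B k l * ghop k l (ghop i j f) a); last first.
  have ex (G : int -> int -> int -> int -> C) (s : seq int) :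
      \sum_(i <- s) \sum_(j <- s) \sum_(k <- s) \sum_(l <- s) G i j k l =
      \sum_(k <- s) \sum_(l <- s) \sum_(i <- s) \sum_(j <- s) G i j k l.
    under eq_bigr do rewrite exchange_big /=.
    rewrite exchange_big /=; apply: eq_bigr => k _.
    under eq_bigr do rewrite exchange_big /=.
    by rewrite exchange_big.
  rewrite [RHS]ex; apply: eq_bigr => k _; apply: eq_bigr => l _.
  by apply: eq_bigr => i _; apply: eq_bigr => j _; rewrite [_ * A _ _]mulrC.
rewrite -sumrB; apply: eq_bigr => i _; rewrite -sumrB; apply: eq_bigr => j _.
rewrite -sumrB; apply: eq_bigr => k _; rewrite -sumrB; apply: eq_bigr => l _.
by rewrite fockB mulrBr.
Qed.

Let winmul N A B i l : C := \sum_(j <- window N) A i j * B j l.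

Let sum_winmul A B N (G : int -> int -> C) :
  \sum_(i <- window N) \sum_(j <- window N)
  \sum_(k <- window N) \sum_(l <- window N) A i j * B k l * ((j == k)%:R * G i l) =
  \sum_(i <- window N) \sum_(l <- window N) winmul N A B i l * G i l.
Proof.
apply: eq_bigr => i _; rewrite /winmul.
under [RHS]eq_bigr do rewrite mulr_suml.
rewrite [RHS]exchange_big /=; apply: eq_big_seq => j; rewrite mem_window => jN.
under eq_bigr do under eq_bigr do rewrite mulrCA eq_sym.
under eq_bigr do rewrite -mulr_sumr.
exact: (sum_window_delta (fun k => \sum_(l <- window N) A i j * B k l * G i l)).
Qed.

Let sum_winmul_swap A B N (G : int -> int -> C) :
  \sum_(i <- window N) \sum_(j <- window N)
  \sum_(k <- window N) \sum_(l <- window N) A i j * B k l * ((i == l)%:R * G k j) =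
  \sum_(k <- window N) \sum_(j <- window N) winmul N B A k j * G k j.
Proof.
transitivity (\sum_(k <- window N) \sum_(l <- window N)
  \sum_(i <- window N) \sum_(j <- window N) B k l * A i j * ((l == i)%:R * G k j)).
  under eq_bigr do rewrite exchange_big /=.
  rewrite exchange_big /=; apply: eq_bigr => k _.
  under eq_bigr do rewrite exchange_big /=.
  rewrite exchange_big /=; apply: eq_bigr => l _.
  apply: eq_bigr => i _; apply: eq_bigr => j _.
  by rewrite [A i j * _]mulrC eq_sym.
exact: sum_winmul.
Qed.

(** A product has bandwidth 2 M, so only rows up to N + 2 M matter at [a]; the inner summation index
    needs another M. *)
Let gl_mul_winmul A B i l f a M N N' : band M A -> band M B ->
  within (window N) a -> (N + 3 * M <= N')%N ->
  gl_mul A B i l * ghop i l f a = winmul N' A B i l * ghop i l f a.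
Proof.
move=> AM BM aN NN'; have [il|il] := ltnP (M + M) (absz (i - l)).
  rewrite (band_mul AM BM il) /winmul big1_fset // => j _ _.
  have [/AM ->|ij] := ltnP M (absz (i - j)); first by rewrite mul0r.
  by rewrite BM ?mulr0 //; lia.
have [iN|iN] := leqP (absz i) (N + (M + M)).
  by congr (_ * _); apply: (gl_mulE _ _ AM); lia.
by rewrite (ghop_far _ aN il) ?mulr0 //; lia.
Qed.

(** At a fixed monomial everything takes place in one finite window. The ordering constants left by
    [ghop_comm] sum up to the trace defining the cocycle. *)
Lemma gact_bracket x y f :
  gact (bracket x y) f = gact x (gact y f) - gact y (gact x f).
Proof.
case: x y => [A c] [B d]; apply/funext => a.
have [M1 AM] := band_exists A; have [M2 BM] := band_exists B.
have [N aN] := within_window_exists a.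
pose M := (M1 + M2)%N; pose N' := (N + 3 * M)%N.
have {}AM : band M A by apply: band_le AM; exact: leq_addr.
have {}BM : band M B by apply: band_le BM; exact: leq_addl.
rewrite fockB (gact_comm _ _ _ AM BM aN (leqnn _)).
pose G i l := ghop i l f a - n%:R * ((i == l) && (i <= 0))%:R * f a.
under eq_bigr do under eq_bigr do under eq_bigr do under eq_bigr do
  rewrite ghop_comm fockB !fockZ !fockB !fockZ mulrBr -!/(G _ _).
under eq_bigr do under eq_bigr do under eq_bigr do rewrite sumrB.
under eq_bigr do under eq_bigr do rewrite sumrB.
under eq_bigr do rewrite sumrB.
rewrite sumrB sum_winmul sum_winmul_swap.
have brM : band (M + M) (gl_bracket A B).
  move=> i j ij; rewrite -[LHS]/(gl_mul A B i j - gl_mul B A i j).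
  by rewrite (band_mul AM BM ij) (band_mul BM AM ij) subrr.
rewrite (gactE (N' := N') _ _ brM aN); last by rewrite /N'; lia.
rewrite fockB fockZ ghsumE.
have split_G A' B' : \sum_(i <- window N') \sum_(l <- window N') winmul N' A' B' i l * G i l =
   \sum_(i <- window N') \sum_(l <- window N') winmul N' A' B' i l * ghop i l f a
   - n%:R * f a * \sum_(i <- window N') (i <= 0)%R%:R * winmul N' A' B' i i.
  rewrite mulr_sumr -sumrB; apply: eq_big_seq => i iN.
  under eq_bigr do rewrite mulrBr.
  rewrite sumrB; congr (_ - _).
  transitivity (\sum_(l <- window N') (l == i)%:R *
      (n%:R * f a * ((i <= 0)%R%:R * winmul N' A' B' i l))).
    apply: eq_bigr => l _; rewrite -mulnb natrM eq_sym.
    by move: (_%:R) (_%:R) (_%:R) => x1 x2 x3; ring.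
  by rewrite (sum_window_delta (fun l => n%:R * f a * ((i <= 0)%R%:R * winmul N' A' B' i l))) // -mem_window.
(* It remains to compare the cocycle with the difference of the two partial traces over the rows
   [i <= 0]. *)
rewrite !split_G (@cocycleE _ _ M N' AM); last by rewrite /N'; lia.
transitivity (\sum_(i <- window N') \sum_(l <- window N')
    (winmul N' A B i l * ghop i l f a - winmul N' B A i l * ghop i l f a)
   - n%:R * f a * (\sum_(i <- window N') (i <= 0)%R%:R * winmul N' A B i i -
   \sum_(i <- window N') (i <= 0)%R%:R * winmul N' B A i i)).
  congr (_ - _).
    apply: eq_bigr => i _; apply: eq_bigr => l _.
    rewrite -[gl_bracket A B i l]/(gl_mul A B i l - gl_mul B A i l) mulrBl.
    by rewrite (gl_mul_winmul _ _ _ AM BM aN (leqnn _)) (gl_mul_winmul _ _ _ BM AM aN (leqnn _)).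
  rewrite mulrAC; congr (_ * _).
  have -> : \sum_(i <- window N') (i <= 0)%R%:R * winmul N' B A i i =
     \sum_(i <- window N') \sum_(j <- window N') (j <= 0)%R%:R * (A i j * B j i).
    rewrite exchange_big; apply: eq_bigr => i _; rewrite /winmul mulr_sumr.
    by apply: eq_bigr => j _; rewrite [B i j * _]mulrC.
  rewrite -sumrB; apply: eq_bigr => i _; rewrite /winmul mulr_sumr -sumrB.
  by apply: eq_bigr => j _; rewrite mulrBl.
under eq_bigr do rewrite sumrB.
rewrite sumrB mulrBr.
have shuffle (x1 x2 y1 y2 : C) : x1 - x2 - (y1 - y2) = x1 - y1 - (x2 - y2) by ring.
exact: shuffle.
Qed.

Lemma glop_gact x p q f : glop p q (gact x f) = gact x (glop p q f).
Proof.
case: x => A c; apply/funext => a.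
have [M AM] := band_exists A; have [N aN] := within_window_exists a.
rewrite (gactE _ _ AM aN (leqnn _)).
rewrite (@glop_local _ _ (window N) _ _ _
   (ghsum (N + M) A f - (n%:R * c) *: f)) //; last first.
  by move=> b bN; exact: (gactE _ _ AM bN).
rewrite (linearB (glop p q)) (linearZ_LR (glop p q)) /= !fockB; congr (_ - _).
rewrite /ghsum (linear_sum (glop p q)) !fock_sum; apply: eq_bigr => i _.
rewrite (linear_sum (glop p q)) !fock_sum; apply: eq_bigr => j _.
by rewrite (linearZ_LR (glop p q)) /= glop_ghop.
Qed.

Lemma gact0 x : gact x (0 : Fock) = 0.
Proof.
by have := gact_linear_r x (-1) (0 : Fock) 0; rewrite scaler0 addr0 scaleN1r addNr.
Qed.

Lemma gactZ x (c : C) f : gact x (c *: f) = c *: gact x f.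
Proof. by have := gact_linear_r x c f 0; rewrite gact0 !addr0. Qed.

Lemma gl_highest_gact lam x f : gl_highest lam f -> gl_highest lam (gact x f).
Proof.
move=> [s w]; split=> [p q pq|p]; rewrite glop_gact.
  by rewrite s // gact0.
by rewrite w gactZ.
Qed.

Lemma bounded_gact x N f : bounded N f -> exists N', bounded N' (gact x f).
Proof.
case: x => A c fN; have [M AM] := band_exists A; exists (N + M.+1)%N => a aN.
have [L aL] := within_window_exists a.
rewrite (gactE _ _ AM aL (leqnn _)) fockB fockZ fN ?mulr0 ?subr0; last by lia.
rewrite ghsumE big1 // => i _; rewrite big1 // => j _.
have [/AM ->|ij] := ltnP M (absz (i - j)); first by rewrite mul0r.
by rewrite (ghop_meas ij fN aN) mulr0.
Qed.

End BandMatrixAction.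

Local Open Scope classical_set_scope.
Local Open Scope ring_scope.

(** * The Fischer form *)

Section Form.
Variables (K : numClosedFieldType) (I : choiceType).
Local Notation Fock := (fock K I).
Implicit Types (f g h : Fock) (a b : {cmonom I}) (u v w : I).

Definition cmfact a : nat := (\prod_(u <- finsupp a) (a u)`!)%N.

Lemma cmfactE (S : {fset I}) a : (finsupp a `<=` S)%fset ->
  cmfact a = (\prod_(u <- S) (a u)`!)%N.
Proof.
move=> aS; rewrite /cmfact (big_fset_incl _ aS) // => u _.
by rewrite -cmE_eq0 => /eqP ->.
Qed.

Lemma cmfact_gt0 a : (0 < cmfact a)%N.
Proof. by rewrite prodn_gt0 // => u; exact: fact_gt0. Qed.

Lemma cmfact_inc a u : cmfact (inc a u) = ((a u).+1 * cmfact a)%N.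
Proof.
pose S := (finsupp (inc a u))%fset; have uS : u \in S.
  by rewrite -cmE_neq0 incE eqxx addn1.
have aS : (finsupp a `<=` S)%fset.
  apply/fsubsetP => v; rewrite -!cmE_neq0 incE -!lt0n => v0.
  exact: leq_trans (leq_addr _ _).
rewrite (cmfactE (fsubset_refl S)) (cmfactE aS) (big_fsetD1 u uS) /=.
rewrite [in RHS](big_fsetD1 u uS) /= incE eqxx addn1 factS mulnA; congr (_ * _)%N.
apply: eq_big_seq => v; rewrite in_fsetD1 => /andP[vu _].
by rewrite incE eq_sym (negPf vu) addn0.
Qed.

(* The Fischer form, for which multiplication by a variable is adjoint to the
   derivation; a divided power a has square norm 1 / a!. *)
Definition form f g : K := \sum_(a \in [set: {cmonom I}]) f a * (g a)^* / (cmfact a)%:R.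

(** The nonzero terms of both sides correspond under [inc], and the exponent introduced by [mulv]
    cancels the new factor of the factorial. *)
Lemma form_mulv u f g : form (mulv u f) g = form f (derv u g).
Proof.
pose F a : K := mulv u f a * (g a)^* / (cmfact a)%:R.
rewrite /form -/F.
transitivity (\sum_(a \in (fun a => inc a u) @` [set: {cmonom I}]) F a).
  apply/esym/fsbig_widen => // a /= [_ aN].
  rewrite /F /mulv; have [->|au] := posnP (a u); first by rewrite !mul0r.
  by case: aN; exists (dec a u) => //; exact: decK.
rewrite fsbig_image => [|a b _ _ E]; last by rewrite -(incK a u) E incK.
apply: eq_fsbigr => b _; rewrite /F /mulv /derv incK incE eqxx addn1.
rewrite cmfact_inc natrM invfM mulrA [(_ * f b)]mulrC -!mulrA; congr (_ * _).
by rewrite [LHS]mulrCA mulVKf ?pnatr_eq0.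
Qed.

Definition supp_in (D : {fset {cmonom I}}) f := forall a, a \notin D -> f a = 0.
Definition finsup f := exists D, supp_in D f.

Lemma formE (D : {fset {cmonom I}}) f g : supp_in D f \/ supp_in D g ->
  form f g = \sum_(a <- D) f a * (g a)^* / (cmfact a)%:R.
Proof.
by move=> D0; rewrite /form (fsbigTE D) // => a aD;
  case: D0 => /(_ _ aD) ->; rewrite ?conjC0 ?mulr0 !mul0r.
Qed.

Lemma form_conj f g : finsup f -> form g f = (form f g)^*.
Proof.
move=> [D fD]; rewrite !(@formE D); [|by left|by right].
rewrite rmorph_sum; apply: eq_bigr => a _ /=.
by rewrite !rmorphM /= conjCK fmorphV /= conjC_nat [g a * _]mulrC.
Qed.

Lemma form_derv u f g : finsup g -> form (derv u f) g = form f (mulv u g).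
Proof.
move=> gs; rewrite (form_conj _ gs) -form_mulv -form_conj //.
case: gs => D gD; exists [fset inc a u | a in D]%fset => a aD.
rewrite /mulv; have [->|au] := posnP (a u); first by rewrite mul0r.
rewrite gD ?mulr0 //; apply: contra aD => aD; apply/imfsetP.
by exists (dec a u) => //; rewrite decK.
Qed.

Lemma finsup_mulv u f : finsup f -> finsup (mulv u f).
Proof.
case=> D fD; exists [fset inc a u | a in D]%fset => a aD.
rewrite /mulv; have [->|au] := posnP (a u); first by rewrite mul0r.
rewrite fD ?mulr0 //; apply: contra aD => aD; apply/imfsetP.
by exists (dec a u) => //; rewrite decK.
Qed.

Lemma finsup_derv u f : finsup f -> finsup (derv u f).
Proof.
case=> D fD; exists [fset dec a u | a in D]%fset => a aD.
rewrite /derv fD //; apply: contra aD => aD; apply/imfsetP.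
by exists (inc a u) => //; rewrite incK.
Qed.

Lemma finsup_linear c f g : finsup f -> finsup g -> finsup (c *: f + g).
Proof.
case=> D fD [E gE]; exists (D `|` E)%fset => a; rewrite inE negb_or => /andP[aD aE].
by rewrite fockD fockZ fD // gE // mulr0 addr0.
Qed.

Lemma finsup0 : finsup 0. Proof. by exists fset0. Qed.

Lemma finsupZ c f : finsup f -> finsup (c *: f).
Proof. by move=> ff; rewrite -[_ *: _]addr0; apply: finsup_linear => //; exact: finsup0. Qed.

Lemma finsup_sum (T : Type) (r : seq T) (F : T -> Fock) :
  (forall i, finsup (F i)) -> finsup (\sum_(i <- r) F i).
Proof.
move=> FF; elim: r => [|i r IHr]; first by rewrite big_nil; exact: finsup0.
by rewrite big_cons -[F i]scale1r; exact: finsup_linear.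
Qed.

Lemma form_linear c f g h : finsup h -> form (c *: f + g) h = c * form f h + form g h.
Proof.
case=> D hD; rewrite !(@formE D); try by right.
rewrite mulr_sumr -big_split; apply: eq_bigr => a _.
by rewrite fockD fockZ !mulrDl !mulrA.
Qed.

Lemma form_linearr c f g h : finsup f -> form f (c *: g + h) = c^* * form f g + form f h.
Proof.
case=> D fD; rewrite !(@formE D); try by left.
rewrite mulr_sumr -big_split; apply: eq_bigr => a _ /=.
rewrite fockD fockZ rmorphD rmorphM /= mulrDr mulrDl; congr (_ + _).
by rewrite !mulrA [f a * c^*]mulrC.
Qed.

Lemma formZr c f g : finsup f -> form f (c *: g) = c^* * form f g.
Proof.
move=> ff; have := form_linearr c g 0 ff; rewrite addr0 => ->.
by rewrite [X in _ + X]fsbig1 ?addr0 // => a _; rewrite conjC0 mulr0 mul0r.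
Qed.

Lemma form_sumr (T : Type) (r : seq T) (F : T -> Fock) h : finsup h ->
  form h (\sum_(i <- r) F i) = \sum_(i <- r) form h (F i).
Proof.
move=> hs; elim: r => [|i r IHr].
  by rewrite !big_nil -(scale0r (0 : Fock)) formZr // conjC0 mul0r.
by rewrite !big_cons -IHr -[F i in LHS]scale1r form_linearr // conjC1 mul1r.
Qed.

Lemma form0 h : form 0 h = 0.
Proof. by rewrite /form fsbig1 // => a _; rewrite !mul0r. Qed.

Lemma formZ c f h : finsup h -> form (c *: f) h = c * form f h.
Proof. by move=> hs; rewrite -[c *: f]addr0 form_linear // form0 addr0. Qed.

Lemma form_sum (T : Type) (r : seq T) (F : T -> Fock) h : finsup h ->
  form (\sum_(i <- r) F i) h = \sum_(i <- r) form (F i) h.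
Proof.
move=> hs; elim: r => [|i r IHr]; first by rewrite !big_nil form0.
by rewrite !big_cons -IHr -[F i in LHS]scale1r form_linear // mul1r.
Qed.

Lemma form_ge0 f : 0 <= form f f.
Proof.
apply: fsumr_ge0 => a _; rewrite divr_ge0 ?mul_conjC_ge0 //.
Qed.

Lemma form_eq0 f : finsup f -> form f f = 0 -> f = 0.
Proof.
move=> [D fD]; rewrite (@formE D); last by left.
move/eqP; rewrite psumr_eq0 => [/allP f0|a _]; last by rewrite divr_ge0 ?mul_conjC_ge0.
apply/funext => a; have [aD|/fD //] := boolP (a \in D).
have := f0 a aD; rewrite mulf_eq0 mul_conjC_eq0 invr_eq0 pnatr_eq0.
by rewrite (negPf (lt0n_neq0 (cmfact_gt0 a))) orbF => /eqP.
Qed.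

End Form.

(** * Adjoints, finite weight spaces and dominance *)

Section FormDualPair.
Variables (K : numClosedFieldType) (n : nat).
Local Notation I := (int * 'I_n)%type.
Local Notation Fock := (fock K I).
Implicit Types (f g h : Fock) (a b : {cmonom I}) (u v w : I) (p q : 'I_n) (i j k : int).

Local Notation sg k := ((sgcol k)%:~R : K).

Lemma finsup_psis u f : finsup f -> finsup (psis u f).
Proof.
by move=> ff; rewrite /psis; case: ifP => _; [exact: finsup_derv|exact: finsup_mulv].
Qed.

Lemma form_psi u f g : finsup f -> finsup g -> form (psi u f) g = sg u.1 * form f (psis u g).
Proof.
move=> ff fg; rewrite /psi /psis /sgcol; case: ifP => _; first by rewrite mul1r form_mulv.
by rewrite -scaleN1r formZ // form_derv.
Qed.

Lemma form_psis u f g : finsup f -> finsup g -> form (psis u f) g = sg u.1 * form f (psi u g).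
Proof.
move=> ff fg; rewrite /psi /psis /sgcol; case: ifP => _; first by rewrite mul1r form_derv.
have -> : (-1)%:~R = (-1 : K)^* by rewrite !rmorphN1.
rewrite -scaleN1r formZr // form_mulv mulrA -rmorphM mulrNN mulr1.
by rewrite rmorph1 mul1r.
Qed.

Lemma sgcolK k : sg k * sg k = 1.
Proof. by rewrite -rmorphM /sgcol; case: ifP. Qed.

Lemma form_bil u v f g : finsup f -> finsup g ->
  form (bil u v f) g = sg u.1 * sg v.1 * form f (bil v u g).
Proof.
move=> ff fg; have fv := finsup_psis v ff.
rewrite bilE addrC form_linear // form_psi // form_psis; last exact: finsup_psis.
  rewrite [in RHS]bilE [in RHS]addrC form_linearr // conjC_nat mulrDr mulrA.
  congr (_ + _); have [->|uv] := eqVneq u v; last by rewrite !mul0r mulr0.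
  by rewrite /= mulrA sgcolK mul1r.
by [].
Qed.

Lemma form_ghop i j f g : finsup f -> finsup g ->
  form (ghop i j f) g = sg i * sg j * form f (ghop j i g).
Proof.
move=> ff fg; rewrite /ghop form_sum // form_sumr // mulr_sumr.
by apply: eq_bigr => p _; rewrite form_bil.
Qed.

Lemma finsup_within f : finsup f -> exists S : {fset int},
  forall a, f a != 0 -> within S a.
Proof.
case=> D fD; exists (\bigcup_(a <- D) rows a)%fset => a fa.
have aD : a \in D by apply: contraNT fa => /fD ->.
apply: within_sub (@within_rows _ a); apply/fsubsetP => k ka.
by apply/bigfcupP; exists a => //; rewrite aD.
Qed.

(** Both variables of each term lie in the same row, so their signs cancel: the form is
    contravariant for gl_n. *)
Lemma form_glop p q f g : finsup f -> finsup g ->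
  form (glop p q f) g = form f (glop q p g).
Proof.
move=> ff fg; have [S1 fS] := finsup_within ff; have [S2 gS] := finsup_within fg.
pose S := (S1 `|` S2)%fset.
transitivity (form (glsum S p q f) g).
  apply: eq_fsbigr => a _; have [->|ga] := eqVneq (g a) 0.
    by rewrite conjC0 !mulr0 !mul0r.
  by rewrite (@glopE _ _ S) //; apply: within_sub (gS _ ga); exact: fsubsetUr.
transitivity (form f (glsum S q p g)); last first.
  apply: eq_fsbigr => a _; have [->|fa] := eqVneq (f a) 0; first by rewrite !mul0r.
  by rewrite (@glopE _ _ S) //; apply: within_sub (fS _ fa); exact: fsubsetUl.
rewrite /glsum form_sum // form_sumr //; apply: eq_bigr => k _.
by rewrite form_bil // sgcolK mul1r.
Qed.

Definition ghset (nu : int -> int) : set {cmonom I} := [set a | wtm a = nu].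

Lemma wtm_natE a k : absz (wtm a k) = (\sum_p a (k, p))%N.
Proof. by rewrite /wtm /sgcol; case: ifP; rewrite ?mul1r ?mulN1r ?abszN. Qed.

(** The weight fixes the sum of the exponents in each row, and one monomial [a0] of that weight
    shows that almost all of these sums are 0. *)
Lemma finite_ghset nu : finite_set (ghset nu).
Proof.
have [[a0 a0E]|] := pselect (exists a, ghset nu a); last first.
  by move=> /forallNP N; rewrite (_ : ghset nu = set0) // -subset0 => a /N.
pose S := rows a0; pose N := (\sum_(k <- S) absz (nu k))%N.
pose D := (S `*` seq_fset tt (enum 'I_n))%fset.
have mem_D u : (u \in D) = (u.1 \in S).
  by rewrite in_fsetM seq_fsetE mem_enum andbT.
pose G (F : {ffun D -> 'I_N.+1}) : {cmonom I} :=
  mkcmonom [fsfun u : D => nat_of_ord (F u) | 0%N].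
apply: (@sub_finite_set _ _ (G @` setT)); last first.
  by apply: finite_image; exact: finite_finset.
move=> a /= aE; exists [ffun u => inord (a (val u))] => //.
apply: cmonom_eq => u; rewrite /G cmE fsfun_ffun.
case: insubP => [v vD vE /=|uD].
  rewrite ffunE inordK ?vE // ltnS.
  have uS : u.1 \in S by rewrite -mem_D.
  rewrite /N (big_fsetD1 _ uS) /= (leq_trans _ (leq_addr _ _)) // -aE wtm_natE.
  by case: (u) => k p /=; rewrite (bigD1 p) //= leq_addr.
apply/esym/eqP; have uS : u.1 \notin S by rewrite -mem_D.
have : absz (wtm a u.1) == 0%N.
  rewrite aE -a0E wtm_natE sum_nat_eq0; apply/forallP => p.
  by rewrite (@within_rows _ a0).
rewrite wtm_natE sum_nat_eq0 => /forallP/(_ u.2).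
by case: (u).
Qed.

Definition ghfset nu : {fset {cmonom I}} := fset_set (ghset nu).

Lemma mem_ghfset nu a : (a \in ghfset nu) <-> wtm a = nu.
Proof. by rewrite in_fset_set ?inE //; exact: finite_ghset. Qed.

Lemma gh_weightP nu f : gh_weight nu f <-> supp_in (ghfset nu) f.
Proof.
split=> [w a aN|fN k].
  apply/eqP; apply: contraNT aN => fa; apply/mem_ghfset/funext => k.
  have := congr1 (fun g : Fock => g a) (w k); rewrite ghop_diag fockZ.
  by move=> /(mulIf fa)/intr_inj.
apply/funext => a; rewrite ghop_diag fockZ.
have [/mem_ghfset ->//|/fN ->] := boolP (a \in ghfset nu).
by rewrite !mulr0.
Qed.

Lemma gh_weight_finsup nu f : gh_weight nu f -> finsup f.
Proof. by move/gh_weightP => fN; exists (ghfset nu). Qed.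

Lemma finsup_bounded f : finsup f -> exists N, bounded N f.
Proof.
move=> [D fD]; exists (\max_(a <- D) meas a).+1 => a aN; apply: fD.
apply: contraL aN => aD; rewrite -ltnNge ltnS.
exact: (@leq_bigmax_seq _ _ xpredT).
Qed.

Lemma glop_gh_weight nu p q f : gh_weight nu f -> gh_weight nu (glop p q f).
Proof. by move=> w k; rewrite -glop_ghop w (linearZ_LR (glop p q)). Qed.

(** For p < q the square norm of [glop q p f] is [lam p - lam q] times that of [f]. *)
Lemma gl_highest_dominant nu lam f : gh_weight nu f -> f != 0 ->
  gl_highest lam f -> forall p q, (p < q)%N -> lam q <= lam p.
Proof.
move=> wf f0 [s w] p q pq.
have ff := gh_weight_finsup wf.
have fq : finsup (glop q p f) := gh_weight_finsup (glop_gh_weight q p wf).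
have := form_ge0 (glop q p f); rewrite form_conj // form_glop //.
have := glop_comm p q q p f; rewrite !eqxx !scale1r !w (s p q pq) (linear0 (glop q p)) subr0.
move=> ->; rewrite -scalerBl -rmorphB formZr // rmorphM /= !conjCK.
have -> : (form f f)^* = form f f by rewrite -form_conj.
have : 0 < form f f.
  by rewrite lt_def form_ge0 andbT; apply: contraNneq f0 => /(form_eq0 ff) ->.
by move=> f1; rewrite pmulr_lge0 // ler0z subr_ge0.
Qed.

End FormDualPair.

(** * Joint highest weight vectors: uniqueness *)

Section JointHighest.
Variables (K : numClosedFieldType) (n : nat).
Local Notation I := (int * 'I_n)%type.
Local Notation Fock := (fock K I).
Implicit Types (f g h : Fock) (a b : {cmonom I}) (u v w : I) (p q : 'I_n) (i j k : int).
Implicit Types (r s : nat).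

Variables (lam : 'I_n -> int) (nu : int -> int) (phi : Fock).
Hypothesis phi_gl : gl_highest lam phi.
Hypothesis phi_gh : forall i j, i < j -> ghop i j phi = 0.
Hypothesis phi_nu : gh_weight nu phi.

Let phi_fin : finsup phi := gh_weight_finsup phi_nu.

(** [relA], [relB] and [relC] express ghat-singularity in coefficients, according to the signs of
    the two rows; [relD] does so for gl_n. *)
Let relA a i j : 0 < i -> i < j ->
  \sum_p (a (i, p))%:R * phi (inc (dec a (i, p)) (j, p)) = 0.
Proof.
move=> i0 ij; have := congr1 (fun f : Fock => f a) (phi_gh ij).
rewrite ghopE fock0 => E; rewrite -[RHS]E; apply: eq_bigr => p _.
by rewrite bil_xx //; exact: lt_trans ij.
Qed.

Let relB a i j : i < j -> j <= 0 ->
  \sum_p (a (j, p))%:R * phi (dec (inc a (i, p)) (j, p)) = 0.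
Proof.
move=> ij j0; have /eqP := congr1 (fun f : Fock => f a) (phi_gh ij).
rewrite ghopE fock0 -oppr_eq0 -sumrN => /eqP E; rewrite -[RHS]E; apply: eq_bigr => p _.
rewrite bil_yy ?opprK //; first exact: le_trans (ltW ij) _.
by rewrite xpair_eqE lt_eqF.
Qed.

Let relC a i j : i <= 0 -> 0 < j -> \sum_p phi (inc (inc a (i, p)) (j, p)) = 0.
Proof.
move=> i0 j0; have /eqP := congr1 (fun f : Fock => f a) (phi_gh (le_lt_trans i0 j0)).
rewrite ghopE fock0 -oppr_eq0 -sumrN => /eqP E; rewrite -[RHS]E; apply: eq_bigr => p _.
by rewrite bil_yx // opprK.
Qed.

Let relD (S : {fset int}) a p q : (p < q)%N -> within S a ->
  \sum_(k <- S | 0 < k) (a (k, p))%:R * phi (inc (dec a (k, p)) (k, q)) =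
  \sum_(k <- S | k <= 0) (a (k, q))%:R * phi (dec (inc a (k, p)) (k, q)).
Proof.
move=> pq aS; apply/eqP; rewrite -subr_eq0; apply/eqP.
have [s _] := phi_gl; have := congr1 (fun f : Fock => f a) (s p q pq).
rewrite (glopE _ _ _ aS) /glsum fock_sum fock0 => E; rewrite -[RHS]E.
rewrite [RHS](bigID (fun k => 0 < k)) /=; congr (_ + _).
  by apply: eq_bigr => k k0; rewrite bil_xx.
rewrite -sumrN; apply: eq_big => [k|k k0]; first by rewrite leNgt.
rewrite bil_yy // xpair_eqE eqxx /= -val_eqE /=.
by rewrite ltn_eqF.
Qed.

Let phi_charge a p : phi a != 0 -> charge a p = lam p.
Proof.
move=> fa; have [_ w] := phi_gl.
have := congr1 (fun f : Fock => f a) (w p); rewrite glop_diag fockZ.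
by move=> /(mulIf fa)/intr_inj.
Qed.

Let phi_bound a u : phi a != 0 -> (a u <= absz (nu u.1))%N.
Proof.
move=> fa; have -> : nu u.1 = wtm a u.1.
  have := congr1 (fun f : Fock => f a) (phi_nu u.1); rewrite ghop_diag fockZ.
  by move=> /(mulIf fa)/intr_inj.
by rewrite wtm_natE; case: u => k p; rewrite (bigD1 p) //= leq_addr.
Qed.

(** The rows of [xdiag p] and [ydiag p] are the indices k at which Lambda(lam) takes the value lam p
    on e_kk, for lam p positive and negative respectively. *)
Definition xdiag p : I := (p.+1%:Z, p).
Definition ydiag p : I := (p.+1%:Z - n%:Z, p).

Let on_xdiag r a := forall p, (p < r)%N -> a (xdiag p) = absz (lam p).

(* The monomials of phi are determined column by column: once the first r
   exponents on the diagonal are maximal, the rest of these columns vanishes. *)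
Let clean r a :=
  (forall k p, 0 < k -> k <= r%:Z \/ (p < r)%N -> k != p.+1%:Z -> a (k, p) = 0%N)
  /\ (forall k p, k <= 0 -> (p < r)%N -> a (k, p) = 0%N).

Let xclean r := forall a, phi a != 0 -> on_xdiag r a -> clean r a.

Section XStage.
Variables (q0 : 'I_n) (alpha : nat).
Let r : nat := q0.
Hypothesis xclean_r : xclean r.
Hypothesis alpha_max : forall a, phi a != 0 -> on_xdiag r a ->
  (a (xdiag q0) <= alpha)%N.

Let max0 a : on_xdiag r a -> (alpha < a (xdiag q0))%N -> phi a = 0.
Proof.
move=> da am; apply/eqP; apply: contraLR am => fa.
by rewrite -leqNgt; exact: alpha_max.
Qed.

Let row1 : int := r.+1%:Z.

(** Moving a power from row [i] to the diagonal gives [a']. In the relation at [a'] all terms but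
    the one at [a] keep the exponent alpha + 1 on the diagonal, hence vanish by maximality. *)
Let col_clean a i : phi a != 0 -> on_xdiag r a -> a (xdiag q0) = alpha ->
  0 < i -> i != row1 -> a (i, q0) = 0%N.
Proof.
move=> fa da aal i0 ir; have [cx _] := xclean_r fa da.
have [ile|igt] := lerP i r%:Z; first by apply: cx => //; left.
have {igt}igt : row1 < i by rewrite lt_neqAle eq_sym ir /row1; lia.
apply/eqP; rewrite -leqn0 leqNgt; apply/negP => ai.
pose a' := inc (dec a (i, q0)) (xdiag q0).
have := relA a' (isT : 0 < row1) igt.
rewrite (bigD1 q0) //= [X in _ + X]big1 ?addr0; last first.
  move=> p pq0; rewrite [X in _ * X]max0 ?mulr0 //.
    move=> p' p'r; rewrite -da // !(incE, decE, xpair_eqE) /=.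
    by rewrite -!val_eqE /= /row1; lia.
  rewrite !(incE, decE, xpair_eqE) /= aal -!val_eqE /= /row1.
  have : p != q0 :> nat by [].
  by lia.
rewrite -/(xdiag q0) /a' incK decK // incE eqxx => /eqP.
by rewrite mulf_eq0 pnatr_eq0 addn1 /= (negPf fa).
Qed.

(** The same argument along a row, with the relation of gl_n-singularity. *)
Let row_clean a p : phi a != 0 -> on_xdiag r a -> a (xdiag q0) = alpha ->
  p != q0 -> a (row1, p) = 0%N.
Proof.
move=> fa da aal pq0; have [cx _] := xclean_r fa da.
have npq0 : p != q0 :> nat by [].
have [plt|pge] := ltnP p r.
  by apply: cx => //; [right|rewrite /row1; have := plt; lia].
have {pge}pgt : (q0 < p)%N by rewrite ltn_neqAle eq_sym npq0.
apply/eqP; rewrite -leqn0 leqNgt; apply/negP => ap.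
pose a' := inc (dec a (row1, p)) (xdiag q0).
have [S a'S rS] : exists2 S, within S a' & row1 \in S.
  exists (row1 |` rows a')%fset; last by rewrite !inE eqxx.
  by apply: within_sub (@within_rows _ a'); exact: fsubsetUr.
have := relD pgt a'S.
rewrite [X in _ = X -> _]big1 => [|k k0]; last first.
  rewrite max0 ?mulr0 // => [p' p'r|].
    rewrite -da // !(incE, decE, xpair_eqE) /=.
    by rewrite -!val_eqE /= /row1; lia.
  by rewrite !(incE, decE, xpair_eqE) /= aal -!val_eqE /= /row1; lia.
rewrite big_mkcond (big_fsetD1 row1 rS) /= [X in _ + X]big1_fset ?addr0.
  rewrite -/(xdiag q0) /a' incK decK // incE eqxx => /eqP.
  by rewrite mulf_eq0 pnatr_eq0 addn1 /= (negPf fa).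
move=> k; rewrite in_fsetD1 => /andP[kr _] _; case: ifP => // k0.
rewrite max0 ?mulr0 // => [p' p'r|].
  rewrite -da // !(incE, decE, xpair_eqE) /=.
  by rewrite -!val_eqE /= /row1; lia.
by rewrite !(incE, decE, xpair_eqE) /= aal -!val_eqE /= /row1; lia.
Qed.

(** Row [row1] is now empty, so after moving one power of (k, p) into it the relation has a single
    term. *)
Let alpha0_clean a k p : alpha = 0%N -> phi a != 0 -> on_xdiag r a ->
  0 < k -> (r <= p)%N -> a (k, p) = 0%N.
Proof.
move=> al0 fa da k0 rp; have [cx _] := xclean_r fa da.
have aal : a (xdiag q0) = alpha.
  by apply/eqP; rewrite eqn_leq alpha_max // al0.
have row0 p' : a (row1, p') = 0%N.
  have [->|] := eqVneq p' q0; last exact: row_clean.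
  by rewrite -[(row1, q0)]/(xdiag q0) aal.
have [kle|kgt] := lerP k r%:Z.
  by apply: cx => //; [left|lia].
have [->//|kr] := eqVneq k row1.
have {kr}kgt : row1 < k by rewrite lt_neqAle eq_sym kr /row1; lia.
apply/eqP; rewrite -leqn0 leqNgt; apply/negP => ap.
pose a' := inc (dec a (k, p)) (row1, p).
have := relA a' (isT : 0 < row1) kgt.
rewrite (bigD1 p) //= [X in _ + X]big1 ?addr0; last first.
  move=> p' pp'; rewrite [a' _](_ : _ = 0%N) ?mul0r // incE decE row0.
  by rewrite sub0n !xpair_eqE eqxx /= eq_sym (negPf pp').
rewrite /a' incK decK // incE decE row0 eqxx sub0n mul1r => fa0.
by rewrite fa0 eqxx in fa.
Qed.

Let Qset a := on_xdiag r a /\ a (xdiag q0) = alpha.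
(** [Qset] only constrains exponents in positive rows, so operators on the rows [k <= 0] respect
    this truncation. *)
Let phiQ : Fock := fun a => if `[< Qset a >] then phi a else 0.

Let phiQ_fin : finsup phiQ.
Proof.
have [D fD] := phi_fin; exists D => a aD; rewrite /phiQ fD //.
by case: ifP.
Qed.

Let phiQ_neq0 a : phiQ a != 0 -> [/\ phi a != 0, Qset a & phiQ a = phi a].
Proof. by rewrite /phiQ; case: ifP; rewrite ?eqxx // => /asboolP. Qed.

Let phiQ_eq a b : (forall k p, 0 < k -> a (k, p) = b (k, p)) ->
  Qset a -> phiQ b = phi b.
Proof.
move=> E [da aal]; rewrite /phiQ; case: asboolP => // -[]; split.
  by move=> p pr; rewrite -E // da.
by rewrite -E.
Qed.

Section Positivity.
Variable S : {fset int}.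
Hypothesis phiS : forall a, phi a != 0 -> within S a.
Hypothesis alpha_gt0 : (0 < alpha)%N.

Let ysum (G : int -> Fock) : Fock := \sum_(j <- [seq j <- S | j <= 0]) G j.

Let ysumE G a : ysum G a = \sum_(j <- S | j <= 0) G j a.
Proof. by rewrite /ysum fock_sum big_filter. Qed.
Let raise_op p f := ysum (fun j => mulv (j, q0) (derv (j, p) f)).
Let lower_op p f := ysum (fun j => mulv (j, p) (derv (j, q0) f)).

Let finsup_ysum G : (forall j, finsup (G j)) -> finsup (ysum G).
Proof. by move=> fG; exact: finsup_sum. Qed.

Let form_raise p f g : finsup f -> finsup g ->
  form (raise_op p f) g = form f (lower_op p g).
Proof.
move=> ff fg; have L := form_sum [seq j <- S | j <= 0]
   (fun j => mulv (j, q0) (derv (j, p) f)) fg.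
have R := form_sumr [seq j <- S | j <= 0]
   (fun j => mulv (j, p) (derv (j, q0) g)) ff.
rewrite [LHS]L [RHS]R; apply: eq_bigr => j _.
by rewrite form_mulv form_derv //; exact: finsup_derv.
Qed.

(* Paired with phiQ, both terms become nonnegative, hence vanish. *)
Let phiQ_eqn a : phiQ a != 0 ->
  alpha%:R * (\sum_(j <- S | j <= 0) (a (j, q0))%:R) * phiQ a +
  \sum_(p < n | (r < p)%N) raise_op p (lower_op p phiQ) a = 0.
Proof.
move=> /phiQ_neq0[fa Qa fQa]; have [da aal] := Qa.
have [cx _] := xclean_r fa da.
rewrite [X in _ + X](eq_bigr (fun p => \sum_(j <- S | j <= 0)
    mulv (j, q0) (derv (j, p) (lower_op p phiQ)) a)); last by move=> p _; exact: ysumE.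
rewrite exchange_big /= -mulrA mulr_suml mulr_sumr -big_split big1 //= => j j0.
have [aj0|aj] := posnP (a (j, q0)).
  rewrite aj0 mul0r mulr0 add0r big1 // => p _.
  by rewrite /mulv aj0 mul0r.
rewrite mulrCA; under eq_bigr do rewrite /mulv.
rewrite -mulr_sumr -mulrDr.
suff -> : alpha%:R * phiQ a + \sum_(p < n | (r < p)%N)
    derv (j, p) (lower_op p phiQ) (dec a (j, q0)) = 0 by rewrite mulr0.
have aS := phiS fa.
have jS : j \in S.
  by apply: contraTT aj => jS; rewrite (aS (j, q0)).
pose a0 := dec (dec a (xdiag q0)) (j, q0).
pose bb p := inc (inc a0 (j, p)) (row1, p).
have xj : xdiag q0 != (j, q0) by rewrite xpair_eqE eqxx andbT; lia.
(* The term of column [q0] is [phi a]; columns before [q0] vanish because they are clean, and the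
   later ones are the [bb p]. *)
have := relC a0 j0 (isT : 0 < row1).
rewrite (bigD1 q0) //= decK; last first.
  by rewrite decE (negPf xj) subn0.
rewrite decK; last by rewrite aal.
rewrite (bigID (fun p : 'I_n => (r < p)%N)) /= [X in _ + (_ + X)]big1 ?addr0; last first.
  move=> p /andP[pq0]; rewrite -leqNgt => pr.
  have npq0 : p != q0 :> nat by [].
  apply/eqP; apply/negPn/negP => fb.
  have : on_xdiag r (bb p).
    move=> p' p'r; rewrite -da // !(incE, decE, xpair_eqE) /=.
    by rewrite -!val_eqE /= /row1; lia.
  move=> /(xclean_r fb)[cl _]; have pr' : (p < r)%N by rewrite ltn_neqAle npq0 pr.
  have : (bb p) (row1, p) = 0%N by apply: cl; [|right|rewrite /row1; lia].
  by rewrite incE eqxx addn1.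
move=> eqC; rewrite -[RHS](mulr0 alpha%:R) -[X in _ = _ * X]eqC mulrDr fQa; congr (_ + _).
rewrite mulr_sumr; apply: eq_big => [p|p rp].
  by rewrite andb_idl // => rp; rewrite -val_eqE /= gtn_eqF.
have npq0 : p != q0 :> nat by rewrite gtn_eqF.
rewrite /derv; pose a2 := inc (dec a (j, q0)) (j, p); rewrite -/a2.
have a2S : within S a2 by apply: within_inc => //; exact: within_dec.
have rS : row1 \in S.
  by apply: contraTT alpha_gt0 => rS; rewrite -aal (aS (xdiag q0)).
transitivity (\sum_(k <- S | k <= 0) (a2 (k, p))%:R * phi (dec (inc a2 (k, q0)) (k, p))).
  apply: etrans (ysumE _ _) _; apply: eq_bigr => k k0.
  rewrite /mulv /derv; congr (_ * _).
  rewrite -inc_dec ?xpair_eqE ?eqxx -?val_eqE /=; last by rewrite eq_sym.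
  apply: (@phiQ_eq a) => // k' p' k'0.
  rewrite !(incE, decE, xpair_eqE) /= -!val_eqE /=; lia.
(* gl_n-singularity trades the sum over the rows [k <= 0] for one over positive rows, where column
   [q0] has only its diagonal exponent alpha: what is left is alpha times [phi (bb p)]. *)
rewrite -(relD rp a2S) big_mkcond (big_fsetD1 row1 rS) /= [X in _ + X]big1_fset ?addr0.
  rewrite !(incE, decE, xpair_eqE) -[a (row1, q0)]/(a (xdiag q0)) aal.
  have -> : (j == row1) = false by rewrite /row1; lia.
  rewrite /= subn0 addn0; congr (_ * phi _).
  have ne : (j, p) != (row1, q0) by rewrite xpair_eqE /row1; lia.
  by rewrite /bb /a0 /a2 (inc_dec (dec a (j, q0)) ne) (decC a (j, q0) (row1, q0)).
move=> k; rewrite in_fsetD1 => /andP[kr _] _; case: ifP => // k0.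
rewrite !(incE, decE, xpair_eqE) (col_clean fa da aal k0 kr).
have -> : (j == k) = false by lia.
by rewrite mul0r.
Qed.

(** Pairing [phiQ_eqn] with [phiQ] gives alpha times the square norms of the derivatives of [phiQ]
    by the (j, q0), plus the square norms of the [lower_op p phiQ]. As alpha > 0, all these
    derivatives vanish. *)
Lemma y_clean a j : phi a != 0 -> Qset a -> j <= 0 -> a (j, q0) = 0%N.
Proof.
move=> fa Qa j0; have fQa : phiQ a = phi a by rewrite /phiQ asboolT.
have fQ0 : phiQ a != 0 by rewrite fQa.
pose num : Fock := ysum (fun j => mulv (j, q0) (derv (j, q0) phiQ)).
have num_fin : finsup num.
  by apply: finsup_ysum => k; apply: finsup_mulv; exact: finsup_derv.
pose ps := [seq p : 'I_n <- index_enum 'I_n | (r < p)%N].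
have lfin p : finsup (lower_op p phiQ).
  by apply: finsup_ysum => k; apply: finsup_mulv; exact: finsup_derv.
have : form (alpha%:R *: num + \sum_(p <- ps) raise_op p (lower_op p phiQ)) phiQ = 0.
  rewrite /form fsbig1 // => b _.
  have [->|fb] := eqVneq (phiQ b) 0; first by rewrite conjC0 mulr0 mul0r.
  rewrite [X in X * _ * _](_ : _ = 0) ?mul0r // -[RHS](phiQ_eqn fb).
  rewrite fockD fockZ fock_sum big_filter.
  congr (_ + _); rewrite -mulrA; congr (_ * _).
  rewrite [num b]ysumE mulr_suml; apply: eq_bigr => k _.
  rewrite /mulv /derv; have [->|bk] := posnP (b (k, q0)); first by rewrite !mul0r.
  by rewrite decK.
rewrite form_linear // [form num _]form_sum // [form (\sum_(p <- ps) _) _]form_sum //.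
under [X in _ * X]eq_bigr do rewrite form_mulv.
under [X in _ + X]eq_bigr do rewrite form_raise //.
move=> /eqP; rewrite paddr_eq0; last 2 first.
- by rewrite mulr_ge0 // sumr_ge0 // => k _; exact: form_ge0.
- by rewrite sumr_ge0 // => p _; exact: form_ge0.
case/andP; rewrite mulf_eq0 pnatr_eq0 (gtn_eqF alpha_gt0) /= psumr_eq0 => [|k _].
  move=> /allP d0 _; apply/eqP; rewrite -leqn0 leqNgt; apply/negP => aj.
  have jS : j \in [seq j <- S | j <= 0].
    by rewrite mem_filter j0; apply: contraTT aj => jS; rewrite (phiS fa (u := (j, q0))).
  have /eqP/(form_eq0 (finsup_derv _ phiQ_fin)) := d0 j jS.
  move=> /(congr1 (fun f : Fock => f (dec a (j, q0)))); rewrite /derv decK // fQa.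
  by move=> fa0; rewrite fa0 eqxx in fa.
exact: form_ge0.
Qed.

End Positivity.

Let y_col_clean a j : (0 < alpha)%N -> phi a != 0 -> on_xdiag r a ->
  a (xdiag q0) = alpha -> j <= 0 -> a (j, q0) = 0%N.
Proof.
move=> al fa da aal j0; have [S fS] := finsup_within phi_fin.
exact: (@y_clean S).
Qed.

Let alpha_pos_charge a : (0 < alpha)%N -> phi a != 0 -> on_xdiag r a ->
  a (xdiag q0) = alpha -> lam q0 = alpha%:Z.
Proof.
move=> al fa da aal; rewrite -(phi_charge q0 fa) /charge.
have rS : row1 \in rows a.
  apply/negPn/negP => /(@within_rows _ a (xdiag q0)); rewrite aal => al0.
  by rewrite al0 in al.
rewrite (big_fsetD1 row1 rS) /= -[a (row1, q0)]/(a (xdiag q0)) aal.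
rewrite big1_fset ?addr0 ?mul1r // => k; rewrite in_fsetD1 => /andP[kr _] _.
have [k0|k0] := ltP 0 k; first by rewrite (col_clean fa da aal k0 kr) mulr0.
by rewrite (y_col_clean al fa da aal k0) mulr0.
Qed.

Let alpha0_charge a : alpha = 0%N -> phi a != 0 -> on_xdiag r a -> lam q0 <= 0.
Proof.
move=> al fa da; rewrite -(phi_charge q0 fa) /charge.
apply: sumr_le0 => k _; have [k0|k0] := ltP 0 k.
  by rewrite (alpha0_clean al fa da k0) // mulr0.
by rewrite /sgcol ltNge k0 /= mulN1r oppr_le0.
Qed.

Variable a0 : {cmonom I}.
Hypotheses (phi_a0 : phi a0 != 0) (da0 : on_xdiag r a0) (aal0 : a0 (xdiag q0) = alpha).

Lemma xstage_pos : 0 < lam q0 -> alpha = absz (lam q0) /\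
  (forall a, phi a != 0 -> on_xdiag r a -> a (xdiag q0) = alpha -> clean r.+1 a).
Proof.
move=> lam0; have al : (0 < alpha)%N.
  by rewrite lt0n; apply/eqP => /alpha0_charge/(_ phi_a0 da0); rewrite leNgt lam0.
split=> [|a fa da aal]; first by rewrite (alpha_pos_charge al phi_a0 da0 aal0).
have [cx cy] := xclean_r fa da; split=> [k p k0 kp kpn|k p k0 pr].
  have [pq|pq] := eqVneq p q0.
    by rewrite pq in kpn *; exact: (col_clean fa da aal k0 kpn).
  have [->|kr] := eqVneq k row1; first exact: row_clean.
  apply: cx => //; case: kp => [kle|plt]; [left|right].
    by move: kr; rewrite /row1; lia.
  have : p != q0 :> nat by [].
  by rewrite /r; lia.
have [->|pq] := eqVneq p q0; first exact: y_col_clean.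
apply: cy => //; have : p != q0 :> nat by [].
by rewrite /r; lia.
Qed.

Lemma xstage_npos : lam q0 <= 0 -> forall a k p, phi a != 0 -> on_xdiag r a ->
  0 < k -> (r <= p)%N -> a (k, p) = 0%N.
Proof.
move=> lam0 a k p; apply: alpha0_clean; apply/eqP; rewrite -leqn0 leqNgt; apply/negP => al.
by move: lam0; rewrite (alpha_pos_charge al phi_a0 da0 aal0); lia.
Qed.

End XStage.

Let ex_max (P : {cmonom I} -> Prop) u : (exists2 a, phi a != 0 & P a) ->
  exists a, [/\ phi a != 0, P a & forall b, phi b != 0 -> P b -> (b u <= a u)%N].
Proof.
move=> [a fa Pa]; pose Q m := `[< exists b, [/\ phi b != 0, P b & b u = m] >].
have exQ : exists m, Q m by exists (a u); apply/asboolP; exists a.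
have ubQ m : Q m -> (m <= absz (nu u.1))%N.
  by move=> /asboolP[b [fb _ <-]]; exact: phi_bound.
have [m /asboolP[b [fb Pb bm]] mmax] := ex_maxnP exQ ubQ.
exists b; split=> // c fc Pc; rewrite bm; apply: mmax.
by apply/asboolP; exists c.
Qed.

Lemma xphase r : phi != 0 -> (r <= n)%N -> (forall p, (p < r)%N -> 0 < lam p) ->
  xclean r /\ exists2 a, phi a != 0 & on_xdiag r a.
Proof.
move=> f0; elim: r => [|r IHr] rn lam0.
  split=> [a fa _|].
    split=> [k p k0 [k1|//]|//]; by move: k0 k1; lia.
  have [a fa] : exists a, phi a != 0.
    apply: contrapT => /forallNP nf; case/eqP: f0; apply/funext => a.
    by apply/eqP/negPn/negP; exact: nf.
  by exists a.
have [|xc ex] := IHr (ltnW rn); first by move=> p pr; apply: lam0; exact: ltnW.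
have [a [fa da amax]] := ex_max (xdiag (Ordinal rn)) ex.
have lam1 := lam0 (Ordinal rn) (ltnSn _).
have [aE cl] := @xstage_pos (Ordinal rn) _ xc amax _ fa da erefl lam1.
have dS b : on_xdiag r.+1 b <-> on_xdiag r b /\ b (xdiag (Ordinal rn)) = a (xdiag (Ordinal rn)).
  split=> [db|[db bE] p]; last first.
    rewrite ltnS leq_eqVlt => /orP[/eqP pr|]; last exact: db.
    have -> : p = Ordinal rn by exact: val_inj.
    by rewrite bE aE.
  by rewrite aE; split=> [p pr|]; apply: db => //; exact: ltnW.
split; last by exists a => //; apply/dS.
by move=> b fb /dS[db bE]; exact: cl.
Qed.

(** * The rows k <= 0, with columns taken from the last one backwards *)

Section YPhase.
Variable r0 : nat.
Hypothesis r0_le : (r0 <= n)%N.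
Hypothesis lam_pos : forall p, (p < r0)%N -> 0 < lam p.
Hypothesis lam_npos : forall p, (r0 <= p)%N -> lam p <= 0.
Hypothesis phi_neq0 : phi != 0.

Let xpart a k p : phi a != 0 -> on_xdiag r0 a -> 0 < k ->
  k != p.+1%:Z \/ (r0 <= p)%N -> a (k, p) = 0%N.
Proof.
move=> fa da k0 kp; have [xc ex] := xphase phi_neq0 r0_le lam_pos.
have [pr|pr] := ltnP p r0.
  have [cx _] := xc a fa da; apply: cx => //; first by right.
  by case: kp => //; rewrite leqNgt pr.
have rn : (r0 < n)%N by apply: leq_ltn_trans pr _.
have [b [fb db bmax]] := ex_max (xdiag (Ordinal rn)) ex.
have lr : lam (Ordinal rn) <= 0 by apply: lam_npos.
have C := @xstage_npos (Ordinal rn) _ xc bmax _ fb db erefl lr.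
exact: C.
Qed.

Let y_left0 a k p : phi a != 0 -> on_xdiag r0 a -> k <= 0 -> (p < r0)%N -> a (k, p) = 0%N.
Proof.
move=> fa da; have [xc _] := xphase phi_neq0 r0_le lam_pos.
by have [_ cy] := xc a fa da; exact: cy.
Qed.

Let on_ydiag t a := forall p, (t <= p)%N -> a (ydiag p) = absz (lam p).

Let yclean t := forall a, phi a != 0 -> on_xdiag r0 a -> on_ydiag t a ->
  forall k p, k <= 0 -> (t <= p)%N \/ t.+1%:Z - n%:Z <= k ->
    k != p.+1%:Z - n%:Z -> a (k, p) = 0%N.

Section YStage.
Variables (q0 : 'I_n) (beta : nat).
Hypothesis r0q0 : (r0 <= q0)%N.
Hypothesis yclean_q0 : yclean q0.+1.
Hypothesis beta_max : forall a, phi a != 0 -> on_xdiag r0 a /\ on_ydiag q0.+1 a ->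
  (a (ydiag q0) <= beta)%N.

Let max0 a : on_xdiag r0 a -> on_ydiag q0.+1 a -> (beta < a (ydiag q0))%N -> phi a = 0.
Proof.
move=> da ya am; apply/eqP; apply: contraLR am => fa.
by rewrite -leqNgt; exact: beta_max.
Qed.

Let row0 : int := q0.+1%:Z - n%:Z.
Let row0_le : row0 <= 0. Proof. by have := ltn_ord q0; rewrite /row0; lia. Qed.

Variable a : {cmonom I}.
Hypotheses (fa : phi a != 0) (da : on_xdiag r0 a) (ya : on_ydiag q0.+1 a).
Hypothesis abe : a (ydiag q0) = beta.

Let ycol_clean i : i <= 0 -> i != row0 -> a (i, q0) = 0%N.
Proof.
move=> i0 ir.
have [ile|igt] := lerP (q0.+2%:Z - n%:Z) i.
  by apply: (yclean_q0 fa da ya i0 _ ir); right.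
have {igt}igt : i < row0 by rewrite lt_neqAle ir /row0; lia.
apply/eqP; rewrite -leqn0 leqNgt; apply/negP => ai.
pose a' := inc (dec a (i, q0)) (ydiag q0).
have := relB a' igt row0_le.
rewrite (bigD1 q0) //= [X in _ + X]big1 ?addr0; last first.
  move=> p pq0; have npq0 : p != q0 :> nat by [].
  rewrite max0 ?mulr0 // => [p' p'r|p' p'q|].
  - rewrite -da // !(incE, decE, xpair_eqE) /=.
    by rewrite -!val_eqE /=; move: row0_le; rewrite /row0; lia.
  - rewrite -ya // !(incE, decE, xpair_eqE) /=.
    by rewrite -!val_eqE /= /row0; move: igt; rewrite /row0; lia.
  by rewrite !(incE, decE, xpair_eqE) /= abe -!val_eqE /= /row0; lia.
rewrite -/(ydiag q0) /a' incC incK decK // incE eqxx => /eqP.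
by rewrite mulf_eq0 pnatr_eq0 addn1 /= (negPf fa).
Qed.

Let yrow_clean p : p != q0 -> a (row0, p) = 0%N.
Proof.
move=> pq0; have npq0 : p != q0 :> nat by [].
have [pq|pq] := leqP q0.+1 p.
  apply: (yclean_q0 fa da ya) => //; first by left.
  by rewrite /row0; lia.
have {pq}pq : (p < q0)%N by rewrite ltn_neqAle npq0 -ltnS.
have [pr|pr] := ltnP p r0; first exact: y_left0.
apply/eqP; rewrite -leqn0 leqNgt; apply/negP => ap.
pose a' := inc (dec a (row0, p)) (ydiag q0).
have [S a'S rS] : exists2 S, within S a' & row0 \in S.
  exists (row0 |` rows a')%fset; last by rewrite !inE eqxx.
  by apply: within_sub (@within_rows _ a'); exact: fsubsetUr.
have := relD pq a'S.
rewrite [LHS]big1 => [|k k0]; last first.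
  rewrite [a' _](_ : _ = 0%N) ?mul0r // /a' !(incE, decE) xpart //; last by right.
  by rewrite sub0n xpair_eqE -val_eqE /= gtn_eqF // andbF.
rewrite big_mkcond (big_fsetD1 row0 rS) /= row0_le.
rewrite [X in _ + X]big1_fset ?addr0.
  rewrite -/(ydiag q0) /a' incC incK decK // incE eqxx => /esym/eqP.
  by rewrite mulf_eq0 pnatr_eq0 addn1 /= (negPf fa).
move=> k; rewrite in_fsetD1 => /andP[kr _] _; case: ifP => // k0.
rewrite max0 ?mulr0 // => [p' p'r|p' p'q|].
- rewrite -da // !(incE, decE, xpair_eqE) /=.
  by rewrite -!val_eqE /=; move: row0_le; rewrite /row0; lia.
- rewrite -ya // !(incE, decE, xpair_eqE) /=.
  by rewrite -!val_eqE /= /row0; lia.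
by rewrite !(incE, decE, xpair_eqE) /= abe -!val_eqE /=; move: kr; rewrite /row0; lia.
Qed.

(** In these columns the positive rows are already known to be empty, so extremality with [relB] and
    [relD] suffices, and the charge of column [q0] is - beta. *)
Lemma ystage : beta = absz (lam q0) /\
  (forall k p, k <= 0 -> (q0 <= p)%N \/ q0.+1%:Z - n%:Z <= k ->
    k != p.+1%:Z - n%:Z -> a (k, p) = 0%N).
Proof.
split=> [|k p k0 kp kpn].
  rewrite -(phi_charge q0 fa) /charge.
  have [rS|rS] := boolP (row0 \in rows a).
    rewrite (big_fsetD1 row0 rS) /= -[a (row0, q0)]/(a (ydiag q0)) abe.
    rewrite big1_fset ?addr0 => [|k].
      by rewrite /sgcol ltNge row0_le /= mulN1r abszN.
    rewrite in_fsetD1 => /andP[kr _] _.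
    have [k0|k0] := ltP 0 k; last by rewrite ycol_clean ?mulr0.
    by rewrite xpart ?mulr0 //; right.
  have b0 : beta = 0%N by rewrite -abe; exact: (@within_rows _ a (ydiag q0)).
  rewrite b0 big1_fset // => k kS _.
  have [k0|k0] := ltP 0 k; first by rewrite xpart ?mulr0 //; right.
  rewrite ycol_clean ?mulr0 //.
  by apply: contraNneq rS => <-.
have [pq|pq] := eqVneq p q0; first by rewrite pq in kpn *; exact: ycol_clean.
have npq0 : p != q0 :> nat by [].
have [->|kr] := eqVneq k row0; first exact: yrow_clean.
apply: (yclean_q0 fa da ya) => //; case: kp => [qp|kle]; [left|right].
  by rewrite ltn_neqAle eq_sym npq0.
by move: kr; rewrite /row0; lia.
Qed.

End YStage.

Let yphase t : (t <= n - r0)%N -> yclean (n - t) /\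
  exists2 a, phi a != 0 & on_xdiag r0 a /\ on_ydiag (n - t) a.
Proof.
elim: t => [|t IHt] tn.
  rewrite subn0; split=> [a fa da ya k p k0 [np|kn] kpn|].
  - by have := ltn_ord p; lia.
  - by lia.
  have [_ [a fa da]] := xphase phi_neq0 r0_le lam_pos.
  by exists a => //; split=> // p np; have := ltn_ord p; lia.
have [yc ex] := IHt (ltnW tn).
have qn : (n - t.+1 < n)%N by lia.
pose q0 := Ordinal qn; have q0E : (n - t = q0.+1)%N by rewrite /=; lia.
rewrite q0E in yc ex.
have [a [fa [da ya] amax]] := ex_max (ydiag q0) ex.
have rq : (r0 <= q0)%N by rewrite /=; lia.
have [bE _] := ystage rq yc amax fa da ya erefl.
have dS b : on_ydiag q0 b <-> on_ydiag q0.+1 b /\ b (ydiag q0) = a (ydiag q0).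
  split=> [db|[db bE'] p]; last first.
    rewrite leq_eqVlt => /orP[/eqP pr|]; last exact: db.
    have <- : q0 = p by exact: val_inj.
    by rewrite bE' bE.
  by rewrite bE; split=> [p pr|]; apply: db => //; exact: ltnW.
split=> [b fb db /dS[yb bb]|]; last by exists a => //; split=> //; apply/dS.
by have [_] := ystage rq yc amax fb db yb bb.
Qed.

Lemma canonical_neq0 : exists2 a, phi a != 0 &
  forall u, a u = if (u == xdiag u.2) && (0 < lam u.2) || (u == ydiag u.2) && (lam u.2 < 0)
                  then absz (lam u.2) else 0%N.
Proof.
have [] := yphase (leqnn _); rewrite subKn // => yc [a fa [da ya]].
exists a => // -[k p] /=; rewrite !xpair_eqE eqxx !andbT.
have [k0|k0] := ltP 0 k.
  have -> : (k == p.+1%:Z - n%:Z) = false by have := ltn_ord p; lia.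
  rewrite orbF; case: ifP => [/andP[/eqP -> lp]|/negbT].
    by apply: da; rewrite ltnNge; apply/negP => /lam_npos; lia.
  rewrite negb_and => kp; apply: xpart => //.
  case/orP: kp => [|lp]; [by left|right].
  by rewrite leqNgt; apply: contra lp => /lam_pos.
have -> : (k == p.+1%:Z) = false by lia.
have [pr|pr] := ltnP p r0.
  rewrite y_left0 // andFb orFb; case: ifP => // /andP[_].
  by have := lam_pos pr; lia.
have [->|kp] := eqVneq k (p.+1%:Z - n%:Z).
  rewrite -[(_, p)]/(ydiag p) ya //= lt_neqAle (lam_npos pr) andbT.
  by case: eqVneq => // ->.
by rewrite /= (yc a fa da ya) //; left.
Qed.

End YPhase.

End JointHighest.

Section CanonicalMonomial.
Variables (n : nat).
Local Notation I := (int * 'I_n)%type.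
Implicit Types (p q : 'I_n) (lam : 'I_n -> int) (u : I).

Definition canonical_exp lam u : nat :=
  if (u == xdiag u.2) && (0 < lam u.2) || (u == ydiag u.2) && (lam u.2 < 0)
  then absz (lam u.2) else 0.

(* The monomial of the joint highest weight vector of gl_n-weight lam on which
   only the identity term of the antisymmetrizers contributes. *)
Definition canonical lam : {cmonom I} :=
  mkcmonom [fsfun u in [fset xdiag p | p : 'I_n]%fset `|` [fset ydiag p | p : 'I_n]%fset
    => canonical_exp lam u | 0%N]%fset.

Lemma canonicalE lam u : canonical lam u = canonical_exp lam u.
Proof.
rewrite cmE fsfunE; case: ifPn => //; rewrite inE negb_or => /andP[ux uy].
rewrite /canonical_exp; case: ifP => // /orP[]/andP[/eqP uE _].
  by case/imfsetP: ux; exists u.2.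
by case/imfsetP: uy; exists u.2.
Qed.

End CanonicalMonomial.

(** * Weight components and raising to joint highest weight vectors *)

Section WeightComponent.
Variables (K : numClosedFieldType) (n : nat).
Local Notation I := (int * 'I_n)%type.
Local Notation Fock := (fock K I).
Implicit Types (f g h : Fock) (a b : {cmonom I}) (u v w : I) (p q : 'I_n) (i j k : int).

Lemma wtm_inc a u k : wtm (inc a u) k = wtm a k + sgcol k * (k == u.1)%:Z.
Proof.
rewrite /wtm -mulrDr -PoszD; congr (_ * _%:Z).
under eq_bigr do rewrite incE.
rewrite big_split /=; congr (_ + _)%N; case: u => i q /=.
rewrite (bigD1 q) //= big1 => [|p pq]; last first.
  by rewrite xpair_eqE [q == p]eq_sym (negPf pq) andbF.
by rewrite addn0 xpair_eqE eqxx andbT eq_sym.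
Qed.

Lemma wtm_dec a u k : (0 < a u)%N -> wtm (dec a u) k = wtm a k - sgcol k * (k == u.1)%:Z.
Proof. by move=> au; rewrite -{2}(decK au) wtm_inc addrK. Qed.

Lemma psi_weight u f g a :
  (forall b, (forall k, wtm b k = wtm a k - (k == u.1)%:Z) -> f b = g b) ->
  psi u f a = psi u g a.
Proof.
move=> E; rewrite /psi; case: ltP => u0.
  rewrite /mulv; have [->|au] := posnP (a u); first by rewrite !mul0r.
  rewrite E // => k; rewrite wtm_dec //; congr (_ - _).
  by case: (eqVneq k u.1) => [->|]; rewrite ?mulr0 // /sgcol u0.
rewrite !fockN /derv E // => k; rewrite wtm_inc; congr (_ + _).
case: (eqVneq k u.1) => [->|]; rewrite ?mulr0 ?oppr0 //.
by rewrite /sgcol ltNge u0 mulr1.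
Qed.

Lemma psis_weight u f g a :
  (forall b, (forall k, wtm b k = wtm a k + (k == u.1)%:Z) -> f b = g b) ->
  psis u f a = psis u g a.
Proof.
move=> E; rewrite /psis; case: ltP => u0.
  rewrite /derv E // => k; rewrite wtm_inc; congr (_ + _).
  by case: (eqVneq k u.1) => [->|]; rewrite ?mulr0 // /sgcol u0.
rewrite /mulv; have [->|au] := posnP (a u); first by rewrite !mul0r.
rewrite E // => k; rewrite wtm_dec //; congr (_ + _).
case: (eqVneq k u.1) => [->|]; rewrite ?mulr0 ?oppr0 //.
by rewrite /sgcol ltNge u0 mulr1 opprK.
Qed.

Lemma bil_weight u v f g a :
  (forall b, (forall k, wtm b k = wtm a k - (k == u.1)%:Z + (k == v.1)%:Z) -> f b = g b) ->
  bil u v f a = bil u v g a.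
Proof.
move=> E; rewrite !bilEa; congr (_ + _).
  apply: psi_weight => b bE; apply: psis_weight => c cE; apply: E => k.
  by rewrite cE bE.
case: eqP => [uv|]; last by rewrite !mul0r.
by rewrite E // => k; rewrite uv subrK.
Qed.

(** A general element is an infinite sum of weight vectors. One component has the finite support
    that the uniqueness argument relies on, and it inherits singularity. *)
Definition wcomp nu f : Fock := fun a => if `[< wtm a = nu >] then f a else 0.

Lemma wcomp_weight nu f : gh_weight nu (wcomp nu f).
Proof.
apply/gh_weightP => a; rewrite /wcomp; case: asboolP => //.
by move=> /mem_ghfset ->.
Qed.

Lemma glop_wcomp nu p q f : glop p q (wcomp nu f) = wcomp nu (glop p q f).
Proof.
apply/funext => a; pose S := rows a; have aS : within S a := @within_rows _ a.
have E g : (forall b, wtm b = wtm a -> wcomp nu f b = g b) ->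
    glop p q (wcomp nu f) a = glop p q g a.
  move=> E; rewrite !(glopE _ _ _ aS) /glsum !fock_sum; apply: eq_bigr => k _.
  apply: bil_weight => b bE; apply: E; apply/funext => l.
  by rewrite bE subrK.
rewrite {2}/wcomp; case: asboolP => aN.
  by rewrite (E f) // => b ba; rewrite /wcomp ba asboolT.
rewrite (E 0) ?(linear0 (glop p q)) // => b ba.
by rewrite /wcomp ba asboolF.
Qed.

Lemma ghop_wcomp nu i j f :
  ghop i j (wcomp nu f) = wcomp (fun k => nu k + (k == i)%:Z - (k == j)%:Z) (ghop i j f).
Proof.
apply/funext => a.
have E g : (forall b, (forall k, wtm b k = wtm a k - (k == i)%:Z + (k == j)%:Z) ->
     wcomp nu f b = g b) -> ghop i j (wcomp nu f) a = ghop i j g a.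
  move=> E; rewrite !ghopE; apply: eq_bigr => p _.
  by apply: bil_weight => b bE; apply: E.
rewrite {2}/wcomp; case: asboolP => aN.
  rewrite (E f) // => b ba; rewrite /wcomp asboolT //.
  by apply/funext => k; rewrite ba aN addrAC subrK addrK.
rewrite (E 0) ?(linear0 (ghop i j)) // => b ba.
rewrite /wcomp asboolF // => bN; apply: aN; apply/funext => k.
by rewrite -bN ba addrAC addrK subrK.
Qed.

Lemma gl_highest_wcomp nu lam f : gl_highest lam f -> gl_highest lam (wcomp nu f).
Proof.
have w0 : wcomp nu 0 = 0 by apply/funext => a; rewrite /wcomp; case: ifP.
move=> [s w]; split=> [p q pq|p]; rewrite glop_wcomp; first by rewrite s.
rewrite w; apply/funext => a; apply: esym; apply: etrans (fockZ _ _ _) _.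
by rewrite /wcomp; case: ifP => _; rewrite ?mulr0.
Qed.

Lemma dominant_pos (lam : 'I_n -> int) : dominant lam ->
  exists r, [/\ (r <= n)%N, forall p, (p < r)%N -> 0 < lam p
             & forall p, (r <= p)%N -> lam p <= 0].
Proof.
move=> dom; pose r := #|[set p | 0 < lam p]%SET|.
have sub p : 0 < lam p -> forall q, (q <= p)%N -> 0 < lam q.
  move=> lp q; rewrite leq_eqVlt => /orP[/eqP/val_inj -> //|qp].
  exact: lt_le_trans lp (dom _ _ qp).
have cl m : (m <= n)%N -> #|[set q : 'I_n | (q < m)%N]%SET| = m.
  move=> mn; rewrite -sum1dep_card -(big_ord_widen n (fun=> 1%N) mn).
  by rewrite sum1_card card_ord.
exists r; split=> [|p pr|p rp].
- by rewrite -[leqRHS]card_ord max_card.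
- apply/negPn/negP => lp; move: pr; rewrite ltnNge => /negP; apply.
  rewrite -[leqRHS](cl p) ?(ltnW (ltn_ord p)) //; apply: subset_leq_card.
  apply/fintype.subsetP => q; rewrite !inE => lq; rewrite ltnNge.
  by apply: contra lp => pq; exact: sub lq _ pq.
rewrite leNgt; apply/negP => lp; move: rp; rewrite leqNgt => /negP; apply.
rewrite -[leqLHS](cl p.+1) //; apply: subset_leq_card.
by apply/fintype.subsetP => q; rewrite !inE ltnS; exact: sub lp q.
Qed.

Lemma joint_highest_eq0 (lam : 'I_n -> int) f : dominant lam -> gl_highest lam f ->
  (forall i j, i < j -> ghop i j f = 0) -> f (canonical lam) = 0 -> f = 0.
Proof.
move=> /dominant_pos[r [rn lpos lnpos]] fl fh fc; apply: contrapT => f0.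
have [a fa] : exists a, f a != 0.
  apply: contrapT => /forallNP nf; apply: f0; apply/funext => a.
  by apply/eqP/negPn/negP; exact: nf.
pose nu := wtm a; pose phi := wcomp nu f.
have phi0 : phi != 0.
  apply: contraNneq fa => /(congr1 (fun g : Fock => g a)).
  by rewrite /phi /wcomp asboolT // => ->.
have phi_gh i j : i < j -> ghop i j phi = 0.
  move=> ij; rewrite /phi ghop_wcomp fh //.
  by apply/funext => b; rewrite /wcomp; case: ifP.
have [b fb bE] := canonical_neq0 (gl_highest_wcomp nu fl) phi_gh
  (wcomp_weight nu f) rn lpos lnpos phi0.
have bc : b = canonical lam by apply: cmonom_eq => u; rewrite bE canonicalE.
by move/eqP: fb; apply; rewrite /phi /wcomp bc fc if_same.
Qed.

Lemma raise_to_joint_highest (P : set Fock) N f :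
  (forall i j g, i < j -> P g -> P (ghop i j g)) -> P f -> f != 0 -> bounded N f ->
  exists g, [/\ P g, g != 0 & forall i j, i < j -> ghop i j g = 0].
Proof.
move=> Pgh; elim: N f => [f _ f0 fN|N IHN f Pf f0 fN].
  by case/eqP: f0; apply/funext => a; rewrite fN.
have [//|] := pselect (forall i j, i < j -> ghop i j f = 0); first by exists f.
move=> /existsNP[i1] /existsNP[j1] /not_implyP[ij] /eqP ne.
apply: (IHN (ghop i1 j1 f)) => //; first exact: Pgh.
exact: bounded_ghop_raise.
Qed.

End WeightComponent.

(** * Joint highest weight vectors: existence *)

Section Antisymmetrizer.
Variables (K : numClosedFieldType) (n r : nat) (k : 'I_r -> int).
Local Notation I := (int * 'I_n)%type.
Local Notation Fock := (fock K I).
Implicit Types (f g h : Fock) (a b : {cmonom I}) (p q : 'I_n) (c : 'I_r -> 'I_n).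
Implicit Types (s : seq 'I_r) (i j : 'I_r) (z : K).

Definition mono s c f : Fock := foldr (fun i => mulv (k i, c i)) f s.

Lemma monoZ s c z f : mono s c (z *: f) = z *: mono s c f.
Proof. by elim: s => //= i s ->; rewrite (linearZ_LR (mulv _)). Qed.

Lemma eq_mono s c c' f : {in s, c =1 c'} -> mono s c f = mono s c' f.
Proof.
elim: s => //= i s IHs E; rewrite IHs ?E ?mem_head // => j js.
by apply: E; rewrite inE js orbT.
Qed.

Lemma mono_eq0 s c f a i : i \in s -> a (k i, c i) = 0%N -> mono s c f a = 0.
Proof.
elim: s a => // j s IHs a; rewrite inE /= /mulv.
have [<- _ ->|_ /= is_] := eqVneq i j; first by rewrite mul0r.
by move=> ai; rewrite IHs ?mulr0 // decE ai.
Qed.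

Definition decs s c a : {cmonom I} := foldl (fun b i => dec b (k i, c i)) a s.

Lemma decsE s c a u : decs s c a u = (a u - count (fun i => (k i, c i) == u) s)%N.
Proof.
by elim: s a => [|i s IHs] a; rewrite /= ?subn0 // IHs decE subnDA.
Qed.

Lemma mono_neq0 s c f a : injective k -> uniq s -> {in s, forall i, (0 < a (k i, c i))%N} ->
  f (decs s c a) != 0 -> mono s c f a != 0.
Proof.
move=> kI; elim: s a => // i s IHs a /andP[ns us] pos fa.
rewrite /= /mulv mulf_neq0 //; first by rewrite pnatr_eq0 -lt0n pos ?mem_head.
apply: IHs => // j js; rewrite decE xpair_eqE (inj_eq kI).
have [ij|_] := eqVneq i j; first by rewrite ij js in ns.
by rewrite subn0 pos // inE js orbT.
Qed.

Lemma finsup_mono s c f : finsup f -> finsup (mono s c f).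
Proof. by move=> ff; elim: s => //= i s; exact: finsup_mulv. Qed.

Definition subst c i p j := if j == i then p else c j.

Section GlMono.
Variables (p q p' q' : 'I_n) (z : K).
Hypothesis glop_mulv : forall i t f, glop p q (mulv (k i, t) f) =
  mulv (k i, t) (glop p q f) + (z * (q' == t)%:R) *: mulv (k i, p') f.

Lemma glop_mono s c f : uniq s -> glop p q (mono s c f) = mono s c (glop p q f) +
  \sum_(i <- s) (z * (q' == c i)%:R) *: mono s (subst c i p') f.
Proof.
elim: s => [_|i s IHs /= /andP[ns us]]; first by rewrite big_nil addr0.
rewrite glop_mulv IHs // linearD /= big_cons [subst c i p' i]/subst eqxx.
rewrite (@eq_mono s (subst c i p') c) => [|j js]; last first.
  by rewrite /subst; case: eqP => // ji; rewrite -ji js in ns.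
rewrite addrAC -addrA; congr (_ + (_ + _)).
rewrite linear_sum; apply: eq_big_seq => j js.
rewrite (linearZ_LR (mulv (k i, c i))) /subst /= ifN_eq //.
by apply: contraNneq ns => ->.
Qed.

Variable e : 'I_r -> 'I_n.
Hypothesis eI : injective e.

(** Multiplication by the minor of the matrix of variables with rows [k] and columns [e]. *)
Definition antisym f : Fock := \sum_(w : 'S_r) (-1) ^+ w *: mono (index_enum 'I_r) (e \o w) f.

Lemma glop_antisym_diag f : p' = q' -> glop p q (antisym f) =
  antisym (glop p q f) + (z * [exists i, e i == q']%:R) *: antisym f.
Proof.
move=> pq; rewrite /antisym (linear_sum (glop p q)) scaler_sumr -big_split.
apply: eq_bigr => w _ /=; rewrite (linearZ_LR (glop p q)) /= glop_mono ?index_enum_uniq //.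
rewrite scalerDr; congr (_ + _); rewrite scalerA [_ * (-1) ^+ _]mulrC -scalerA; congr (_ *: _).
case: existsP => [[j /eqP jq]|N].
  rewrite (bigD1 (w^-1 j)%g) //= permKV -jq eqxx [X in _ + X]big1 => [|i iw]; last first.
    rewrite (inj_eq eI) [j == _](_ : _ = false) ?mulr0 ?scale0r //.
    by apply: contraNF iw => /eqP ->; rewrite permK.
  rewrite addr0; congr (_ *: _); apply: eq_mono => i _; rewrite /subst.
  by case: eqP => // ->; rewrite /= permKV jq.
rewrite mulr0 scale0r big1 // => i _; rewrite [_ == _](_ : _ = false) ?mulr0 ?scale0r //.
by apply/eqP => E; apply: N; exists (w i); rewrite E.
Qed.

(** The operator differentiates the minor, replacing its column [q'] by [p'], which occurs already:
    a determinant with two equal columns. *)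
Lemma glop_antisym f : p' != q' ->
  ((exists i, e i = q') -> exists i, e i = p') -> glop p q (antisym f) = antisym (glop p q f).
Proof.
move=> pq im; rewrite /antisym (linear_sum (glop p q)).
under eq_bigr do rewrite (linearZ_LR (glop p q)) /= glop_mono ?index_enum_uniq // scalerDr.
rewrite big_split /= [X in _ + X](_ : _ = 0) ?addr0 //.
have [[j jq]|N] := pselect (exists i, e i = q'); last first.
  rewrite big1 // => w _; rewrite big1 ?scaler0 // => i _.
  rewrite [_ == _](_ : _ = false) ?mulr0 ?scale0r //.
  by apply/eqP => E; apply: N; exists (w i); rewrite E.
have [j' jp] : exists i, e i = p' by apply: im; exists j.
have jj : j' != j by apply: contraNneq pq => jj; rewrite -jp -jq jj.
pose m i := if i == j then j' else i.
pose G (h : 'I_r -> 'I_r) := z *: mono (index_enum 'I_r) (e \o h) f.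
rewrite (eq_bigr (fun w : 'S_r => (-1) ^+ w *: G (m \o w))) => [|w _]; last first.
  congr (_ *: _); rewrite (bigD1 (w^-1 j)%g) //= permKV jq eqxx mulr1.
  rewrite [X in _ + X]big1 => [|i iw]; last first.
    rewrite -jq (inj_eq eI) [j == _](_ : _ = false) ?mulr0 ?scale0r //.
    by apply: contraNF iw => /eqP ->; rewrite permK.
  rewrite addr0; congr (_ *: _); apply: eq_mono => i _; rewrite /subst /= /m.
  have -> : (i == (w^-1)%g j) = (w i == j).
    by apply/eqP/eqP => [->|<-]; rewrite ?permKV ?permK.
  by case: ifP.
(* [m] sends both [j] and [j'] to [j'], so composing [w] with their transposition changes only the
   sign. *)
set S := LHS; have : S = - S.
  rewrite {1}/S (reindex_inj (mulIg (tperm j j'))) -sumrN; apply: eq_bigr => w _.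
  rewrite odd_permM odd_tperm eq_sym jj addbT signrN scaleNr; congr (- (_ *: _)).
  congr (_ *: _); apply: eq_mono => i _; rewrite /= permM /m; congr (e _).
  have [->|wj] := eqVneq (w i) j; first by rewrite tpermL (negPf jj).
  have [->|wj'] := eqVneq (w i) j'; first by rewrite tpermR eqxx.
  by rewrite tpermD ?(negPf wj) // eq_sym.
move/eqP; rewrite -addr_eq0 -[S in S + _]scale1r -[S in _ + S]scale1r -scalerDl.
by rewrite scaler_eq0 -[_ == 0 :> K]/((1 + 1 : K) == 0) -(natrD _ 1 1) pnatr_eq0 => /eqP.
Qed.

End GlMono.

Lemma antisymZ e z f : antisym e (z *: f) = z *: antisym e f.
Proof.
rewrite /antisym scaler_sumr; apply: eq_bigr => w _.
by rewrite monoZ !scalerA mulrC.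
Qed.

Lemma finsup_antisym e f : finsup f -> finsup (antisym e f).
Proof. by move=> ff; apply: finsup_sum => w; apply: finsupZ; exact: finsup_mono. Qed.

Lemma antisym_value e f a : injective k ->
  (forall i j, (0 < a (k i, e j))%N = (i == j)) ->
  f (decs (index_enum 'I_r) e a) != 0 -> antisym e f a != 0.
Proof.
move=> kI ae fa; rewrite /antisym fock_sum (bigD1 1%g) //= [X in _ + X]big1 ?addr0.
  rewrite odd_perm1 scale1r (@eq_mono _ _ e) => [|i _]; last by rewrite /= perm1.
  by apply: mono_neq0 => // [|i _]; rewrite ?index_enum_uniq // ae.
move=> w w1; have [i wi] : exists i, w i != i.
  apply: contrapT => /forallNP N; case/eqP: w1; apply/permP => i; rewrite perm1.
  by apply/eqP/negPn/negP; exact: N.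
rewrite fockZ (@mono_eq0 _ _ _ _ i) ?mulr0 ?mem_index_enum //=.
by apply/eqP; rewrite -leqn0 leqNgt ae eq_sym.
Qed.

End Antisymmetrizer.

(** * Products of minors *)

Section SingularVectors.
Variables (K : numClosedFieldType) (n : nat).
Local Notation I := (int * 'I_n)%type.
Local Notation Fock := (fock K I).
Implicit Types (f g h : Fock) (a b : {cmonom I}) (p q : 'I_n) (lam : 'I_n -> int).

Lemma glop_mulv_x p q (k : int) t f : 0 < k ->
  glop p q (mulv (k, t) f) = mulv (k, t) (glop p q f) + (1 * (q == t)%:R) *: mulv (k, p) f.
Proof. by move=> k0; have := glop_psi p q k t f; rewrite /psi k0 mul1r. Qed.

Lemma glop_mulv_y p q (k : int) t f : k <= 0 ->
  glop p q (mulv (k, t) f) = mulv (k, t) (glop p q f) + (-1 * (p == t)%:R) *: mulv (k, q) f.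
Proof.
by move=> k0; have := glop_psis p q k t f; rewrite /psis ltNge k0 mulN1r scaleNr.
Qed.

Definition vacuum : Fock := fun a => (a == mone)%:R.

Lemma inc_neq1 (I' : choiceType) (a : {cmonom I'}) u : (inc a u == mone) = false.
Proof.
apply/eqP => /(congr1 (fun b : {cmonom I'} => b u)); rewrite incE eqxx.
by rewrite -[mone]/(onecm _) cm1 addn1.
Qed.

Lemma vacuum_highest : gl_highest (fun=> 0) vacuum.
Proof.
have vac_charge p : charge mone p = 0.
  by rewrite /charge big1 // => k _; rewrite -[mone]/(onecm _) cm1 mulr0.
split=> [p q pq|p]; apply/funext => a; last first.
  rewrite glop_diag fockZ /vacuum; case: eqP => [->|]; last by rewrite !mulr0.
  by rewrite vac_charge.
rewrite (glopE _ _ _ (@within_rows _ a)) /glsum fock_sum big1 // => k _.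
have npq : p != q by rewrite -val_eqE /= ltn_eqF.
have [k0|k0] := ltP 0 k; first by rewrite bil_xx // /vacuum inc_neq1 mulr0.
have kpq : (k, p) != (k, q) by rewrite xpair_eqE eqxx.
by rewrite bil_yy // inc_dec // /vacuum inc_neq1 mulr0 oppr0.
Qed.

(** The induction step for both signs of the entries of [lam]. On variables in positive rows
    [glop p q] replaces column [q] by [p], in the other rows [p] by [q] with the opposite sign;
    [p'], [q'], [y] and [z] record this. *)
Lemma antisym_highest (r : nat) (k : 'I_r -> int) (e : 'I_r -> 'I_n) (z : int) lam lam' f :
  injective k -> injective e ->
  (forall p q, (p < q)%N -> exists p' q' (y : K), [/\ p' != q',
     forall i t g, glop p q (mulv (k i, t) g) =
       mulv (k i, t) (glop p q g) + (y * (q' == t)%:R) *: mulv (k i, p') g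
     & (exists i, e i = q') -> exists i, e i = p']) ->
  (forall p i t g, glop p p (mulv (k i, t) g) =
       mulv (k i, t) (glop p p g) + (z%:~R * (p == t)%:R) *: mulv (k i, p) g) ->
  (forall p, lam p = lam' p + z * [exists i, e i == p]%:Z) ->
  (forall i j, (0 < canonical lam (k i, e j))%N = (i == j)) ->
  (forall u, canonical lam' u =
     (canonical lam u - count (fun i => (k i, e i) == u) (index_enum 'I_r))%N) ->
  [/\ finsup f, gl_highest lam' f & f (canonical lam') != 0] ->
  exists g, [/\ finsup g, gl_highest lam g & g (canonical lam) != 0].
Proof.
move=> kI eI H1 H2 lamE ce cE [ff [s w] fc]; exists (antisym k e f).
split; first exact: finsup_antisym.
  split=> [p q pq|p].
    have [p' [q' [y [ne E im]]]] := H1 p q pq.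
    rewrite (glop_antisym E eI _ ne im) s //.
    by rewrite -{1}(scale0r (0 : Fock)) antisymZ scale0r.
  rewrite (@glop_antisym_diag _ _ _ _ _ _ _ _ _ (H2 p)) // w lamE.
  rewrite antisymZ.
  by rewrite -scalerDl rmorphD rmorphM.
apply: antisym_value => //.
rewrite (_ : decs _ _ _ _ = canonical lam') //.
by apply: cmonom_eq => u; rewrite decsE cE.
Qed.

Lemma count_inj (T : finType) (T' : eqType) (F : T -> T') u : injective F ->
  count (fun i => F i == u) (index_enum T) = [exists i, F i == u].
Proof.
move=> FI; case: existsP => [[i /eqP <-]|N]; last first.
  by apply/eqP; rewrite -leqn0 leqNgt -has_count; apply/hasP => -[i _ iu]; apply: N; exists i.
rewrite (@eq_count _ _ (pred1 i)) => [|j /=]; last exact: inj_eq.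
by rewrite count_uniq_mem ?index_enum_uniq // mem_index_enum.
Qed.

(** Lowering all positive entries by 1 splits off the minor with rows 1, .., r and the first r
    columns. When none is left, raising all negative entries by 1 splits off the minor with rows 0,
    .., 1 - s and the last s columns. *)
Lemma singular_exists lam : dominant lam ->
  exists f, [/\ finsup f, gl_highest lam f & f (canonical lam) != 0].
Proof.
have [N] := ubnP (\sum_p absz (lam p))%N; elim: N lam => // N IHN lam lamN dom.
have [r [rn lpos lnpos]] := dominant_pos dom.
have lt_sum lam' (p : 'I_n) : (forall q, absz (lam' q) <= absz (lam q))%N ->
    (absz (lam' p) < absz (lam p))%N -> (\sum_p absz (lam' p) < N)%N.
  move=> le lt; rewrite -ltnS; apply: leq_ltn_trans lamN; rewrite (bigD1 p) //= [leqRHS](bigD1 p) //=.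
  by rewrite -addSn leq_add // leq_sum.
have [r0|r_gt0] := posnP r; last first.
  pose lam' p := lam p - (p < r)%N%:Z.
  have dom' : dominant lam'.
    move=> p q pq; have := dom p q pq; rewrite /lam'.
    have [pr|pr] := ltnP p r; have [qr|qr] := ltnP q r; rewrite ?subr0 //; try lia.
    by have := lpos p pr; have := lnpos q qr; lia.
  have rn0 : (0 < n)%N by exact: leq_trans rn.
  have lt' : (\sum_p absz (lam' p) < N)%N.
    apply: (@lt_sum _ (Ordinal rn0)) => [q|]; rewrite /lam'.
      by have [/lpos|_] := ltnP q r; lia.
    by rewrite /= r_gt0; have := lpos (Ordinal rn0) r_gt0; lia.
  have [f fP] := IHN lam' lt' dom'.
  pose e (i : 'I_r) := widen_ord rn i.
  have im p : [exists i, e i == p] = (p < r)%N.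
    apply/existsP/idP => [[i /eqP <-] /=|pr]; first exact: ltn_ord.
    by exists (Ordinal pr); apply/eqP/val_inj.
  apply: (@antisym_highest r (fun i => i.+1%:Z) e 1 lam lam' f) => //.
  - by move=> i j [] /val_inj.
  - by move=> i j [] /val_inj.
  - move=> p q pq; exists p, q, 1; split=> [|i t g|[i /(congr1 val) /= iq]].
    + by rewrite -val_eqE /= ltn_eqF.
    + by rewrite glop_mulv_x.
    have pr : (p < r)%N by rewrite (ltn_trans pq) // -iq.
    by exists (Ordinal pr); apply: val_inj.
  - by move=> p i t g; rewrite glop_mulv_x.
  - by move=> p; rewrite im /lam' mul1r subrK.
  - move=> i j; rewrite canonicalE /canonical_exp /= !xpair_eqE eqxx !andbT.
    have := lpos (e j) (ltn_ord j); have := ltn_ord j; rewrite /e /= => jr lj.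
    have -> : (i.+1%:Z == j.+1%:Z - n%:Z) = false by lia.
    rewrite lj !andbT orbF -[i == j]val_eqE /=.
    by case: eqP => [[->]|]; lia.
  move=> -[k p]; rewrite !canonicalE /canonical_exp /= count_inj; last first.
    by move=> i j [] /val_inj.
  have -> : [exists i : 'I_r, (i.+1%:Z, e i) == (k, p)] = (k == p.+1%:Z) && (p < r)%N.
    rewrite -im; apply/existsP/andP => [[i /eqP [<- <-]]|[/eqP -> /existsP[i /eqP <-]]].
      by split=> //; apply/existsP; exists i.
    by exists i.
  rewrite !xpair_eqE eqxx !andbT /lam'.
  have := ltn_ord p; have [pr|pr] := ltnP p r; [have := lpos p pr|have := lnpos p pr] => lp pn.
    have -> : (lam p < 0) = false by lia.
    have -> : (lam p - 1 < 0) = false by lia.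
    rewrite !andbF !orbF lp andbT; case: eqP => /= _; last by [].
    by case: ifP; lia.
  by rewrite subr0 andbF subn0.
move: lnpos lpos; rewrite {}r0 => lnpos _.
have {}lnpos p : lam p <= 0 by exact: lnpos.
have [s [sn sP]] : exists s, (s <= n)%N /\ forall p : 'I_n, (n - s <= p)%N = (lam p < 0).
  pose lamN' p := - lam (rev_ord p).
  have [|s [sn s1 s2]] := @dominant_pos n lamN'.
    by move=> p q pq; rewrite lerN2; apply: dom => /=; have := ltn_ord q; lia.
  exists s; split=> // p; have pn := ltn_ord p; apply/idP/idP => H.
    have := s1 (rev_ord p); rewrite /lamN' rev_ordK /= oppr_gt0; apply.
    by lia.
  rewrite leqNgt; apply/negP => ps; have := s2 (rev_ord p); rewrite /lamN' rev_ordK /=.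
  have -> : (s <= n - p.+1)%N by lia.
  by move=> /(_ isT); lia.
have [s0|s_gt0] := posnP s.
  have lam0 : lam = fun=> 0.
    apply/funext => p; apply/eqP; rewrite eq_le lnpos leNgt -sP s0.
    by have := ltn_ord p; lia.
  exists vacuum; rewrite lam0; split; last 1 first.
  - rewrite /vacuum (_ : canonical _ = mone) ?eqxx ?oner_eq0 //.
    apply: cmonom_eq => u; rewrite canonicalE /canonical_exp ltxx !andbF.
    by rewrite -[mone]/(onecm _) cm1.
  - exists [fset (mone : {cmonom I})]%fset => a; rewrite in_fset1 => /negPf E.
    by rewrite /vacuum E.
  exact: vacuum_highest.
pose lam' p := lam p + (n - s <= p)%N%:Z.
have dom' : dominant lam'.
  move=> p q pq; have := dom p q pq; rewrite /lam' !sP; have := lnpos p; have := lnpos q.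
  by case: ltP; case: ltP; lia.
have sn0 : (n - s < n)%N by lia.
have lt' : (\sum_p absz (lam' p) < N)%N.
  apply: (@lt_sum _ (Ordinal sn0)) => [q|]; rewrite /lam' sP.
    by have := lnpos q; case: ltP; lia.
  have := sP (Ordinal sn0); rewrite /= leqnn => /esym lt0.
  by rewrite lt0; lia.
have [f fP] := IHN lam' lt' dom'.
(* In reverse order, so that row [- i] and column [e i] meet at [ydiag (e i)]. *)
pose e (i : 'I_s) := rev_ord (widen_ord sn i).
have eE i : e i = (n - i.+1)%N :> nat by [].
have eI : injective e by move=> i j /rev_ord_inj [] /val_inj.
have im p : [exists i, e i == p] = (n - s <= p)%N.
  have pn := ltn_ord p; apply/existsP/idP => [[i /eqP <-]|pr].
    by rewrite eE; have := ltn_ord i; lia.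
  have ps : (n - p.+1 < s)%N by lia.
  by exists (Ordinal ps); apply/eqP/ord_inj; rewrite eE /=; lia.
have yE i : (e i).+1%:Z - n%:Z = - i%:Z by rewrite eE; have := ltn_ord i; lia.
apply: (@antisym_highest s (fun i => - i%:Z) e (-1) lam lam' f) => //.
- by move=> i j /oppr_inj [] /val_inj.
- move=> p q pq; exists q, p, (-1); split=> [|i t g|[i /(congr1 val) ip]].
  + by rewrite -val_eqE /= gtn_eqF.
  + by rewrite glop_mulv_y // oppr_le0.
  have : [exists i, e i == q].
    by rewrite im; move: ip; rewrite /= => ip; have := ltn_ord i; lia.
  by case/existsP=> j /eqP; exists j.
- by move=> p i t g; rewrite glop_mulv_y // oppr_le0.
- by move=> p; rewrite im /lam' mulN1r addrK.
- move=> i j; rewrite canonicalE /canonical_exp /= !xpair_eqE eqxx !andbT -[_ == _ - _]/(_ == (e j).+1%:Z - _) yE.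
  have lj : lam (e j) < 0 by rewrite -sP -im; apply/existsP; exists j.
  have -> : (- i%:Z == (e j).+1%:Z) = false by lia.
  rewrite lj andbT /= eqr_opp -[i == j]val_eqE /=.
  by rewrite eqz_nat; case: eqP; lia.
move=> -[k p]; rewrite !canonicalE /canonical_exp /= count_inj; last first.
  by move=> i j /(congr1 snd) /eI.
have -> : [exists i : 'I_s, (- i%:Z, e i) == (k, p)] = (k == p.+1%:Z - n%:Z) && (n - s <= p)%N.
  rewrite -im; apply/existsP/andP => [[i /eqP [<- <-]]|[/eqP -> /existsP[i /eqP <-]]].
    by split; [rewrite yE|apply/existsP; exists i].
  by exists i; rewrite yE.
rewrite !xpair_eqE eqxx !andbT /lam' sP.
have := lnpos p; case: (ltP (lam p) 0) => lp lp0 /=.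
  have -> : (0 < lam p) = false by lia.
  have -> : (0 < lam p + 1) = false by lia.
  rewrite !andbF /= !andbT; case: eqP => _ /=; last by [].
  by case: ifP; lia.
have -> : lam p = 0 by apply/eqP; rewrite eq_le lp0 lp.
by rewrite addr0 !andbF.
Qed.

(** Raising the product of minors ends at a joint highest weight vector. By uniqueness its
    coefficient at the canonical monomial is nonzero, so its component of that weight can be
    normalized. *)
Lemma joint_highest_exists lam : dominant lam -> exists w : Fock, [/\ gl_highest lam w,
  forall i j, i < j -> ghop i j w = 0, w (canonical lam) = 1
  & gh_weight (wtm (canonical lam)) w].
Proof.
move=> dom; have [f [ff fl fc]] := singular_exists dom; have [N fN] := finsup_bounded ff.
have f0 : f != 0 by apply: contraNneq fc => ->.
have [g [gl g0 gh]] := raise_to_joint_highest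
  (fun i j g _ => @gl_highest_ghop _ _ lam i j g) fl f0 fN.
have gc : g (canonical lam) != 0.
  by apply: contraNneq g0 => gc; apply/eqP; exact: joint_highest_eq0 dom gl gh gc.
pose nu := wtm (canonical lam).
exists ((g (canonical lam))^-1 *: wcomp nu g); split.
- have [s w] := gl_highest_wcomp nu gl; split=> [p q pq|p]; rewrite (linearZ_LR (glop _ _)) /=.
    by rewrite s ?scaler0.
  by rewrite w !scalerA mulrC.
- move=> i j ij; rewrite (linearZ_LR (ghop i j)) /= ghop_wcomp gh //.
  rewrite [wcomp _ 0](_ : _ = 0) ?scaler0 //.
  by apply/funext => a; rewrite /wcomp; case: ifP.
- by rewrite fockZ /wcomp asboolT // mulVf.
move=> k; rewrite (linearZ_LR (ghop k k)) /= (@wcomp_weight _ _ nu g).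
by rewrite !scalerA mulrC.
Qed.

End SingularVectors.

(** * Submodules generated by a highest weight vector *)

Section Masks.
Variable R : realType.
Local Notation C := R[i].
Implicit Types (A B : gl_infty R) (P : int -> int -> bool).

Fact mask_subproof P A : (fun i j : int => if P i j then A i j else 0) \in @banded R.
Proof.
have [M AM] := band_exists A; apply/asboolP; exists M => i j ij.
by case: ifP => // _; exact: AM.
Qed.
Definition gl_mask P A : gl_infty R := GlInfty (mask_subproof P A).

Lemma gl_maskE P A i j : gl_mask P A i j = if P i j then A i j else 0.
Proof. by []. Qed.

Lemma gl_diagE (d : int -> C^o) i j : gl_diag d i j = if i == j then d i else 0.
Proof. by []. Qed.

Definition low A := gl_mask (fun i j => j < i) A.
Definition up A := gl_mask (fun i j => i < j) A.

Lemma triangular A (c : C^o) :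
  (A, c) = (low A, 0) + h0_inj (fun i => A i i, c) + (up A, 0) :> ghat R.
Proof.
congr (_, _); rewrite /= ?add0r ?addr0 //.
apply: gl_ext => i j; rewrite !entryD !gl_maskE gl_diagE.
by case: (ltgtP i j) => [_|_|->]; rewrite ?addr0 ?add0r.
Qed.

Lemma up_upper A : strictly_upper (up A).
Proof. by move=> i j ji; rewrite gl_maskE ltNge ji. Qed.

Definition degree_part (r : nat) A := gl_mask (fun i j => i - j == r%:Z) A.

Lemma degree_partE r A i j : degree_part r A i j = if i - j == r%:Z then A i j else 0.
Proof. by []. Qed.

(** Bandedness makes a strictly lower matrix a finite sum of homogeneous ones, on which [degree_op]
    acts by a scalar. *)
Lemma low_sum A M : band M A ->
  low A = \sum_(r <- iota 1 M) degree_part r A.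
Proof.
move=> AM; apply: gl_ext => i j.
have -> : (\sum_(r <- iota 1 M) degree_part r A) i j = \sum_(r <- iota 1 M) degree_part r A i j.
  elim: (iota 1 M) => [|r s IHs]; first by rewrite !big_nil.
  by rewrite !big_cons entryD IHs.
rewrite -[LHS]/(if j < i then A i j else 0); case: ifP => ji; last first.
  rewrite big1_seq // => r /andP[_]; rewrite mem_iota degree_partE => r1.
  by case: eqP => // ?; lia.
have [ijM|ijM] := ltnP M (absz (i - j)).
  by rewrite AM // big1 // => r _; rewrite degree_partE AM // if_same.
rewrite (bigD1_seq (absz (i - j))) ?iota_uniq ?mem_iota //=; last by lia.
rewrite ifT; last by lia.
by rewrite big1 ?addr0 // => r rij; rewrite ifF //; lia.
Qed.

Definition degree_op : ghat R := (gl_diag (fun i => i%:~R), 0).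

Lemma bracket_degree r A :
  bracket degree_op (degree_part r A, 0) = r%:R *: (degree_part r A, 0).
Proof.
have diagB (d : int -> C^o) : band 0 (gl_diag d).
  by move=> i j ij; rewrite gl_diagE; case: eqP => // ijE; move: ij; rewrite ijE subrr.
have dE (d : int -> C^o) i j : gl_diag d i j = (j == i)%:R * d i.
  by rewrite gl_diagE eq_sym; case: eqP; rewrite ?mul1r ?mul0r.
have dmul (d : int -> C^o) B i j : gl_mul (gl_diag d) B i j = d i * B i j.
  rewrite (gl_mulE _ _ (diagB d) (leqnn _)); under eq_bigr do rewrite dE -mulrA.
  by rewrite (sum_window_delta (fun k => d i * B k j)) //; lia.
have muld (d : int -> C^o) B i j : gl_mul B (gl_diag d) i j = B i j * d j.
  have [M BM] := band_exists B.
  rewrite (@gl_mulE _ _ _ M (absz i + absz j + M) _ _ BM); last by lia.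
  under eq_bigr do rewrite dE mulrC -mulrA [j == _]eq_sym.
  by rewrite (sum_window_delta (fun k => d k * B i k)) ?[d j * _]mulrC //; lia.
congr (_, _); last first.
  have b0 : band 0 (gl_diag (fun i => i%:~R)) := diagB _.
  rewrite /= (cocycleE _ b0 (leqnn _)) scaler0 big1 // => i _; rewrite big1 // => j _.
  by rewrite gl_diagE; case: eqP => [->|_]; rewrite ?subrr ?mul0r ?mulr0.
apply: gl_ext => i j; rewrite entryD entryN dmul muld.
rewrite -[RHS]/(r%:R * degree_part r A i j) degree_partE.
case: eqP => [ij|_]; last by rewrite !mulr0 mul0r subr0.
by rewrite [_ * j%:~R]mulrC -mulrBl -rmorphB /= ij.
Qed.

End Masks.

Section HighestWeightVector.
Variables (R : realType) (M : ghat_module R) (L : {scalar (h0 R)}) (z : M).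
Local Notation C := R[i].
Hypothesis z_up : forall A : gl_infty R, strictly_upper A -> act (A, 0) z = 0.
Hypothesis z_h : forall h : h0 R, act (h0_inj h) z = L h *: z.
Implicit Types (u t : M) (x y : ghat R) (A : gl_infty R) (c : C).

Lemma act0 x : act x (0 : M) = 0.
Proof.
by have := act_linear_r x (-1) (0 : M) 0; rewrite scaler0 addr0 scaleN1r addNr.
Qed.

Lemma actZ x c u : act x (c *: u) = c *: act x u.
Proof. by have := act_linear_r x c u 0; rewrite act0 !addr0. Qed.

Lemma actD x u t : act x (u + t) = act x u + act x t.
Proof. by have := act_linear_r x 1 u t; rewrite !scale1r. Qed.

Lemma act0l u : act 0 u = 0.
Proof.
by have := act_linear_l u (-1) 0 0; rewrite scaler0 addr0 scaleN1r addNr.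
Qed.

Lemma actDl x y u : act (x + y) u = act x u + act y u.
Proof. by have := act_linear_l u 1 x y; rewrite !scale1r. Qed.

Lemma actZl c x u : act (c *: x) u = c *: act x u.
Proof. by have := act_linear_l u c x 0; rewrite act0l !addr0. Qed.

(** The submodule generated by [z]. Allowing only strictly lower matrices simplifies inductions; by
    the triangular decomposition it is stable under all of ghat. *)
Inductive gen : M -> Prop :=
| gen_vec : gen z
| gen_linear c u t : gen u -> gen t -> gen (c *: u + t)
| gen_low A u : gen u -> gen (act (low A, 0) u).

Lemma gen0 : gen 0.
Proof. by rewrite -[0](addNr z) -scaleN1r; apply: gen_linear; exact: gen_vec. Qed.

Lemma genD u t : gen u -> gen t -> gen (u + t).
Proof. by rewrite -{2}[u]scale1r; exact: gen_linear. Qed.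

Lemma genZ c u : gen u -> gen (c *: u).
Proof. by move=> gu; rewrite -[_ *: _]addr0; apply: gen_linear => //; exact: gen0. Qed.

Lemma gen_act x u : gen u -> gen (act x u).
Proof.
move=> gu; elim: gu x => [|c u' t _ IHu _ IHt|A u' _ IHu] x.
- case: x => A c; rewrite triangular !actDl z_h (z_up (@up_upper _ A)) addr0.
  by apply: genD; [apply: gen_low|apply: genZ]; exact: gen_vec.
- by rewrite actD actZ; apply: gen_linear.
have := act_bracket x (low A, 0) u' => /eqP; rewrite eq_sym subr_eq => /eqP ->.
by apply: genD; [exact: IHu|apply: gen_low].
Qed.

End HighestWeightVector.

(** * Separating a highest weight vector from the rest by the degree operator *)

Section LowerPart.
Variables (R : realType) (d : R[i]).
Local Notation C := R[i].
Local Notation D := (degree_op R).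

(* Sums of eigenvectors of D for eigenvalues d + r with r > 0. *)
Inductive lower (M : ghat_module R) : M -> Prop :=
| lower0 : lower 0
| lower_add (r : nat) u t : lower u -> act D t = (d + r.+1%:R) *: t -> lower (u + t).

Section Module.
Variable M : ghat_module R.
Implicit Types (u t : M) (c : C).

Lemma lowerD u t : lower u -> lower t -> lower (u + t).
Proof.
move=> lu; elim=> [|r t' s' _ IHt E]; first by rewrite addr0.
by rewrite addrA; apply: lower_add E.
Qed.

Lemma lowerZ c u : lower u -> lower (c *: u).
Proof.
elim=> [|r u' t _ IHu E]; first by rewrite scaler0; exact: lower0.
rewrite scalerDr; apply: (@lower_add _ r) => //.
by rewrite actZ E !scalerA mulrC.
Qed.

Lemma lower_eigen r t : act D t = (d + r.+1%:R) *: t -> lower t.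
Proof. by move=> E; rewrite -[t]add0r; apply: lower_add E; exact: lower0. Qed.

Lemma lower_act_eigen A (r : nat) t : act D t = (d + r%:R) *: t -> lower (act (low A, 0) t).
Proof.
move=> E; have [N AN] := band_exists A; rewrite (low_sum AN).
have -> : (\sum_(s <- iota 1 N) degree_part s A, 0) =
    \sum_(s <- iota 1 N) (degree_part s A, 0) :> ghat R.
  elim: (iota 1 N) => [|s l IH]; first by rewrite !big_nil.
  by rewrite !big_cons -IH; congr (_, _); rewrite /= addr0.
have : {in iota 1 N, forall s, (0 < s)%N} by move=> s; rewrite mem_iota => /andP[].
elim: (iota 1 N) => [|s l IH] pos; first by rewrite big_nil act0l; exact: lower0.
rewrite big_cons actDl; apply: lowerD; last first.
  by apply: IH => s' s'l; apply: pos; rewrite inE s'l orbT.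
(* [lower] counts the shifts of the eigenvalue from 1, and [s] is positive. *)
apply: (@lower_eigen (r + s).-1).
have := act_bracket D (degree_part s A, 0) t; rewrite bracket_degree actZl E actZ => /eqP.
rewrite eq_sym subr_eq -scalerDl => /eqP ->; congr (_ *: _).
have := pos s (mem_head _ _); case: s {pos} => // s _.
by rewrite addnS /= -addnS natrD addrC addrA.
Qed.

Lemma lower_act A u : lower u -> lower (act (low A, 0) u).
Proof.
elim=> [|r u' t _ IHu E]; first by rewrite act0; exact: lower0.
by rewrite actD; apply: lowerD => //; exact: lower_act_eigen E.
Qed.

Lemma gen_lower z u : act D z = d *: z -> gen z u -> exists c, lower (u - c *: z).
Proof.
move=> zD; elim=> [|c u' t _ [c1 l1] _ [c2 l2]|A u' _ [c l]].
- by exists 1; rewrite scale1r subrr; exact: lower0.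
- exists (c * c1 + c2); rewrite scalerDl -scalerA opprD addrACA -scalerBr.
  by apply: lowerD => //; exact: lowerZ.
exists 0; rewrite scale0r subr0 -[u'](subrK (c *: z)) actD; apply: lowerD.
  exact: lower_act.
by apply: (@lower_act_eigen _ 0%N); rewrite addr0 actZ zD !scalerA mulrC.
Qed.

Let shift_op (r : nat) u := act D u - (d + r.+1%:R) *: u.

Let shift_opZ r c u : shift_op r (c *: u) = c *: shift_op r u.
Proof. by rewrite /shift_op actZ scalerBr !scalerA [_ * c]mulrC. Qed.

Let shift_opD r u t : shift_op r (u + t) = shift_op r u + shift_op r t.
Proof. by rewrite /shift_op actD scalerDr opprD addrACA. Qed.

Let shift_ops rs u := foldr shift_op u rs.

Let shift_opsD rs u t : shift_ops rs (u + t) = shift_ops rs u + shift_ops rs t.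
Proof. by elim: rs => //= r rs ->; rewrite shift_opD. Qed.

Let shift_ops_eigen rs x u : act D u = x *: u ->
  shift_ops rs u = (\prod_(r <- rs) (x - (d + r.+1%:R))) *: u.
Proof.
move=> E; elim: rs => [|r rs IH] /=; first by rewrite big_nil scale1r.
by rewrite IH shift_opZ /shift_op E -scalerBl scalerA big_cons mulrC.
Qed.

(* Products of D - (d + r) with r > 0 kill the lower part, not the eigenvalue d. *)
Lemma lower_top u : act D u = d *: u -> lower u -> u = 0.
Proof.
move=> E l; have [rs rs0] : exists rs, shift_ops rs u = 0.
  elim: l => [|r t s _ [rs rs0] Es]; first by exists [::].
  exists (r :: rs); rewrite /= shift_opsD rs0 add0r (shift_ops_eigen _ Es).
  by rewrite shift_opZ /shift_op Es subrr scaler0.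
move: rs0; rewrite (shift_ops_eigen _ E) => /eqP; rewrite scaler_eq0 => /orP[|/eqP //].
rewrite prodf_seq_eq0 => /hasP[r _]; rewrite opprD addNKr oppr_eq0.
by rewrite pnatr_eq0.
Qed.

End Module.

Lemma lower_map (M N : ghat_module R) (h : M -> N) : linear h ->
  (forall x u, h (act x u) = act x (h u)) -> forall u, lower u -> lower (h u).
Proof.
move=> hl ha u.
have h0 : h 0 = 0 by have := hl (-1) 0 0; rewrite scaler0 addr0 scaleN1r addNr.
have hZ c t : h (c *: t) = c *: h t by have := hl c t 0; rewrite h0 !addr0.
elim=> [|r t s _ IH E]; first by rewrite h0; exact: lower0.
have := hl 1 t s; rewrite !scale1r => ->; apply: (@lower_add _ r) => //.
by rewrite -ha E hZ.
Qed.

End LowerPart.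

Section OrthogonalProjection.
Variables (K : numClosedFieldType) (I : choiceType).
Local Notation Fock := (fock K I).
Implicit Types (f g y : Fock) (Y : set Fock) (D : {fset {cmonom I}}).

Lemma form_subl f g h : finsup h -> form (f - g) h = form f h - form g h.
Proof.
move=> hs; have := form_linear (-1) g f hs.
by rewrite scaleN1r [- g + f]addrC mulN1r [- _ + _]addrC.
Qed.

(** Gram-Schmidt by induction on [D]: the elements of [Y] vanishing at [a] form a hyperplane [Y'],
    and [y1], the part of [y0] orthogonal to [Y'], spans a complement. *)
Lemma orthogonal_projection Y D f : Y 0 ->
  (forall c y y', Y y -> Y y' -> Y (c *: y + y')) -> (forall y, Y y -> supp_in D y) ->
  finsup f -> exists2 y, Y y & forall g, Y g -> form (f - y) g = 0.
Proof.
have [N] := ubnP #|` D|; elim: N D Y f => // N IHN D Y f DN Y0 Yl YD ff.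
have [[a [y0 [Yy0 y0a]]]|nY] := pselect (exists a y, Y y /\ y a != 0); last first.
  exists 0 => // g Yg; suff -> : g = 0.
    by rewrite /form fsbig1 // => a _; rewrite conjC0 mulr0 mul0r.
  apply/funext => a; apply: contrapT => /eqP ga; apply: nY.
  by exists a, g.
have aD : a \in D by apply: contraNT y0a => /(YD _ Yy0) ->.
pose Y' g := Y g /\ g a = 0.
have {}DN : (#|` (D `\ a)%fset| < N)%N.
  by move: DN; rewrite [in X in X -> _](cardfsD1 a) aD add1n.
have Y'0 : Y' 0 by [].
have Y'l c y y' : Y' y -> Y' y' -> Y' (c *: y + y').
  by move=> [Yy ya] [Yy' ya']; split; [exact: Yl|rewrite fockD fockZ ya ya' mulr0 addr0].
have Y'D y : Y' y -> supp_in (D `\ a)%fset y.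
  move=> [Yy ya] b; rewrite in_fsetD1 negb_and negbK => /orP[/eqP -> //|].
  exact: YD Yy b.
have fin y : Y y -> finsup y by move=> Yy; exists D; exact: YD.
have [p [Yp pa] pO] := IHN _ Y' y0 DN Y'0 Y'l Y'D (fin _ Yy0).
have [q [Yq qa] qO] := IHN _ Y' f DN Y'0 Y'l Y'D ff.
pose y1 := y0 - p.
have YN y : Y y -> Y (- y) by move=> Yy; rewrite -scaleN1r -[_ *: _]addr0; exact: Yl.
have YA y y' : Y y -> Y y' -> Y (y + y').
  by move=> Yy Yy'; rewrite -[y]scale1r; exact: Yl.
have Yy1 : Y y1 by apply: YA => //; exact: YN.
have y1a : y1 a != 0 by rewrite /y1 fockB pa subr0.
have y10 : form y1 y1 != 0.
  apply: contraNneq y1a => E.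
  by rewrite (form_eq0 (fin _ Yy1) E).
pose t := form f y1 / form y1 y1.
have fq : form q y1 = 0.
  rewrite form_conj; last exact: fin.
  by rewrite (pO q) ?conjC0.
have y1Y' g : Y' g -> form y1 g = 0 by exact: pO.
exists (t *: y1 + q) => [|g Yg]; first exact: Yl.
have [g' Yg' gE] : exists2 g', Y' g' & g = (g a / y1 a) *: y1 + g'.
  exists (g - (g a / y1 a) *: y1); last by rewrite addrC subrK.
  split; last by rewrite fockB fockZ divfK // subrr.
  by rewrite addrC -scaleNr; exact: Yl.
have fsub : finsup (f - (t *: y1 + q)).
  rewrite addrC -scaleN1r; apply: finsup_linear => //; apply: fin; exact: Yl.
rewrite gE form_linearr // !form_subl ?form_linear; try by apply: fin => //; case: Yg'.
rewrite fq addr0 divfK // subrr mulr0 add0r y1Y' // mulr0 add0r.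
by rewrite -form_subl ?qO //; apply: fin; case: Yg'.
Qed.

End OrthogonalProjection.

(** * Realization of the irreducible module *)

Section ProductModule.
Variables (R : realType) (M N : ghat_module R).
Local Notation C := R[i].

Definition prod_act (x : ghat R) (u : (M * N)%type) : (M * N)%type := (act x u.1, act x u.2).

Fact prod_act_linear_l u : linear (prod_act^~ u).
Proof. by move=> c x y; congr (_, _); rewrite act_linear_l. Qed.
Fact prod_act_linear_r x : linear (prod_act x).
Proof. by move=> c u t; congr (_, _); rewrite act_linear_r. Qed.
Fact prod_act_bracket x y u :
  prod_act (bracket x y) u = prod_act x (prod_act y u) - prod_act y (prod_act x u).
Proof. by congr (_, _); rewrite act_bracket. Qed.

Definition prod_module : ghat_module R :=
  GhatModule prod_act_linear_l prod_act_linear_r prod_act_bracket.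

End ProductModule.

Section FockModule.
Variables (R : realType) (n : nat).
Local Notation C := R[i].
Local Notation I := (int * 'I_n)%type.
Local Notation Fock := (fock C I).
Implicit Types (f g : Fock) (A : gl_infty R) (i j k : int) (a : {cmonom I}).

Definition fock_module : ghat_module R :=
  GhatModule (@gact_linear_l R n) (@gact_linear_r R n) (@gact_bracket R n).

Lemma gact_elem i j f : gact (gl_elem R i j, 0) f = ghop i j f.
Proof.
have eE k l : gl_elem R i j k l = ((k == i) && (l == j))%:R.
  by rewrite -[LHS]/(if _ then _ else _); case: ifP.
apply/funext => a; have [M AM] := band_exists (gl_elem R i j).
have [N aN] := within_window_exists a.
rewrite (@gactE _ _ _ _ _ _ M N (N + M + absz i + absz j) AM aN); last by lia.
rewrite mulr0 scale0r subr0 ghsumE.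
under eq_bigr do under eq_bigr do rewrite eE -mulnb natrM -mulrA.
under eq_bigr do rewrite -mulr_sumr.
rewrite (sum_window_delta (fun k => \sum_(l <- _) (l == j)%:R * ghop k l f a)); last by lia.
by rewrite (sum_window_delta (fun l => ghop i l f a)) //; lia.
Qed.

Lemma gact_upper A f : (forall i j, i < j -> ghop i j f = 0) ->
  strictly_upper A -> gact (A, 0) f = 0.
Proof.
move=> fh AU; apply/funext => a; have [M AM] := band_exists A.
have [N aN] := within_window_exists a.
rewrite (gactE _ _ AM aN (leqnn _)) mulr0 scale0r subr0 ghsumE big1 // => i _.
rewrite big1 // => j _; have [ij|ji] := ltP i j; first by rewrite fh // mulr0.
by rewrite AU ?mul0r.
Qed.

Lemma wtm_canonical (lam : 'I_n -> int) k : wtm (canonical lam) k =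
  \sum_(p < n) ((k == p.+1%:Z)%:Z * ((0 < lam p)%R%:Z * lam p) +
                (k == p.+1%:Z - n%:Z)%:Z * ((lam p < 0)%R%:Z * lam p)).
Proof.
rewrite /wtm -[Posz (\sum_p _)]natz natr_sum mulr_sumr; apply: eq_bigr => p _.
rewrite canonicalE /canonical_exp /= !xpair_eqE eqxx !andbT natz /sgcol.
have pn := ltn_ord p; have [->|kx] := eqVneq k p.+1%:Z.
  have -> : (p.+1%:Z == p.+1%:Z - n%:Z) = false by lia.
  by rewrite orbF /=; case: ifP => /=; lia.
have [->|ky] := eqVneq k (p.+1%:Z - n%:Z); last by rewrite /=; lia.
by rewrite /=; case: ifP; case: ifP => /=; lia.
Qed.

(** Lambda(lam) is the weight of the canonical monomial on diagonal matrices, and -n on K. *)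
Lemma gact_cartan (lam : 'I_n -> int) (h : h0 R) f : gh_weight (wtm (canonical lam)) f ->
  gact (h0_inj h) f = Lambda R lam h *: f.
Proof.
case: h => d c wf; apply/funext => a; rewrite /h0_inj /=.
have [M AM] := band_exists (gl_diag d).
have [N aN] := within_window_exists a.
(* The last summand brings all rows [p.+1] and [p.+1 - n] into the window. *)
pose N' := (N + M + n.*2.+1)%N.
rewrite (@gactE _ _ _ _ _ _ M N N' AM aN); last by rewrite /N' leq_addr.
rewrite fockB !fockZ ghsumE.
transitivity ((\sum_(i <- window N') (wtm (canonical lam) i)%:~R * d i - n%:R * c) * f a).
  rewrite mulrBl mulr_suml; congr (_ - _).
  apply: eq_big_seq => i; rewrite mem_window => iN.
  transitivity (\sum_(j <- window N') (j == i)%:R * (d i * ghop i j f a)).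
    apply: eq_bigr => j _; rewrite gl_diagE eq_sym.
    by case: eqP => _; rewrite ?mul1r ?mul0r.
  by rewrite (sum_window_delta (fun j => d i * ghop i j f a)) // wf fockZ mulrA [d i * _]mulrC.
congr (_ * _); rewrite -[RHS]/(- n%:R * (c : C)
  + \sum_(i < n | 0 < lam i) (lam i)%:~R * (d (i.+1)%:Z : C)
  + \sum_(i < n | lam i < 0) (lam i)%:~R * (d ((i.+1)%:Z - n%:Z) : C)).
rewrite addrC mulNr -addrA; congr (_ + _).
pose G (b : 'I_n -> bool) p : C := (b p)%:R * (lam p)%:~R.
transitivity (\sum_(i <- window N') \sum_(p < n)
   ((i == p.+1%:Z)%:R * (G (fun p => 0 < lam p) p * d i) +
    (i == p.+1%:Z - n%:Z)%:R * (G (fun p => lam p < 0) p * d i))).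
  apply: eq_bigr => i _; rewrite wtm_canonical rmorph_sum mulr_suml.
  by apply: eq_bigr => p _ /=; rewrite rmorphD !rmorphM /= mulrDl !mulrA.
rewrite exchange_big /= [in RHS]big_mkcond [X in _ = _ + X]big_mkcond -big_split.
apply: eq_bigr => p _; have pn := ltn_ord p; rewrite big_split /=.
rewrite (sum_window_delta (fun i => G (fun p => 0 < lam p) p * d i)); last by rewrite /N'; lia.
rewrite (sum_window_delta (fun i => G (fun p => lam p < 0) p * d i)); last by rewrite /N'; lia.
by rewrite /G; case: ltP => _; case: ltP => _; rewrite ?mul1r ?mul0r.
Qed.

End FockModule.

(** * The isomorphism of V with a space of gl_n-singular vectors *)

Section Realization.
Variables (R : realType) (n : nat) (lam : 'I_n -> int).
Local Notation C := R[i].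
Local Notation I := (int * 'I_n)%type.
Local Notation Fock := (fock C I).
Local Notation L := (Lambda R lam).
Local Notation FM := (fock_module R n).
Implicit Types (f g : Fock) (A : gl_infty R) (i j k : int) (a : {cmonom I}).

Variables (V : ghat_module R) (v : V).
Hypothesis lam_dom : dominant lam.
Hypothesis V_irr : irreducible V.
Hypothesis v_hw : highest_weight_vector L v.

Variable w : Fock.
Hypothesis w_gl : gl_highest lam w.
Hypothesis w_gh : forall i j, i < j -> ghop i j w = 0.
Hypothesis w_c : w (canonical lam) = 1.
Hypothesis w_wt : gh_weight (wtm (canonical lam)) w.

Let M : ghat_module R := prod_module V FM.
Let vw : M := (v, w).

(* This relation will be the graph of an isomorphism of V onto its image. *)
Definition graph (u : V) f : Prop := @gen R M vw (u, f).

Let vw_up A : strictly_upper A -> act (A, 0) vw = 0.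
Proof.
move=> AU; have [_ vu _] := v_hw.
by apply: (congr2 pair); [exact: vu|exact: gact_upper].
Qed.

Let vw_h (h : h0 R) : act (h0_inj h) vw = L h *: vw.
Proof. by have [_ _ vh] := v_hw; apply: (congr2 pair); [exact: vh|exact: gact_cartan]. Qed.

Lemma graph_act x u f : graph u f -> graph (act x u) (gact x f).
Proof. exact: (gen_act vw_up vw_h). Qed.

Lemma graph_linear (c : C) u f u' f' :
  graph u f -> graph u' f' -> graph (c *: u + u') (c *: f + f').
Proof. exact: gen_linear. Qed.

Lemma graph0 : graph 0 0. Proof. exact: gen0. Qed.

Lemma graphB u f u' f' : graph u f -> graph u' f' -> graph (u - u') (f - f').
Proof.
move=> G G'; have := graph_linear (-1) G' G.
by rewrite !scaleN1r [- u' + _]addrC [- f' + _]addrC.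
Qed.

Lemma graphZ (c : C) u f : graph u f -> graph (c *: u) (c *: f).
Proof. by move=> G; have := graph_linear c G graph0; rewrite !addr0. Qed.

Lemma graph_vw : graph v w. Proof. exact: gen_vec. Qed.

Let w_neq0 : w != 0.
Proof. by apply: contraTneq (oner_neq0 C) => w0; rewrite -w_c w0 fock0 eqxx. Qed.

(** Modulo lower terms (0, w) would be c (v, w). The first component shows that - c v is lower,
    hence c = 0; then w itself is lower, hence 0. *)
Lemma graph_0w : ~ graph 0 w.
Proof.
move=> G; have [v0 _ _] := v_hw; set d := L (fun i => i%:~R, 0).
have vwD : act (degree_op R) vw = d *: vw by exact: (vw_h (fun i => i%:~R, 0)).
have [c l] := gen_lower vwD G.
have lV : lower d (- (c *: v)).
  have := @lower_map _ _ M V fst (fun _ _ _ => erefl) (fun _ _ => erefl) _ l.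
  by rewrite /= sub0r.
have lF : lower d ((w - c *: w) : FM).
  exact: (@lower_map _ _ M FM snd (fun _ _ _ => erefl) (fun _ _ => erefl) _ l).
have vD : act (degree_op R) v = d *: v by exact: (congr1 fst vwD).
have wD : act (degree_op R) (w : FM) = d *: w by exact: (congr1 snd vwD).
have : - (c *: v) = 0.
  by apply: lower_top lV; rewrite -scaleNr actZ vD !scalerA mulrC.
move/eqP; rewrite oppr_eq0 scaler_eq0 => /orP[/eqP c0|/eqP //].
rewrite c0 scale0r subr0 in lF; case/eqP: w_neq0.
exact: lower_top lF.
Qed.

Lemma graph_total u : exists f, graph u f.
Proof.
have [_ irr] := V_irr; have [v0 _ _] := v_hw; pose U := [set t | exists f, graph t f].
have [||E] := irr U.
- split=> [|c t t' [f G] [f' G']|x t [f G]].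
  + by exists 0; exact: graph0.
  + by exists (c *: f + f'); exact: graph_linear.
  by exists (gact x f); exact: graph_act.
- move=> E; have : U v by exists w; exact: graph_vw.
  by rewrite E.
by have : U u by rewrite E.
Qed.

Lemma graph_highest u f : graph u f -> gl_highest lam f /\ exists N, bounded N f.
Proof.
have aux (t : M) : gen vw t -> gl_highest lam t.2 /\ exists N, bounded N (t.2 : Fock).
  elim=> [|c x y _ [xl [N xN]] _ [yl [N' yN']]|A x _ [xl [N xN]]].
  - by split=> //; apply: finsup_bounded; exact: gh_weight_finsup w_wt.
  - split; first exact: gl_highest_linear.
    exists (maxn N N') => a; rewrite geq_max => /andP[aN aN'].
    rewrite -[LHS]/(c * (x.2 : Fock) a + (y.2 : Fock) a).
    by rewrite xN // yN' // mulr0 addr0.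
  - split; first exact: gl_highest_gact.
    exact: bounded_gact xN.
by move/aux.
Qed.

Lemma joint_highest_scale f : gl_highest lam f -> (forall i j, i < j -> ghop i j f = 0) ->
  f = f (canonical lam) *: w.
Proof.
move=> fl fh; set c := f _.
suff : - c *: w + f = 0.
  by move=> E; rewrite -[LHS](addKr (- c *: w)) E addr0 scaleNr opprK.
apply: (joint_highest_eq0 lam_dom); first exact: gl_highest_linear.
- by move=> i j ij; rewrite (ghop_linear i) fh // w_gh // scaler0 addr0.
by rewrite fockD fockZ w_c mulr1 /c addNr.
Qed.

(** A nonzero f with (0, f) in the graph could be raised, inside the graph, to a nonzero multiple of
    (0, w). *)
Lemma graph0r f : graph 0 f -> f = 0.
Proof.
move=> G; apply: contrapT => /eqP f0; have [fl [N fN]] := graph_highest G.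
pose P := [set g | graph 0 g].
have Pgh i j g : i < j -> P g -> P (ghop i j g).
  by move=> _ /(graph_act (gl_elem R i j, 0)); rewrite gact_elem act0.
have [g [Pg g0 gh]] := raise_to_joint_highest Pgh G f0 fN.
have gE := joint_highest_scale (graph_highest Pg).1 gh.
have gc : g (canonical lam) != 0 by apply: contraNneq g0 => E; rewrite gE E scale0r.
apply: graph_0w; have := graphZ (g (canonical lam))^-1 Pg.
by rewrite scaler0 [X in graph 0 (_ *: X)]gE scalerA mulVf // scale1r.
Qed.

Lemma graph0l u : graph u 0 -> u = 0.
Proof.
move=> Gu; have [_ irr] := V_irr; pose U := [set t | graph t 0].
have [||E] := irr U.
- split=> [|c t t' G G'|x t G]; first exact: graph0.
  + by have := graph_linear c G G'; rewrite scaler0 addr0.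
  by have := graph_act x G; rewrite gact0.
- by move=> E; have : U u by []; rewrite E.
have : U v by rewrite E.
move=> Gv; case: graph_0w; have := graphB graph_vw Gv.
by rewrite subrr subr0.
Qed.

Lemma graph_funr u f f' : graph u f -> graph u f' -> f = f'.
Proof.
move=> G G'; apply/eqP; rewrite -subr_eq0; apply/eqP/graph0r.
by rewrite -(subrr u); exact: graphB.
Qed.

Lemma graph_funl u u' f : graph u f -> graph u' f -> u = u'.
Proof.
move=> G G'; apply/eqP; rewrite -subr_eq0; apply/eqP/graph0l.
by rewrite -(subrr f); exact: graphB.
Qed.

Let image f := exists u, graph u f.

Let image_ghop i j f : image f -> image (ghop i j f).
Proof.
move=> [u G]; exists (act (gl_elem R i j, 0) u); rewrite -gact_elem.
exact: graph_act.
Qed.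

(** The adjoint of a raising operator preserves the image, so raised vectors are again orthogonal to
    it and vanish by induction. Then f is a multiple of w, lies in the image, and is orthogonal to
    itself. *)
Lemma orthogonal_image N nu f : bounded N f -> gl_highest lam f -> gh_weight nu f ->
  (forall g, image g -> gh_weight nu g -> form f g = 0) -> f = 0.
Proof.
elim: N nu f => [|N IHN] nu f fN fl fw fO; first by apply/funext => a; rewrite fN.
have fh i j : i < j -> ghop i j f = 0.
  move=> ij; apply: (IHN (fun k => nu k + (k == i)%:Z - (k == j)%:Z)).
  - exact: bounded_ghop_raise.
  - exact: gl_highest_ghop.
  - exact: gh_weight_ghop.
  move=> g Ug gw; rewrite form_ghop; [|exact: gh_weight_finsup fw|exact: gh_weight_finsup gw].
  rewrite fO ?mulr0 //; first exact: image_ghop.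
  have := gh_weight_ghop j i gw; congr gh_weight; apply/funext => k.
  by rewrite subrK addrK.
apply: form_eq0; first exact: gh_weight_finsup fw.
apply: fO fw; rewrite (joint_highest_scale fl fh).
by exists (f (canonical lam) *: v); apply: graphZ; exact: graph_vw.
Qed.

Lemma graph_onto nu f : gl_highest lam f -> gh_weight nu f -> exists u, graph u f.
Proof.
move=> fl fw; pose Y := [set g | image g /\ gh_weight nu g].
have Y0 : Y 0.
  split; first by exists 0; exact: graph0.
  by move=> k; rewrite (linear0 (ghop k k)) scaler0.
have Yl c y y' : Y y -> Y y' -> Y (c *: y + y').
  move=> [[u G] yw] [[u' G'] yw']; split; first by exists (c *: u + u'); exact: graph_linear.
  exact: gh_weight_linear.
have YD y : Y y -> supp_in (ghfset n nu) y by move=> [_ /gh_weightP].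
have [y [[u G] yw] yO] := orthogonal_projection Y0 Yl YD (gh_weight_finsup fw).
exists u; suff /eqP : f - y = 0 by rewrite subr_eq0 => /eqP ->.
have fyE : f - y = (-1) *: y + f by rewrite scaleN1r addrC.
have fyw : gh_weight nu (f - y) by rewrite fyE; exact: gh_weight_linear.
have [N fyN] := finsup_bounded (gh_weight_finsup fyw).
apply: (orthogonal_image fyN _ fyw) => [|g Ug gw]; last exact: yO.
by rewrite fyE; apply: gl_highest_linear => //; exact: (graph_highest G).1.
Qed.

Lemma graph_weight (mu : int -> int) u f : graph u f ->
  weight_space (fun k => (mu k)%:~R) u <-> gh_weight mu f.
Proof.
move=> G; split=> H k.
  have := graph_act (gl_elem R k k, 0) G; rewrite H gact_elem => E.
  exact: graph_funr E (graphZ _ G).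
have := graph_act (gl_elem R k k, 0) G; rewrite gact_elem H => E.
exact: graph_funl E (graphZ _ G).
Qed.

End Realization.

(** * Dimensions of weight spaces *)

Section Bases.
Variables (R : realType) (V : lmodType R[i]) (U : set V).

Lemma finite_basis_leq d d' : finite_basis U d -> finite_basis U d' -> (d <= d')%N.
Proof.
move=> [b [Ub bfree _]] [b' [_ _ bgen]].
have [c cE] := choice (fun i => bgen _ (Ub i)).
pose A := \matrix_(i, j) c i j.
suff : row_free A by move=> /eqP <-; exact: rank_leq_col.
apply: inj_row_free => u uA; apply/rowP => i; rewrite mxE; move: i; apply: bfree.
transitivity (\sum_j (u *m A) 0 j *: b' j).
  under eq_bigr do rewrite cE scaler_sumr.
  rewrite exchange_big; apply: eq_bigr => j _; rewrite mxE scaler_suml.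
  by apply: eq_bigr => i _; rewrite mxE scalerA.
by rewrite uA big1 // => j _; rewrite mxE scale0r.
Qed.

Lemma dimensionE d : finite_basis U d -> dimension U = d.
Proof.
move=> Ud; apply: xget_unique => // d' Ud'.
by apply/eqP; rewrite eqn_leq !finite_basis_leq.
Qed.

End Bases.

Section WeightSpaceDimension.
Variables (K : numClosedFieldType) (n : nat) (nu : int -> int) (lam : 'I_n -> int).
Local Notation I := (int * 'I_n)%type.
Local Notation Fock := (fock K I).
Implicit Types (f g : Fock) (a : {cmonom I}) (p q : 'I_n).

Let D : seq {cmonom I} := ghfset n nu.
Let N := size D.
Let am (i : 'I_N) : {cmonom I} := nth mone D i.

Let amI : injective am.
Proof. by move=> i j /eqP; rewrite nth_uniq ?fset_uniq // => /eqP/val_inj. Qed.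

Let delta (i : 'I_N) : Fock := fun a => (a == am i)%:R.
Definition vec_fock (u : 'rV[K]_N) : Fock := \sum_i u 0 i *: delta i.

Lemma vec_fock_linear : linear vec_fock.
Proof.
move=> c u t; rewrite /vec_fock scaler_sumr -big_split; apply: eq_bigr => i _.
by rewrite !mxE scalerDl scalerA.
Qed.

Let vec_fock_am u i : vec_fock u (am i) = u 0 i.
Proof.
rewrite /vec_fock fock_sum (bigD1 i) //= fockZ /delta eqxx mulr1 big1 ?addr0 // => j ji.
by rewrite fockZ (inj_eq amI) eq_sym (negPf ji) mulr0.
Qed.

Lemma vec_fock_inj : injective vec_fock.
Proof. by move=> u t E; apply/rowP => i; rewrite -!vec_fock_am E. Qed.

Lemma vec_fock_weight u : gh_weight nu (vec_fock u).
Proof.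
apply/gh_weightP => a aD; rewrite /vec_fock fock_sum big1 // => i _; rewrite fockZ /delta.
case: eqP => [ai|_]; last by rewrite mulr0.
by case/negP: aD; rewrite ai; exact: mem_nth.
Qed.

Let vec_fockK f : gh_weight nu f -> vec_fock (\row_i f (am i)) = f.
Proof.
move=> /gh_weightP fD; apply/funext => a; have [aD|aD] := boolP (a \in ghfset n nu).
  have iN : (index a D < N)%N by rewrite index_mem.
  have -> : a = am (Ordinal iN) by rewrite /am nth_index.
  by rewrite vec_fock_am mxE.
by rewrite fD //; have /gh_weightP -> := vec_fock_weight (\row_i f (am i)).
Qed.

Lemma vec_fock_onto f : gh_weight nu f -> exists u, f = vec_fock u.
Proof. by move=> fw; exists (\row_i f (am i)); rewrite vec_fockK. Qed.

Let rho p q : 'M[K]_N := \matrix_(i, j) glop p q (delta i) (am j).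

Let vec_fock_rho u p q : vec_fock (u *m rho p q) = glop p q (vec_fock u).
Proof.
rewrite -[RHS]vec_fockK; last by apply: glop_gh_weight; exact: vec_fock_weight.
congr vec_fock; apply/rowP => j; rewrite !mxE [in RHS]/vec_fock (linear_sum (glop p q)).
rewrite fock_sum; apply: eq_bigr => i _.
by rewrite (linearZ_LR (glop p q)) /= fockZ mxE.
Qed.

Lemma vec_fock0 : vec_fock 0 = 0.
Proof. by rewrite /vec_fock big1 // => i _; rewrite mxE scale0r. Qed.

Let vec_fockZ c u : vec_fock (c *: u) = c *: vec_fock u.
Proof. by have := vec_fock_linear c u 0; rewrite vec_fock0 !addr0. Qed.

Let rho_singular mu u : gl_singular rho mu u <-> gl_highest mu (vec_fock u).
Proof.
split=> -[s w]; split=> [p q pq|p].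
- by rewrite -vec_fock_rho s // vec_fock0.
- by rewrite -vec_fock_rho w vec_fockZ.
- by apply: vec_fock_inj; rewrite vec_fock_rho s // vec_fock0.
by apply: vec_fock_inj; rewrite vec_fock_rho w vec_fockZ.
Qed.

Definition charge_count (kappa : 'I_n -> int) : nat :=
  count (fun a => [forall p, charge a p == kappa p]) (ghfset n nu).

Lemma gl_highest_rank : dominant lam -> exists S : 'M[K]_N,
  (forall u, (u <= S)%MS <-> gl_highest lam (vec_fock u)) /\
  (\rank S)%:Z = \sum_(w : 'S_n) (-1) ^+ w *
    (charge_count (fun p => lam p - p%:Z + (w p)%:Z))%:Z.
Proof.
move=> dom; have [|||S [SP rS]] := @rank_gl_singular K n N rho (fun i => charge (am i)) lam _ _ _ dom.
- move=> p i j; rewrite mxE glop_diag /delta (inj_eq amI) [j == i]eq_sym.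
  by case: eqP => [->|_]; rewrite ?mulr1 ?mulr0.
- move=> p q r s; apply/row_matrixP => i; rewrite !rowE; apply: vec_fock_inj.
  rewrite mulmxBr !mulmxA mulmxBr -!scalemxAr.
  have vB x y : vec_fock (x - y) = vec_fock x - vec_fock y.
    by rewrite addrC -scaleN1r vec_fock_linear scaleN1r addrC.
  by rewrite !vB !vec_fockZ !vec_fock_rho glop_comm.
(* The weights of singular vectors are dominant by the positivity of the Fischer form. *)
- move=> mu u u0 /rho_singular us; apply: (gl_highest_dominant (@vec_fock_weight u)) us.
  by apply: contraNneq u0 => E; apply/eqP/vec_fock_inj; rewrite E vec_fock0.
exists S; split=> [u|]; first by rewrite SP rho_singular.
rewrite rS; apply: eq_bigr => w _; congr (_ * _%:Z).
by rewrite /charge_count -sum1_count (big_nth mone) big_mkord -sum1dep_card.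
Qed.

End WeightSpaceDimension.

Section Character.
Variables (R : realType) (n : nat) (lam : 'I_n -> int) (V : ghat_module R).
Local Notation C := R[i].

Lemma ch_L0 m : dominant lam -> is_L0 (Lambda R lam) V ->
  ch V m = \sum_(w : 'S_n) (-1) ^+ w *
    (charge_count (monomial_weight m) (fun p => lam p - p%:Z + (w p)%:Z))%:Z.
Proof.
move=> dom [irr [v v_hw _]]; have [w [w_gl w_gh w_c w_wt]] := joint_highest_exists C dom.
set nu := monomial_weight m; have [S [SP <-]] := gl_highest_rank C nu dom.
rewrite /ch; congr (_%:Z); apply: dimensionE.
have hw := vec_fock_weight.
have onto (u : 'rV[C]_(size (ghfset n nu))) : (u <= S)%MS -> exists t, graph v w t (vec_fock u).
  move=> /SP us; exact: (graph_onto dom v_hw w_gl w_gh w_c w_wt us (@vec_fock_weight _ _ nu u)).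
have rb i : (row i (row_base S) <= S)%MS.
  by rewrite -(eq_row_base S); exact: row_sub.
(* A basis of the singular vectors of the given ghat-weight is transported along the graph to the
   weight space of V. *)
have [b bE] := choice (fun i => onto _ (rb i)).
have sumE (c : 'I_(\rank S) -> C) :
    graph v w (\sum_i c i *: b i) (vec_fock ((\row_i c i) *m row_base S)).
  rewrite mulmx_sum_row; elim/big_rec2: _ => [|i t u _ G].
    by rewrite vec_fock0; exact: graph0.
  by rewrite mxE vec_fock_linear; exact: graph_linear.
exists b; split=> [i|c c0 i|t Ut].
- by apply/(graph_weight dom irr v_hw w_gl w_gh w_c w_wt nu (bE i)); exact: hw.
- have := sumE c; rewrite c0 => /(graph0r dom v_hw w_gl w_gh w_c w_wt).
  rewrite -(@vec_fock0 C n nu) => /vec_fock_inj/eqP.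
  by rewrite mulmx_free_eq0 ?row_base_free // => /eqP/rowP/(_ i); rewrite !mxE.
have [f G] := graph_total irr v_hw w_gh w_wt t.
have fw : gh_weight nu f by apply/(graph_weight dom irr v_hw w_gl w_gh w_c w_wt nu G).
have [u uE] := vec_fock_onto fw.
have : (u <= row_base S)%MS.
  rewrite eq_row_base; apply/SP; rewrite -uE.
  by have [] := graph_highest w_gl w_wt G.
case/submxP=> c cE; exists (fun i => c 0 i).
have := sumE (fun i => c 0 i); rewrite (_ : (\row_i c 0 i) = c); last first.
  by apply/rowP => i; rewrite mxE.
by rewrite -cE -uE => G'; exact: (graph_funl irr v_hw w_gh w_c w_wt G G').
Qed.

End Character.

(** * Products of level 1 characters *)

Section SeriesProduct.
Variables (I : choiceType) (K : comNzRingType).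
Implicit Types (f g : fps I K) (m a b d : {cmonom I}) (c : K).

Definition fps_single c a : fps I K := fun b => c * (b == a)%:R.

Lemma fps_sum (T : Type) (r : seq T) (P : pred T) (F : T -> fps I K) m :
  (\sum_(i <- r | P i) F i) m = \sum_(i <- r | P i) F i m.
Proof. exact: (big_morph (fun f : fps I K => f m)). Qed.

Lemma fps_singleM c c' a a' :
  fps_single c a * fps_single c' a' = fps_single (c * c') (mmul a a').
Proof.
apply/funext => m; rewrite -[LHS]/(fps_mul _ _ m) /fps_mul /fps_single.
have [->|ne] := eqVneq m (mmul a a').
  rewrite (fsbigE [:: (a, a')]) //=.
  - by rewrite big_cons big_nil ifT ?inE //= !eqxx !mulr1 addr0.
  - by move=> p /=; rewrite inE => /eqP ->.
  move=> [b b'] /= _; rewrite inE xpair_eqE negb_and => /orP[]/negPf ->.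
    by rewrite mulr0 mul0r.
  by rewrite !mulr0.
rewrite mulr0 fsbig1 // => -[b b'] /= bb'.
case: (eqVneq b a) => [ba|_]; last by rewrite mulr0 mul0r.
case: (eqVneq b' a') => [ba'|_]; last by rewrite !mulr0.
by rewrite -bb' ba ba' eqxx in ne.
Qed.

Let agree m f g := forall a, (exists b, mmul a b = m) -> f a = g a.

Let agree_mul m f f' g g' : agree m f f' -> agree m g g' -> agree m (f * g) (f' * g').
Proof.
move=> ff gg a [b ab]; apply: eq_fsbigr => -[x y] /=; rewrite inE /= => xy.
rewrite ff ?gg //; first by exists (mmul x b); rewrite mulmA [mmul y x]mulmC xy.
by exists (mmul y b); rewrite mulmA xy.
Qed.

(** The coefficient at [m] depends only on the values at divisors of [m], so each factor may be
    replaced by a finite sum of monomials and the product expanded. *)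
Lemma fps_prodE n (F : 'I_n -> fps I K) m (S : {fset {cmonom I}}) :
  (forall a b, mmul a b = m -> a \in S) ->
  (\prod_p F p) m = \sum_(t : {ffun 'I_n -> S})
    (\prod_p F p (val (t p))) * (m == \big[mmul/mone]_p val (t p))%:R.
Proof.
move=> SP; pose G p : fps I K := \sum_(s : S) fps_single (F p (val s)) (val s).
have FG : agree m (\prod_p F p) (\prod_p G p).
  apply: (big_ind2 (agree m)) => // [f f' g g'|p _ a [b ab]]; first exact: agree_mul.
  have aS := SP _ _ ab; rewrite /G fps_sum (bigD1 [`aS]%fset) //= /fps_single eqxx mulr1.
  rewrite big1 ?addr0 // => s; rewrite -val_eqE /= eq_sym => /negPf ->.
  by rewrite mulr0.
rewrite FG; last by exists mone; rewrite mulm1.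
rewrite /G bigA_distr_bigA fps_sum; apply: eq_bigr => t _.
rewrite [X in X m](_ : _ = fps_single (\prod_p F p (val (t p))) (\big[mmul/mone]_p val (t p))) //.
elim/big_rec3: _ => [|p a c f _ ->]; last exact: fps_singleM.
by apply/funext => b; rewrite /fps_single mul1r.
Qed.

Lemma big_mmulE (T : Type) (r : seq T) (F : T -> {cmonom I}) i :
  (\big[mmul/mone]_(p <- r) F p) i = (\sum_(p <- r) F p i)%N.
Proof.
elim: r => [|p r IH]; first by rewrite !big_nil -[mone]/(onecm _) cm1.
by rewrite !big_cons cmM IH.
Qed.

End SeriesProduct.

Section ChargeGeneratingFunction.

Definition degree (s : {cmonom int}) : int := \sum_(k <- finsupp s) sgcol k * (s k)%:Z.

Lemma degreeE (S : {fset int}) (s : {cmonom int}) : (finsupp s `<=` S)%fset ->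
  degree s = \sum_(k <- S) sgcol k * (s k)%:Z.
Proof.
move=> sS; rewrite /degree (big_fset_incl _ sS) // => k _.
by rewrite -cmE_eq0 => /eqP ->; rewrite mulr0.
Qed.

(** This will be the character of the level 1 module attached to the integer d. *)
Definition degree_series (d : int) : fps int int := fun s => (degree s == d)%:R.

Variable n : nat.
Local Notation I := (int * 'I_n)%type.
Implicit Types (a b : {cmonom I}) (m s : {cmonom int}) (p : 'I_n) (k : int).

Definition column a p : {cmonom int} := mkcmonom [fsfun k in rows a => a (k, p) | 0%N].

Lemma columnE a p k : column a p k = a (k, p).
Proof. by rewrite cmE fsfunE; case: ifPn => // ka; rewrite (@within_rows _ a). Qed.

Lemma charge_column a p : charge a p = degree (column a p).
Proof.
rewrite (@degreeE (rows a)); first by apply: eq_bigr => k _; rewrite columnE.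
by apply/fsubsetP => k; rewrite -cmE_neq0 columnE; apply: contraNT => /(@within_rows _ a (k, p)) ->.
Qed.

Lemma wtm_columns a m :
  wtm a = monomial_weight m <-> m = \big[mmul/mone]_p column a p.
Proof.
have E k : (\sum_p a (k, p) = (\big[mmul/mone]_p column a p) k)%N.
  by rewrite big_mmulE; apply: eq_bigr => p _; rewrite columnE.
have W k : monomial_weight m k = sgcol k * (m k)%:Z.
  by rewrite /monomial_weight /sgcol; case: ifP; rewrite ?mul1r ?mulN1r.
split=> [aE|mE].
  apply: cmonom_eq => k; rewrite -E; have := congr1 (fun f => f k) aE.
  rewrite /wtm W /sgcol; case: ifP => _; rewrite ?mul1r ?mulN1r.
    by move=> [->].
  by move=> /oppr_inj [->].
by apply/funext => k; rewrite W mE /wtm E.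
Qed.

(** Cutting a monomial into its columns is a bijection onto the factorizations of [m] into n
    monomials, and the charges are the degrees of the factors. *)
Lemma charge_countE m (kappa : 'I_n -> int) :
  (charge_count (monomial_weight m) kappa)%:Z = (\prod_p degree_series (kappa p)) m.
Proof.
pose S : {fset {cmonom int}} := fset_set [set s : {cmonom int} | exists s', mmul s s' = m].
have SP s s' : mmul s s' = m -> s \in S.
  by move=> ss; rewrite in_fset_set ?inE /=; [exists s'|exact: finite_divisors].
have s0S : mone \in S by apply: (SP _ m); rewrite mul1m.
pose s0 : S := [` s0S]%fset.
rewrite (fps_prodE _ SP); pose Q (t : {ffun 'I_n -> S}) :=
  (m == \big[mmul/mone]_p val (t p)) && [forall p, degree (val (t p)) == kappa p].
transitivity (\sum_(t | Q t) (1 : int)); last first.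
  rewrite big_mkcond; apply: eq_bigr => t _; rewrite /Q.
  case: eqP => _ /=; last by rewrite mulr0.
  rewrite mulr1 /degree_series; case: ifP => [/forallP E|/negbT].
    by rewrite big1 // => p _; rewrite E.
  by rewrite negb_forall => /existsP[p /negPf E]; rewrite (bigD1 p) //= E mul0r.
(* For the monomials counted, every column divides [m], so [insubd] returns the column itself. *)
pose cols a : {ffun 'I_n -> S} := [ffun p => insubd s0 (column a p)].
pose P a := [forall p, charge a p == kappa p].
have colsE a p : wtm a = monomial_weight m -> val (cols a p) = column a p.
  move/wtm_columns => mE; rewrite ffunE insubdK //.
  apply: (SP _ (\big[mmul/mone]_(q | q != p) column a q)).
  by rewrite [RHS]mE [RHS](bigD1 p).
have perm : perm_eq [seq cols a | a <- [seq a <- ghfset n (monomial_weight m) | P a]]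
    [seq t <- enum {: {ffun 'I_n -> S}} | Q t].
  apply: uniq_perm; [|by apply: filter_uniq; exact: enum_uniq|].
    rewrite map_inj_in_uniq ?filter_uniq ?fset_uniq // => a b.
    rewrite !mem_filter => /andP[_ /mem_ghfset aw] /andP[_ /mem_ghfset bw] ab.
    apply: cmonom_eq => -[k p]; rewrite -!columnE -!colsE //.
    by rewrite ab.
  move=> t; rewrite mem_filter mem_enum andbT; apply/mapP/idP.
    move=> [a]; rewrite mem_filter => /andP[/forallP Pa /mem_ghfset aw] ->.
    apply/andP; split.
      apply/eqP; rewrite [LHS](wtm_columns a m).1 //; apply: eq_bigr => p _.
      by rewrite colsE.
    by apply/forallP => p; rewrite colsE // -charge_column.
  move=> /andP[/eqP mE /forallP td].
  have tm p k : (val (t p) k <= m k)%N.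
    by rewrite mE big_mmulE (bigD1 p) //= leq_addr.
  pose a : {cmonom I} := mkcmonom [fsfun u in (finsupp m `*` seq_fset tt (enum 'I_n))%fset
     => val (t u.2) u.1 | 0%N].
  have aE p : column a p = val (t p).
    apply: cmonom_eq => k; rewrite columnE cmE fsfunE in_fsetM seq_fsetE mem_enum andbT /=.
    case: ifPn => //; rewrite -cmE_eq0 => /eqP m0; apply/esym/eqP.
    by rewrite -leqn0; apply: leq_trans (tm p k) _; rewrite m0.
  have aw : wtm a = monomial_weight m.
    by apply/wtm_columns; rewrite [LHS]mE; apply: eq_bigr => p _; rewrite aE.
  exists a; last by apply/ffunP => p; apply: val_inj; rewrite colsE // aE.
  rewrite mem_filter; apply/andP; split; last exact/mem_ghfset.
  by apply/forallP => p; rewrite charge_column aE.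
rewrite /charge_count -size_filter -(size_map cols) (perm_size perm).
by rewrite sumr_const natz size_filter -sum1_count big_enum_cond sum1_card.
Qed.

End ChargeGeneratingFunction.

Theorem corollary5p8 (R : realType) (n : nat) (lam : 'I_n -> int)
    (V : ghat_module R) (W : 'I_n -> 'I_n -> ghat_module R) :
  generalized_partition lam ->
  is_L0 (Lambda R lam) V ->
  (forall i j : 'I_n,
     is_L0 (Lambda R (fun _ : 'I_1 => lam i - i%:Z + j%:Z)) (W i j)) ->
  ch V = \det (\matrix_(i < n, j < n) ch (W i j)).
Proof.
move=> lam_gp V_L0 W_L0.
(* For n = 1 there is one permutation, and each monomial is its own column. *)
have chW i j : ch (W i j) = degree_series (lam i - i%:Z + j%:Z).
  apply/funext => m; rewrite (ch_L0 m _ (W_L0 i j)) => [|p q]; last by rewrite !ord1.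
  rewrite (big_pred1 1%g) => [|w]; last by apply/esym/eqP/permP => p; rewrite !ord1.
  rewrite odd_perm1 mul1r charge_countE big_ord1; congr degree_series.
  by rewrite perm1 subrK.
apply/funext => m; rewrite (ch_L0 m _ V_L0) => [|p q /ltnW]; last exact: lam_gp.
rewrite /determinant fps_sum; apply: eq_bigr => w _; rewrite charge_countE.
rewrite [in RHS](eq_bigr (fun i => degree_series (lam i - i%:Z + (w i)%:Z))) => [|i _].
  (* On the left the sign is an integer, on the right a power series. *)
  by rewrite mulr_sign [in RHS]mulr_sign; case: (odd_perm w).
by rewrite mxE chW.
Qed.
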